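(* Let $d\ge 1$ and let $\ell(x)=\frac12\langle x,Mx\rangle-\langle q,x\rangle+c$ for $x\in\mathbb{R}^d$, where $M\in\mathbb{R}^{d\times d}$ is symmetric positive semidefinite, $q\in\operatorname{Span}M$ and $c\in\mathbb{R}$. For each $\varepsilon>0$ let $u_0^\varepsilon\in\mathbb{R}^d$, let $u^\varepsilon:\mathbb{R}_{\ge0}\to\mathbb{R}^d$ be the solution of $$\frac{\mathrm{d}u}{\mathrm{d}t}=-\nabla_u\big(\ell(u\circ u)\big)=-2u\circ\nabla\ell(u\circ u),\qquad u(0)=u_0^\varepsilon,$$ and let $x^\varepsilon=u^\varepsilon\circ u^\varepsilon$. Assume that $u_{0,i}^\varepsilon\ne0$ for all $i\in\{1,\dots,d\}$ and that $$\mu^\varepsilon:=\frac12\Big(\sum_{i=1}^d\log^2|u_{0,i}^\varepsilon|\Big)^{1/2}\xrightarrow[\varepsilon\to0]{}+\infty.$$ Denote $\overline{x}^\varepsilon(s)=x^\varepsilon(\mu^\varepsilon s)$, $s\ge0$. Assume that $\frac{1}{2\mu^\varepsilon}\log|u_0^\varepsilon|$ converges as $\varepsilon\to0$ to some limit $\overline{w}_0\in\mathbb{R}^d_{\le0}\cap(\mathbb{R}^d_{<0}+\operatorname{Span}M)$. Then there exists a unique Lipschitz solution $\overline{w}$ of the mirror flow with mirror potential $\iota_{\mathbb{R}^d_{\ge0}}$ and loss $\ell$ with $\overline{w}(0)=\overline{w}_0$. Let $\overline{x}$ be an associated primal variable and let $S>0$. Then: (a) As $\varepsilon\to0$, $\nabla\ell(\overline{x}^\varepsilon(s))\to\nabla\ell(\overline{x}(s))$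 in $L^2([0,S],\mathbb{R}^d,s\,\mathrm{d}s)$, and $$\ell(\overline{x}^\varepsilon(s))\to\ell(\overline{x}(s))=\min_{y\ge0,\ \langle\overline{w}(s),y\rangle=0}\ell(y)\quad\text{in }L^1([0,S],\mathbb{R},s\,\mathrm{d}s)$$ (the equality holding for a.e. $s\in[0,S]$). (b) Let $\overline{y}:[0,S]\to\mathbb{R}^d$ be such that there exists a sequence $\varepsilon_k\to0$ with $\overline{x}^{\varepsilon_k}(s)\to\overline{y}(s)$ as $k\to\infty$ for a.e. $s\in[0,S]$. Then for a.e. $s\in[0,S]$, $\overline{y}(s)\in\operatorname{Argmin}_{y\ge0,\ \langle\overline{w}(s),y\rangle=0}\ell(y)$.
   Context: $\circ$ is the componentwise product of vectors; functions such as $\log$ and $|\cdot|$ are applied to vectors componentwise; $y\ge0$ means all coordinates are nonnegative; $\mathbb{R}^d_{\ge 0},\mathbb{R}^d_{\le0},\mathbb{R}^d_{<0}$ are the sets of vectors with all coordinates nonnegative, nonpositive, negative. $\operatorname{Span}M$ is the column span of $M$. $\iota_C$ is the indicator function of $C$ ($0$ on $C$, $+\infty$ elsewhere). $\operatorname{Argmin}$ denotes the set of minimizers. $L^p(I,\mathbb{R}^m,s\,\mathrm{d}s)$ is the $L^p$ space with respect to the measure of density $s$ with respect to Lebesgue measure. Mirror flow: for a proper convex lower semicontinuous $g:\mathbb{R}^d\to\mathbb{R}\cup\{+\infty\}$, a function $w:\mathbb{R}_{\ge0}\to\mathbb{R}^d$ is a solution of the mirror flow with mirror potential $g$ and loss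 $\ell$ if there exists $x:\mathbb{R}_{\ge0}\to\mathbb{R}^d$ such that for a.e. $t\ge0$, $w$ is differentiable at $t$ and $\frac{\mathrm{d}w}{\mathrm{d}t}(t)=-\nabla\ell(x(t))$, $w(t)\in\partial g(x(t))$ (convex subdifferential). Any such $x$ is called an associated primal variable. *)

(* Defs.v *)
From HB Require Import structures.
From mathcomp Require Export all_boot all_order all_algebra.
From mathcomp Require Export all_classical all_reals all_analysis.

Set Implicit Arguments.
Unset Strict Implicit.
Unset Printing Implicit Defensive.

Export Order.TTheory GRing.Theory Num.Theory.
Export numFieldNormedType.Exports.

Local Open Scope classical_set_scope.
Local Open Scope ring_scope.

(* Points of R^d are column vectors 'cV[R]_d. Functions of time defined on
   [0, +oo[ or on [0, S] are represented by functions on the whole of R of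
   which only the values on that interval are ever used. *)

Definition inner {R : realType} {d : nat} (x y : 'cV[R]_d) : R :=
  \sum_(i < d) x i 0 * y i 0.

(* The library norm `|x| on 'cV[R]_d is the sup norm. *)
Definition enorm {R : realType} {d : nat} (x : 'cV[R]_d) : R :=
  Num.sqrt (inner x x).

Definition hadamard {R : realType} {d : nat} (x y : 'cV[R]_d) : 'cV[R]_d :=
  \col_i (x i 0 * y i 0).

Definition log_abs {R : realType} {d : nat} (u : 'cV[R]_d) : 'cV[R]_d :=
  \col_i ln `|u i 0|.

Definition colspan {R : realType} {d : nat} (M : 'M[R]_d) : set 'cV[R]_d :=
  [set M *m z | z in [set: 'cV[R]_d]].

Definition vec_nonneg {R : realType} (d : nat) : set 'cV[R]_d :=
  [set y | forall i, 0 <= y i 0].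
Definition vec_nonpos {R : realType} (d : nat) : set 'cV[R]_d :=
  [set y | forall i, y i 0 <= 0].
Definition vec_neg {R : realType} (d : nat) : set 'cV[R]_d :=
  [set y | forall i, y i 0 < 0].

Definition minkowski_sum {V : zmodType} (A B : set V) : set V :=
  [set a + b | a in A & b in B].

Definition argmin {R : realType} {T : Type} (A : set T) (f : T -> R) : set T :=
  [set y | A y /\ forall z, A z -> f y <= f z].

Definition is_min_value {R : realType} {T : Type}
    (A : set T) (f : T -> R) (m : R) : Prop :=
  (f @` A) m /\ lbound (f @` A) m.

Definition grad {R : realType} {d : nat} (f : 'cV[R]_d -> R) (x : 'cV[R]_d) :
    'cV[R]_d :=
  \col_i 'D_(delta_mx i 0) f x.

Definition quadratic {R : realType} {d : nat}
    (M : 'M[R]_d) (q : 'cV[R]_d) (c : R) (x : 'cV[R]_d) : R :=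
  2^-1 * inner x (M *m x) - inner q x + c.

(* At t = 0 the differential equation is only required in the sense that u is
   continuous from the right there; the one-sided derivative at 0 then exists
   and satisfies the equation as soon as the gradient of f is continuous. *)
Definition gradient_flow {R : realType} {d : nat}
    (f : 'cV[R]_d -> R) (u0 : 'cV[R]_d) (u : R -> 'cV[R]_d) : Prop :=
  [/\ {within `[0, +oo[, continuous u},
      u 0 = u0 &
      forall t : R, 0 < t -> is_derive t 1 u (- grad f (u t))].

Definition indicator_fun {R : realType} {T : Type} (C : set T) (x : T) :
    \bar R :=
  if `[< C x >] then 0%E else +oo%E.

(* When g is proper, this set is empty at the points where g is +oo. *)
Definition subdifferential {R : realType} {d : nat}
    (g : 'cV[R]_d -> \bar R) (x : 'cV[R]_d) : set 'cV[R]_d :=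
  [set p | forall y, (g x + (inner p (y - x))%:E <= g y)%E].

Definition associated_primal {R : realType} {d : nat}
    (g : 'cV[R]_d -> \bar R) (l : 'cV[R]_d -> R) (w x : R -> 'cV[R]_d) : Prop :=
  {ae @lebesgue_measure R, forall t : R, 0 <= t ->
    is_derive t 1 w (- grad l (x t)) /\ subdifferential g (x t) (w t)}.

Definition mirror_flow {R : realType} {d : nat}
    (g : 'cV[R]_d -> \bar R) (l : 'cV[R]_d -> R) (w : R -> 'cV[R]_d) : Prop :=
  exists x : R -> 'cV[R]_d, associated_primal g l w x.

Definition Lipschitz_mirror_flow {R : realType} {d : nat}
    (g : 'cV[R]_d -> \bar R) (l : 'cV[R]_d -> R)
    (w0 : 'cV[R]_d) (w : R -> 'cV[R]_d) : Prop :=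
  [/\ [lipschitz w s | s in `[0, +oo[],
      mirror_flow g l w &
      w 0 = w0].

(* The space L^p([0, S], R^n, s ds), for finite p. Lebesgue measure is carried
   by the Borel sigma-algebra, so that the usual class of measurable functions
   is that of functions equal almost everywhere to a Borel function. The library
   integral of a nonnegative function is a supremum over the simple functions
   below it, so it does not depend on the values taken on a null set, even when
   the integrand itself is not Borel. *)
Definition ae_measurable {R : realType} (D : set R) (f : R -> R) : Prop :=
  exists2 h : R -> R, measurable_fun D h &
    {ae @lebesgue_measure R, forall s, D s -> f s = h s}.

Definition Lp_norm {R : realType} {n : nat} (S p : R) (f : R -> 'cV[R]_n) :
    \bar R :=
  ((\int[@lebesgue_measure R]_(s in `[0%R, S]) (enorm (f s) `^ p * s)%:E)
    `^ p^-1)%E.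

Definition in_Lp {R : realType} {n : nat} (S p : R) (f : R -> 'cV[R]_n) : Prop :=
  (forall i, ae_measurable `[0, S] (fun s => f s i 0)) /\
  (Lp_norm S p f < +oo)%E.

Definition cvg_Lp {R : realType} {n : nat} {T : Type} (S p : R)
    (F : set_system T) (f_ : T -> R -> 'cV[R]_n) (f : R -> 'cV[R]_n) : Prop :=
  [/\ \forall e \near F, in_Lp S p (f_ e),
      in_Lp S p f &
      Lp_norm S p (fun s => f_ e s - f s) @[e --> F] --> 0%E].

(* Real-valued functions, via R = R^1. *)
Definition cvg_Lp_scalar {R : realType} {T : Type} (S p : R)
    (F : set_system T) (f_ : T -> R -> R) (f : R -> R) : Prop :=
  cvg_Lp S p F (fun e s => (f_ e s)%:M : 'cV[R]_1) (fun s => (f s)%:M).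

(* The set {y >= 0, <w, y> = 0}. *)
Definition feasible {R : realType} {d : nat} (w : 'cV[R]_d) : set 'cV[R]_d :=
  [set y | vec_nonneg y /\ inner w y = 0].

Definition log_scale {R : realType} {d : nat} (u0 : 'cV[R]_d) : R :=
  2^-1 * Num.sqrt (\sum_(i < d) ln `|u0 i 0| ^+ 2).

(* Main.v *)
(** Put [q = M p] and [w = log x / (4 mu)]. In the slow time the flow becomes
    [w' = - M (x - p)] with [x = exp (4 mu w)], the mirror flow of an entropic
    potential. Along it [F = (4 mu)^-1 sum_i x_i - <p, w>] is convex in time, with
    [F' = - |x - p|_M^2]. A strictly negative point of [w0 + Span M] controls
    [sum_i x_i] through a Gronwall inequality, and monotonicity of the exponential
    then makes the family [w] uniformly Cauchy, in the dual form of [M], on bounded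
    time intervals. In the limit [F] becomes the convex function
    [Fbar = - <p, wbar>], and [wbar] is differentiable at every time where the
    slopes of [Fbar] agree, that is, off a countable set; there
    [wbar' = - M (y - p)] for every cluster point [y] of [x], which is feasible for
    [wbar]. Since [<z, wbar>] is maximal at [s] for every feasible [z], [wbar' s] is
    orthogonal to the feasible set, which is the optimality condition for [y].
    Slopes of convex functions converge to the derivative of their limit, so that
    [|x - p|_M^2] converges to [|y - p|_M^2], and with it the gradients. The passage to
    [L^p] is dominated convergence away from [s = 0]; near [0] the
    integral of [s |x - p|_M^2] is at most the decrease of a Lyapunov function, which
    is small there. *)

Require Import Defs.
From mathcomp Require Import ring lra measurable_realfun.

Set Implicit Arguments.
Unset Strict Implicit.
Unset Printing Implicit Defensive.

Local Open Scope classical_set_scope.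
Local Open Scope ring_scope.

(** * Positive semidefinite forms *)

(** The gradient sees [x] only through [M], so limits are taken on [w], measured by [v -> <v, P v>]
    with [M P M = M]; this form is definite on the span of [M] only. Initial data may differ by
    vectors outside that span, so two flows are compared after subtracting their initial gap, and
    each flow gets its own anchor [a = w 0 - M zeta]. Two flows have two different potentials, so
    the usual contraction argument leaves the cross terms [<x1, w2>] and [<x2, w1>]. For large [b]
    the coordinates of [w] are at most a small [k], so these terms cost at most [k] times the mass
    [sum_i x_i]. No pointwise bound on the mass is available near time [0], but it enters the
    derivative of the squared distance to the anchor with the factor [- 2 eta], so a multiple of
    that distance absorbs it. For the same reason the potentials converge at positive times only,
    and the estimate needed at time [0] follows by continuity. The primal variable of the limit is
    an arbitrary function constrained almost everywhere; its measurability is recovered from limits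
    superior of the approximations. *)

Section inner_product.
Context {R : realType} {d : nat}.
Implicit Types (x y z : 'cV[R]_d) (A : 'M[R]_d).

Lemma innerC x y : inner x y = inner y x.
Proof. by apply: eq_bigr => i _; rewrite mulrC. Qed.

Lemma innerDl x y z : inner (x + y) z = inner x z + inner y z.
Proof. by rewrite /inner -big_split; apply: eq_bigr => i _; rewrite mxE mulrDl. Qed.

Lemma innerZl k x y : inner (k *: x) y = k * inner x y.
Proof. by rewrite /inner mulr_sumr; apply: eq_bigr => i _; rewrite mxE mulrA. Qed.

Lemma innerNl x y : inner (- x) y = - inner x y.
Proof. by rewrite -scaleN1r innerZl mulN1r. Qed.

Lemma innerBl x y z : inner (x - y) z = inner x z - inner y z.
Proof. by rewrite innerDl innerNl. Qed.

Lemma inner0l x : inner 0 x = 0.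
Proof. by rewrite -(scale0r 0) innerZl mul0r. Qed.

Lemma innerDr x y z : inner z (x + y) = inner z x + inner z y.
Proof. by rewrite ![inner z _]innerC innerDl. Qed.

Lemma innerZr k x y : inner y (k *: x) = k * inner y x.
Proof. by rewrite ![inner y _]innerC innerZl. Qed.

Lemma innerNr x y : inner y (- x) = - inner y x.
Proof. by rewrite ![inner y _]innerC innerNl. Qed.

Lemma innerBr x y z : inner z (x - y) = inner z x - inner z y.
Proof. by rewrite innerDr innerNr. Qed.

Lemma inner0r x : inner x 0 = 0.
Proof. by rewrite innerC inner0l. Qed.

Lemma colB x y i : (x - y) i 0 = x i 0 - y i 0.
Proof. by rewrite !mxE. Qed.

Lemma inner_delta i x : inner (delta_mx i 0) x = x i 0.
Proof.
rewrite /inner (bigD1 i) //= mxE !eqxx mul1r big1 ?addr0 // => j ji.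
by rewrite mxE (negPf ji) mul0r.
Qed.

Lemma inner_mulmx A x y : inner (A *m x) y = inner x (A^T *m y).
Proof.
have E u v : inner u v = (u^T *m v) 0 0.
  by rewrite mxE; apply: eq_bigr => i _; rewrite !mxE.
by rewrite !E trmx_mul mulmxA.
Qed.

End inner_product.

Section psd_form.
Context {R : realType} {d : nat} (M : 'M[R]_d).
Hypothesis M_sym : M^T = M.
Hypothesis M_psd : forall x : 'cV[R]_d, 0 <= inner x (M *m x).
Implicit Types (x y z v : 'cV[R]_d).

Definition sqf x := inner x (M *m x).

Lemma inner_symmx x y : inner x (M *m y) = inner y (M *m x).
Proof. by rewrite innerC inner_mulmx M_sym. Qed.

Lemma sqf_ge0 x : 0 <= sqf x. Proof. exact: M_psd. Qed.

Lemma sqfDZ k x y : sqf (x + k *: y) = sqf x + 2 * k * inner x (M *m y) + k ^+ 2 * sqf y.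
Proof.
rewrite /sqf mulmxDr -scalemxAr !innerDl !innerDr !innerZl !innerZr (inner_symmx y x).
ring.
Qed.

Lemma sqfB x y : sqf (x - y) = sqf x - 2 * inner x (M *m y) + sqf y.
Proof. by rewrite -scaleN1r sqfDZ; ring. Qed.

Lemma sqfZ k x : sqf (k *: x) = k ^+ 2 * sqf x.
Proof. by rewrite /sqf -scalemxAr innerZl innerZr; ring. Qed.

Lemma sqfN x : sqf (- x) = sqf x.
Proof. by rewrite -scaleN1r sqfZ; ring. Qed.

Lemma sqf_CS x y : inner x (M *m y) ^+ 2 <= sqf x * sqf y.
Proof.
set b := inner _ _; set a := sqf x; set e := sqf y.
have a0 : 0 <= a by exact: sqf_ge0.
have e0 : 0 <= e by exact: sqf_ge0.
have K k : 0 <= a + 2 * k * b + k ^+ 2 * e by rewrite -sqfDZ sqf_ge0.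
have [e_eq0|e_neq0] := eqVneq e 0.
  have [->|b0] := eqVneq b 0; first by rewrite expr0n mulr_ge0.
  (* When [e = 0] the quadratic in [k] is affine, and this [k] gives it the value [-1]. *)
  have := K (- (a + 1) / (2 * b)).
  rewrite e_eq0 mulr0 addr0.
  have -> : 2 * (- (a + 1) / (2 * b)) * b = - (a + 1) by field.
  lra.
have e_gt0 : 0 < e by rewrite lt_neqAle eq_sym e_neq0.
have := K (- b / e).
have -> : a + 2 * (- b / e) * b + (- b / e) ^+ 2 * e = a - b ^+ 2 / e by field.
by rewrite subr_ge0 ler_pdivrMr.
Qed.

Lemma sqf_delta i : sqf (delta_mx i 0) = M i i.
Proof.
rewrite /sqf inner_delta mxE (bigD1 i) //= big1 => [|j ji].
  by rewrite mxE !eqxx mulr1 addr0.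
by rewrite mxE (negPf ji) mulr0.
Qed.

Lemma diag_ge0 i : 0 <= M i i.
Proof. by rewrite -sqf_delta sqf_ge0. Qed.

(** Cauchy-Schwarz against a basis vector. This is how bounds in the seminorm, which is blind to the
    kernel of [M], become bounds on coordinates. *)
Lemma mulmx_coord_sq x i : (M *m x) i 0 ^+ 2 <= M i i * sqf x.
Proof. by rewrite -inner_delta -sqf_delta; exact: sqf_CS. Qed.

Variable P : 'M[R]_d.
Hypothesis MPM : M *m P *m M = M.

(* On the column span of [M] the form [pinvf] is the dual of [sqf]. *)
Definition pinvf v := inner v (P *m v).
(** Given [M P M = M], this is membership in the column span of [M], as an equation that names the
    preimage [P v]. *)
Definition in_span v := M *m (P *m v) = v.

Lemma in_span_mul x : in_span (M *m x).
Proof. by rewrite /in_span !mulmxA MPM. Qed.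

Lemma in_spanD u v : in_span u -> in_span v -> in_span (u + v).
Proof. by rewrite /in_span !mulmxDr => -> ->. Qed.

Lemma in_spanZ k u : in_span u -> in_span (k *: u).
Proof. by rewrite /in_span -!scalemxAr => ->. Qed.

Lemma in_spanN u : in_span u -> in_span (- u).
Proof. by rewrite /in_span !mulmxN => ->. Qed.

Lemma in_spanB u v : in_span u -> in_span v -> in_span (u - v).
Proof. by move=> hu /in_spanN; exact: in_spanD. Qed.

Lemma pinvfE v : in_span v -> pinvf v = sqf (P *m v).
Proof. by move=> {1 2}<-; rewrite /pinvf /sqf innerC; congr inner; rewrite !mulmxA MPM. Qed.

Lemma pinvf_ge0 v : in_span v -> 0 <= pinvf v.
Proof. by move=> /pinvfE ->; exact: sqf_ge0. Qed.

Lemma pinvf_mul x : pinvf (M *m x) = sqf x.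
Proof. by rewrite /pinvf inner_mulmx M_sym !mulmxA MPM. Qed.

Lemma pinvf_CS x v : in_span v -> inner x v ^+ 2 <= sqf x * pinvf v.
Proof. by move=> vM; rewrite pinvfE // -{1}vM; exact: sqf_CS. Qed.

Lemma pinvf_coord_sq v i : in_span v -> v i 0 ^+ 2 <= M i i * pinvf v.
Proof. by move=> vM; rewrite pinvfE // -{1}vM; exact: mulmx_coord_sq. Qed.

(* The two halves of the derivative of [pinvf] along a curve staying in a
   translate of the column span agree, although [P] need not be
   symmetric. *)
Lemma pinvf_polar x v : in_span v ->
  inner (M *m x) (P *m v) + inner v (P *m (M *m x)) = 2 * inner x v.
Proof.
move=> vM; rewrite inner_mulmx M_sym vM -{2}vM inner_mulmx M_sym.
have -> : M *m (P *m (M *m x)) = M *m x by rewrite !mulmxA MPM.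
by rewrite inner_symmx vM; ring.
Qed.

End psd_form.

(** * Calculus along curves *)

Section calculus.
Context {R : realType}.

Lemma cvg_sum_ord {T : Type} (F : set_system T) {FF : Filter F} n
    (f : 'I_n -> T -> R) (a : 'I_n -> R) :
  (forall i, f i x @[x --> F] --> a i) ->
  \sum_(i < n) f i x @[x --> F] --> \sum_(i < n) a i.
Proof. by move=> fa; apply: cvg_big => //; exact: add_continuous. Qed.

Lemma derive_le0_le (f df : R -> R) a b : a <= b ->
  {within `[a, b], continuous f} ->
  (forall t, a < t < b -> is_derive t 1 f (df t)) ->
  (forall t, a < t < b -> df t <= 0) -> f b <= f a.
Proof.
rewrite le_eqVlt => /predU1P[->//|ab] fc fd df0.
have fd' t : t \in `]a, b[ -> is_derive t 1 f (df t) by rewrite in_itv; exact: fd.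
have [c cab E] := MVT ab fd' fc.
rewrite -subr_le0 E mulr_le0_ge0 ?subr_ge0 ?(ltW ab) //.
by apply: df0; move: cab; rewrite in_itv.
Qed.

Lemma derive_ge0_le (f df : R -> R) a b : a <= b ->
  {within `[a, b], continuous f} ->
  (forall t, a < t < b -> is_derive t 1 f (df t)) ->
  (forall t, a < t < b -> 0 <= df t) -> f a <= f b.
Proof.
rewrite le_eqVlt => /predU1P[->//|ab] fc fd df0.
have fd' t : t \in `]a, b[ -> is_derive t 1 f (df t) by rewrite in_itv; exact: fd.
have [c cab E] := MVT ab fd' fc.
rewrite -subr_ge0 E mulr_ge0 ?subr_ge0 ?(ltW ab) //.
by apply: df0; move: cab; rewrite in_itv.
Qed.

Lemma derive_eq0_eq (f : R -> R) a b : a <= b ->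
  {within `[a, b], continuous f} ->
  (forall t, a < t < b -> is_derive t 1 f 0) -> f a = f b.
Proof.
move=> ab fc fd; apply/eqP.
by rewrite eq_le (derive_ge0_le ab fc fd) // (derive_le0_le ab fc fd).
Qed.

Lemma is_derive_sum_fun n (f : 'I_n -> R -> R) (df : 'I_n -> R) (t : R) :
  (forall i, is_derive t 1 (f i) (df i)) ->
  is_derive t 1 (fun s => \sum_(i < n) f i s) (\sum_(i < n) df i).
Proof.
move=> fd; have := is_derive_sum fd.
by rewrite (_ : \sum_(i < n) f i = fun s => \sum_(i < n) f i s) // funeqE => s; rewrite fct_sumE.
Qed.

Lemma is_deriveM_fun (f g : R -> R) (t df dg : R) :
  is_derive t 1 f df -> is_derive t 1 g dg ->
  is_derive t 1 (fun s => f s * g s) (df * g t + f t * dg).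
Proof.
by move=> fd gd; have := is_deriveM fd gd => h; apply: is_derive_eq h _; rewrite addrC mulrC.
Qed.

Lemma is_deriveD_fun (f g : R -> R) (t df dg : R) :
  is_derive t 1 f df -> is_derive t 1 g dg ->
  is_derive t 1 (fun s => f s + g s) (df + dg).
Proof. by move=> fd gd; exact: is_deriveD. Qed.

Lemma is_deriveB_fun (f g : R -> R) (t df dg : R) :
  is_derive t 1 f df -> is_derive t 1 g dg ->
  is_derive t 1 (fun s => f s - g s) (df - dg).
Proof. by move=> fd gd; exact: is_deriveB. Qed.

Lemma is_deriveZ_fun k (f : R -> R) (t df : R) :
  is_derive t 1 f df -> is_derive t 1 (fun s => k * f s) (k * df).
Proof. by move=> fd; exact: (is_deriveZ k fd). Qed.

Lemma is_derive_expR_fun (f : R -> R) (t df : R) :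
  is_derive t 1 f df -> is_derive t 1 (fun s => expR (f s)) (expR (f t) * df).
Proof. by move=> fd; exact: (is_derive1_comp (is_derive_expR (f t)) fd). Qed.

Lemma is_derive_lin k (t : R) : is_derive t 1 (fun s : R => k * s) k.
Proof. by apply: is_derive_eq (is_deriveZ_fun k (is_derive_id t 1)) _; rewrite mulr1. Qed.

End calculus.

Section curves.
Context {R : realType} {d : nat}.
Implicit Types (f g : R -> 'cV[R]_d) (A : 'M[R]_d) (t : R).

Definition col_derive f (t : R) (df : 'cV[R]_d) :=
  forall i, is_derive t 1 (fun s => f s i 0) (df i 0).
Definition col_continuous f := forall i, continuous (fun s => f s i 0).

Lemma col_deriveP f t df : is_derive t 1 f df <-> col_derive f t df.
Proof.
split=> [fd i|fd].
  have /derivable_mxP fdi := @ex_derive _ _ _ _ _ _ _ fd.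
  have := derivableP (fdi i 0) => h; apply: is_derive_eq h _.
  by rewrite -(@derive_val _ _ _ _ _ _ _ fd) derive_mx ?mxE //; exact: ex_derive.
have fm : derivable f t 1.
  by apply/derivable_mxP => i j; rewrite (ord1 j); exact: ex_derive.
split=> //; rewrite derive_mx //; apply/matrixP => i j; rewrite mxE (ord1 j).
exact: derive_val.
Qed.

Lemma col_derive_cst v t : col_derive (fun=> v) t 0.
Proof. by move=> i; rewrite mxE; exact: is_derive_cst. Qed.

Lemma col_deriveD f g t df dg : col_derive f t df -> col_derive g t dg ->
  col_derive (fun s => f s + g s) t (df + dg).
Proof.
move=> fd gd i; rewrite mxE.
rewrite (_ : (fun s => _) = (fun s => f s i 0 + g s i 0)); last by apply/funext => s; rewrite mxE.
exact: is_deriveD_fun.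
Qed.

Lemma col_deriveZ k f t df : col_derive f t df ->
  col_derive (fun s => k *: f s) t (k *: df).
Proof.
move=> fd i; rewrite mxE.
rewrite (_ : (fun s => _) = (fun s => k * f s i 0)); last by apply/funext => s; rewrite mxE.
exact: is_deriveZ_fun.
Qed.

Lemma col_deriveB f g t df dg : col_derive f t df -> col_derive g t dg ->
  col_derive (fun s => f s - g s) t (df - dg).
Proof.
move=> fd gd; rewrite -[- dg]scaleN1r.
under [X in col_derive X]eq_fun do rewrite -[- g _]scaleN1r.
exact/col_deriveD/col_deriveZ.
Qed.

Lemma col_derive_mulmx A f t df : col_derive f t df ->
  col_derive (fun s => A *m f s) t (A *m df).
Proof.
move=> fd i; rewrite mxE.
rewrite (_ : (fun s => _) = (fun s => \sum_j A i j * f s j 0)); last by apply/funext => s; rewrite mxE.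
by apply: is_derive_sum_fun => j; exact: is_deriveZ_fun.
Qed.

Lemma is_derive_inner f g t df dg : col_derive f t df -> col_derive g t dg ->
  is_derive t 1 (fun s => inner (f s) (g s)) (inner df (g t) + inner (f t) dg).
Proof.
move=> fd gd; rewrite /inner -big_split /=.
by apply: is_derive_sum_fun => i; exact: is_deriveM_fun.
Qed.

Lemma col_continuous_cst v : col_continuous (fun=> v).
Proof. by move=> i; exact: cst_continuous. Qed.

Lemma col_continuousD f g : col_continuous f -> col_continuous g ->
  col_continuous (fun s => f s + g s).
Proof.
move=> fc gc i; under [X in continuous X]eq_fun do rewrite mxE.
by move=> s; apply: cvgD; [exact: fc|exact: gc].
Qed.

Lemma col_continuousZ k f : col_continuous f -> col_continuous (fun s => k *: f s).
Proof.
move=> fc i; under [X in continuous X]eq_fun do rewrite mxE.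
by move=> s; apply: cvgM; [exact: cvg_cst|exact: fc].
Qed.

Lemma col_continuousB f g : col_continuous f -> col_continuous g ->
  col_continuous (fun s => f s - g s).
Proof.
move=> fc gc; under [X in col_continuous X]eq_fun do rewrite -[- g _]scaleN1r.
exact/col_continuousD/col_continuousZ.
Qed.

Lemma col_continuous_mulmx A f : col_continuous f -> col_continuous (fun s => A *m f s).
Proof.
move=> fc i; under [X in continuous X]eq_fun do rewrite mxE.
move=> s; apply: cvg_sum_ord => j.
by apply: cvgM; [exact: cvg_cst|exact: fc].
Qed.

Lemma continuous_inner f g : col_continuous f -> col_continuous g ->
  continuous (fun s => inner (f s) (g s)).
Proof.
by move=> fc gc s; apply: cvg_sum_ord => j; apply: cvgM; [exact: fc|exact: gc].
Qed.

End curves.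

(** * The flow in the dual variable *)

Section entropic_flow.
Context {R : realType} {d : nat}.
Variables (M P : 'M[R]_d) (p : 'cV[R]_d).
Hypothesis M_sym : M^T = M.
Hypothesis M_psd : forall x : 'cV[R]_d, 0 <= inner x (M *m x).
Hypothesis MPM : M *m P *m M = M.
Implicit Types (v a : 'cV[R]_d) (r s t : R).

Definition expcol (b : R) v : 'cV[R]_d := \col_i expR (b * v i 0).
Definition mass (b : R) v : R := \sum_i expR (b * v i 0).

(* In the dual variable [w = log x / b] the flow is the gradient flow of [pot],
   for the geometry of [M], and [speed2] is its squared velocity. *)
Definition pot (b : R) v : R := b^-1 * mass b v - inner p v.
Definition speed2 (b : R) v : R := sqf M (expcol b v - p).
(** Continuity is required on the whole line, so that no one-sided topology at [0] is needed; paths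
    are frozen at negative times when this is applied, with [b = 4 mu]. *)
Definition entropic_flow (b : R) (w : R -> 'cV[R]_d) : Prop :=
  col_continuous w /\
  forall t : R, 0 < t -> col_derive w t (- (M *m (expcol b (w t) - p))).

Lemma mass_ge0 b v : 0 <= mass b v.
Proof. by apply: sumr_ge0 => i _; exact: expR_ge0. Qed.

Lemma inner_expcol_ub b v a k : (forall i, a i 0 <= k) -> inner (expcol b v) a <= k * mass b v.
Proof.
move=> ak; rewrite /inner /mass mulr_sumr; apply: ler_sum => i _.
by rewrite mxE mulrC ler_wpM2r ?expR_ge0.
Qed.

(* [- t log t <= 1] with [t = e^{b v_i}] *)
Lemma inner_expcol_self b v : 0 < b -> - inner (expcol b v) v <= d%:R / b.
Proof.
move=> b0; rewrite /inner -sumrN.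
have -> : d%:R / b = \sum_(i < d) b^-1 :> R.
  by rewrite sumr_const card_ord mulrC -[RHS]mulr_natr.
apply: ler_sum => i _; rewrite mxE.
set y := b * v i 0.
have -> : v i 0 = y / b by rewrite /y mulrC mulKf // gt_eqF.
rewrite mulrA -mulNr ler_piMl ?invr_ge0 ?(ltW b0) //.
have := expR_ge1Dx (- y); rewrite expRN => h.
have e0 := expR_gt0 y.
have : (1 - y) * expR y <= 1 by rewrite -ler_pdivlMr ?div1r.
rewrite mulrBl mul1r; lra.
Qed.

(** [expcol b v - p] is the gradient of [pot b] at [v]; on each coordinate the bound is
    [1 + y <= e^y]. *)
Lemma pot_convex b v a : 0 < b -> inner (expcol b v - p) (a - v) <= pot b a - pot b v.
Proof.
move=> b0; rewrite innerBl !innerBr /pot.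
suff: inner (expcol b v) a - inner (expcol b v) v <= b^-1 * mass b a - b^-1 * mass b v by lra.
rewrite -mulrBr mulrC ler_pdivlMr // /inner /mass -!sumrB mulr_suml.
apply: ler_sum => i _; rewrite mxE.
have := expR_ge1Dx (b * (a i 0 - v i 0)).
rewrite mulrBr expRB ler_pdivlMr ?expR_gt0 //.
lra.
Qed.

Section one_flow.
Variables (b : R) (w : R -> 'cV[R]_d).
Hypothesis b_gt0 : 0 < b.
Hypothesis wflow : entropic_flow b w.

Let w_cont : col_continuous w := wflow.1.
Let w_der (t : R) (t0 : 0 < t) : col_derive w t (- (M *m (expcol b (w t) - p))) := wflow.2 t t0.

Let pos_of (s t r : R) : 0 <= s -> s < r < t -> 0 < r.
Proof. by move=> s0 /andP[sr _]; exact: le_lt_trans sr. Qed.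

(** [M P - 1] annihilates the velocity, which is a multiple of [M], so [(M P - 1) w] is constant in
    time. *)
Lemma flow_in_span s t : 0 <= s -> s <= t -> in_span M P (w t - w s).
Proof.
move=> s0 st; rewrite /in_span; apply/eqP; rewrite -subr_eq0; apply/eqP.
pose A := M *m P - 1%:M.
have -> : M *m (P *m (w t - w s)) - (w t - w s) = A *m w t - A *m w s.
  by rewrite -mulmxBr mulmxBl mul1mx -mulmxA.
apply/eqP; rewrite subr_eq0; apply/eqP/matrixP => i j; rewrite (ord1 j).
symmetry; apply: (derive_eq0_eq (f := fun r => (A *m w r) i 0) st).
  by apply: continuous_subspaceT; exact: col_continuous_mulmx.
move=> r /(pos_of s0) /w_der /(col_derive_mulmx A) /(_ i).
by rewrite mulmxN mulmxA mulmxBl mul1mx MPM subrr mul0mx oppr0 mxE.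
Qed.

Lemma col_continuous_expcol : col_continuous (fun t => expcol b (w t)).
Proof.
move=> i; under [X in continuous X]eq_fun do rewrite mxE.
move=> t; apply: continuous_comp; last exact: continuous_expR.
by apply: cvgM; [exact: cvg_cst|exact: w_cont].
Qed.

Lemma continuous_mass : continuous (fun t => mass b (w t)).
Proof.
move=> t; apply: cvg_sum_ord => i.
by have := @col_continuous_expcol i t; under eq_fun do rewrite mxE.
Qed.

Lemma continuous_pot : continuous (fun t => pot b (w t)).
Proof.
move=> t; apply: cvgB; first by apply: cvgM; [exact: cvg_cst|exact: continuous_mass].
by apply: continuous_inner => //; exact: col_continuous_cst.
Qed.

Lemma continuous_speed2 : continuous (fun t => speed2 b (w t)).
Proof.
have h : col_continuous (fun t => expcol b (w t) - p).
  by apply: col_continuousB; [exact: col_continuous_expcol|exact: col_continuous_cst].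
by apply: continuous_inner => //; exact: col_continuous_mulmx.
Qed.

Lemma is_derive_pot t : 0 < t -> is_derive t 1 (fun s => pot b (w s)) (- speed2 b (w t)).
Proof.
move=> t0; have wd := w_der t0.
have dm : is_derive t 1 (fun s => mass b (w s))
    (\sum_i expR (b * w t i 0) * (b * (- (M *m (expcol b (w t) - p))) i 0)).
  by apply: is_derive_sum_fun => i; apply: is_derive_expR_fun; exact: is_deriveZ_fun.
have := is_deriveB_fun (is_deriveZ_fun b^-1 dm) (is_derive_inner (col_derive_cst p t) wd).
move=> h; apply: is_derive_eq h _; rewrite inner0l add0r /speed2 /sqf innerBl.
rewrite innerNr opprK opprB addrC; congr (_ + _).
rewrite mulr_sumr /inner -sumrN; apply: eq_bigr => i _; rewrite !mxE.
by field; rewrite gt_eqF.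
Qed.

(** With [x = e^{b w}] one has [x_i' = - b x_i (M (x - p))_i], so the derivative is
    [- 2 b sum_i x_i (M (x - p))_i^2]. This is the convexity in time of the potential. *)
Lemma speed2_nincr s t : 0 <= s -> s <= t -> speed2 b (w t) <= speed2 b (w s).
Proof.
move=> s0 st.
pose dx r := \col_i (expR (b * w r i 0) * (b * (- (M *m (expcol b (w r) - p))) i 0)) : 'cV[R]_d.
apply: (derive_le0_le (f := fun r => speed2 b (w r))
    (df := fun r => - (2 * inner (M *m (expcol b (w r) - p)) (- dx r))) st).
- by apply: continuous_subspaceT; exact: continuous_speed2.
- move=> r /(pos_of s0) r0; have wd := w_der r0.
  have dxr : col_derive (fun s => expcol b (w s) - p) r (dx r).
    rewrite -[dx r]subr0; apply: col_deriveB; last exact: col_derive_cst.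
    move=> i; rewrite mxE; under [X in is_derive _ _ X]eq_fun do rewrite mxE.
    by apply: is_derive_expR_fun; exact: is_deriveZ_fun.
  apply: is_derive_eq (is_derive_inner dxr (col_derive_mulmx M dxr)) _.
  by rewrite (inner_symmx M_sym (dx r)) innerNr inner_mulmx M_sym; ring.
move=> r _; rewrite oppr_le0 mulr_ge0 //; apply: sumr_ge0 => i _.
rewrite !mxE; set e := expR _; set k := \sum_j _.
rewrite (_ : _ * _ = e * (b * k ^+ 2)); last by ring.
by rewrite mulr_ge0 ?expR_ge0 // mulr_ge0 ?sqr_ge0 // ltW.
Qed.

End one_flow.
End entropic_flow.

(** * Energy estimates along one flow, and comparison of two flows *)

Section entropic_flow_estimates.
Context {R : realType} {d : nat}.
Variables (M P : 'M[R]_d) (p : 'cV[R]_d).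
Hypothesis M_sym : M^T = M.
Hypothesis M_psd : forall x : 'cV[R]_d, 0 <= inner x (M *m x).
Hypothesis MPM : M *m P *m M = M.
Implicit Types (u v a z : 'cV[R]_d) (r s t : R).

Let flow := entropic_flow M p.
Let F := pot p.
Let V := pinvf P.

Lemma pinvfZ k v : V (k *: v) = k ^+ 2 * V v.
Proof. by rewrite /V /pinvf -scalemxAr innerZl innerZr; ring. Qed.

Lemma pinvfD_mul u z : in_span M P u -> V (u + M *m z) = V u + 2 * inner z u + sqf M z.
Proof.
move=> uM; rewrite -(pinvf_polar M_sym MPM z uM) -(pinvf_mul M_sym MPM z) /V /pinvf.
by rewrite mulmxDr !innerDl !innerDr; ring.
Qed.

(** Young's inequality for the two dual forms: expand [V (u - M z) >= 0]. *)
Lemma inner_le_pinvf z u : in_span M P u -> 2 * inner z u <= sqf M z + V u.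
Proof.
move=> uM.
have : 0 <= V (u + M *m (- z)).
  apply: pinvf_ge0 => //; apply: in_spanD => //; exact: in_span_mul.
by rewrite pinvfD_mul // innerNl sqfN //; lra.
Qed.

Lemma is_derive_pinvf (f : R -> 'cV[R]_d) t z :
  col_derive f t (M *m z) -> in_span M P (f t) ->
  is_derive t 1 (fun s => V (f s)) (2 * inner z (f t)).
Proof.
move=> fd fM; rewrite -(pinvf_polar M_sym MPM z fM).
exact: is_derive_inner fd (col_derive_mulmx P fd).
Qed.

Lemma continuous_pinvf (f : R -> 'cV[R]_d) : col_continuous f -> continuous (fun s => V (f s)).
Proof. by move=> fc; apply: continuous_inner => //; exact: col_continuous_mulmx. Qed.

Section one_flow.
Variables (b : R) (w : R -> 'cV[R]_d).
Hypothesis b_gt0 : 0 < b.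
Hypothesis wflow : flow b w.

Let pos_of (s t r : R) : 0 <= s -> s < r < t -> 0 < r.
Proof. by move=> s0 /andP[sr _]; exact: le_lt_trans sr. Qed.

Let Fc : continuous (fun r => F b (w r)).
Proof. exact: continuous_pot wflow. Qed.

Let linc (k : R) : continuous (fun r : R => k * r).
Proof. by move=> r; apply: cvgM; [exact: cvg_cst|exact: cvg_id]. Qed.

(** Since [F' = - speed2] and the speed decreases, the slope of [F] over [[s, t]] is squeezed
    between the end speeds: this is one half, [pot_slope_lb] the other. *)
Lemma pot_slope_ub s t : 0 <= s -> s <= t ->
  F b (w s) - F b (w t) <= (t - s) * speed2 M p b (w s).
Proof.
move=> s0 st; set k := speed2 _ _ _ _.
pose f r := F b (w r) + k * r.
suff : f s <= f t by rewrite /f; lra.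
eapply (derive_ge0_le st).
- by apply: continuous_subspaceT => r; apply: cvgD; [exact: Fc|exact: linc].
- move=> r /(pos_of s0) r0.
  exact: is_deriveD_fun (is_derive_pot b_gt0 wflow r0) (is_derive_lin k r).
move=> r /andP[sr _]; rewrite addrC subr_ge0.
exact: (speed2_nincr M_sym b_gt0 wflow s0 (ltW sr)).
Qed.

Lemma pot_slope_lb s t : 0 <= s -> s <= t ->
  (t - s) * speed2 M p b (w t) <= F b (w s) - F b (w t).
Proof.
move=> s0 st; set k := speed2 _ _ _ _.
pose f r := F b (w r) + k * r.
suff : f t <= f s by rewrite /f; lra.
eapply (derive_le0_le st).
- by apply: continuous_subspaceT => r; apply: cvgD; [exact: Fc|exact: linc].
- move=> r /(pos_of s0) r0.
  exact: is_deriveD_fun (is_derive_pot b_gt0 wflow r0) (is_derive_lin k r).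
move=> r srt; rewrite /= addrC subr_le0.
have /andP[_ rt] := srt.
exact: (speed2_nincr M_sym b_gt0 wflow (ltW (pos_of s0 srt)) (ltW rt)).
Qed.

Lemma pot_nincr s t : 0 <= s -> s <= t -> F b (w t) <= F b (w s).
Proof.
move=> s0 st; rewrite -subr_ge0; apply: le_trans (pot_slope_lb s0 st).
by rewrite mulr_ge0 ?subr_ge0 //; exact: sqf_ge0.
Qed.

(** Cauchy-Schwarz for the length of the curve: [V] of the velocity is [speed2], whose integral over
    [[s, t]] is the drop of [F]. The proof replaces the integral by a monotone function. *)
Lemma flow_length s t : 0 <= s -> s <= t ->
  V (w t - w s) <= (t - s) * (F b (w s) - F b (w t)).
Proof.
move=> s0; rewrite le_eqVlt => /predU1P[->|st].
  by rewrite !subrr mul0r /V /pinvf inner0l.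
have wM := flow_in_span MPM wflow s0 (ltW st).
have h0 : 0 < t - s by rewrite subr_gt0.
(* Up to the kernel of [M], [zt] is the time average of [x - p], because [w' = - M (x - p)]. *)
pose zt := - ((t - s)^-1 *: (P *m (w t - w s))).
have Mzt : M *m zt = - ((t - s)^-1 *: (w t - w s)) by rewrite mulmxN -scalemxAr wM.
have sqzt : sqf M zt = (t - s)^-1 ^+ 2 * V (w t - w s).
  by rewrite sqfN // sqfZ // /V (pinvfE MPM).
(* The derivative of [f] is [- |zt - (x - p)|_M^2]. *)
pose f r := - 2 * inner zt (w r) + - sqf M zt * r + F b (w r).
have key : f t <= f s.
  have wc := wflow.1.
  have ic : continuous (fun r => inner zt (w r)).
    by apply: continuous_inner => //; exact: col_continuous_cst.
  eapply (derive_le0_le (ltW st)).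
  - apply: continuous_subspaceT => r; apply: cvgD; last exact: Fc.
    by apply: cvgD; [apply: cvgM; [exact: cvg_cst|exact: ic]|exact: linc].
  - move=> r /(pos_of s0) r0.
    have h1 := is_derive_inner (col_derive_cst zt r) (wflow.2 r r0).
    exact: is_deriveD_fun (is_deriveD_fun (is_deriveZ_fun _ h1) (is_derive_lin _ r))
      (is_derive_pot b_gt0 wflow r0).
  move=> r _ /=; rewrite inner0l add0r innerNr.
  have := sqf_ge0 M_psd (zt - (expcol b (w r) - p)).
  by rewrite sqfB // /speed2; lra.
have E : inner zt (w t) - inner zt (w s) = - ((t - s) * sqf M zt).
  rewrite /sqf Mzt innerNr mulrN opprK innerZr mulrA divff ?gt_eqF // mul1r.
  by rewrite innerBr.
have : (t - s) * sqf M zt <= F b (w s) - F b (w t).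
  by move: key; rewrite /f; lra.
rewrite sqzt => h.
have -> : V (w t - w s) = (t - s) * ((t - s) * ((t - s)^-1 ^+ 2 * V (w t - w s))).
  by field; rewrite gt_eqF.
by rewrite ler_pM2l.
Qed.

Lemma flow_inner_sq z s t : 0 <= s -> s <= t ->
  inner z (w t - w s) ^+ 2 <= sqf M z * ((t - s) * (F b (w s) - F b (w t))).
Proof.
move=> s0 st; have wM := flow_in_span MPM wflow s0 st.
apply: le_trans (pinvf_CS M_sym M_psd MPM z wM) _.
by rewrite ler_wpM2l ?sqf_ge0 // flow_length.
Qed.

(** Compares a difference quotient with a candidate derivative [- M z]: [V] of their difference is
    expanded and its quadratic term bounded by [flow_length]. Every term on the right passes to the
    limit, which is why differentiability of the limit is derived from this form. *)
Lemma flow_quotient z i s t : 0 <= s -> s < t ->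
  ((t - s)^-1 * (w t i 0 - w s i 0) + (M *m z) i 0) ^+ 2 <=
  M i i * ((t - s)^-1 * (F b (w s) - F b (w t)) + sqf M z
           + 2 * (t - s)^-1 * inner z (w t - w s)).
Proof.
move=> s0 st; have wM := flow_in_span MPM wflow s0 (ltW st).
have h0 : 0 < t - s by rewrite subr_gt0.
set v := (t - s)^-1 *: (w t - w s) + M *m z.
have vM : in_span M P v by apply: in_spanD; [exact: in_spanZ|exact: in_span_mul].
have -> : (t - s)^-1 * (w t i 0 - w s i 0) + (M *m z) i 0 = v i 0.
  by rewrite [RHS]mxE [in RHS]mxE [(w t - w s) i 0]mxE [(- w s) i 0]mxE.
apply: le_trans (pinvf_coord_sq M_sym M_psd MPM i vM) _.
rewrite ler_wpM2l ?(diag_ge0 M_psd) // -/V pinvfD_mul; last exact: in_spanZ.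
rewrite pinvfZ innerZr mulrA.
have : (t - s)^-1 ^+ 2 * V (w t - w s) <= (t - s)^-1 * (F b (w s) - F b (w t)).
  rewrite expr2 -mulrA ler_pM2l ?invr_gt0 // -(ler_pM2l h0) mulrA divff ?gt_eqF // mul1r.
  exact: flow_length (ltW st).
by lra.
Qed.

Section anchor.
Variable a : 'cV[R]_d.
Hypothesis aM : in_span M P (w 0 - a).

Lemma anchor_in_span t : 0 <= t -> in_span M P (w t - a).
Proof.
move=> t0; rewrite -(subrK (w 0) (w t)) -addrA; apply: in_spanD aM.
exact: (flow_in_span MPM wflow).
Qed.

Lemma is_derive_anchor t : 0 < t ->
  is_derive t 1 (fun r => V (w r - a)) (2 * inner (expcol b (w t) - p) (a - w t)).
Proof.
move=> t0; rewrite -[a - w t]opprB innerNr -innerNl.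
apply: (is_derive_pinvf (f := fun r => w r - a)).
  rewrite mulmxN -[X in col_derive _ _ X]subr0; apply: col_deriveB; last exact: col_derive_cst.
  exact: wflow.2.
exact/anchor_in_span/ltW.
Qed.

Lemma continuous_anchor : continuous (fun r => V (w r - a)).
Proof.
apply: continuous_pinvf; apply: col_continuousB; first exact: wflow.1.
exact: col_continuous_cst.
Qed.

(** By convexity of the potential, [V (w - a)] has derivative at most [2 (F a - F w)], and [F] at
    earlier times is at least its value at [t]. *)
Lemma pot_anchor t : 0 <= t -> 2 * t * (F b (w t) - F b a) <= V (w 0 - a) - V (w t - a).
Proof.
move=> t0; set k := F b (w t) - F b a.
pose f r := V (w r - a) + 2 * k * r.
suff : f t <= f 0 by rewrite /f; lra.
eapply (derive_le0_le t0).
- by apply: continuous_subspaceT => r; apply: cvgD; [exact: continuous_anchor|exact: linc].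
- move=> r /(pos_of (lexx 0)) r0.
  exact: is_deriveD_fun (is_derive_anchor r0) (is_derive_lin _ r).
move=> r /andP[r0 rt].
have := pot_convex p (w r) a b_gt0; rewrite -/F.
have := pot_nincr (ltW r0) (ltW rt); rewrite /k; lra.
Qed.

Section strict_anchor.
Variable eta : R.
Hypothesis eta_gt0 : 0 < eta.
Hypothesis a_neg : forall i, a i 0 <= - eta.

Definition anchor_cst := 2 * (d%:R / b) + sqf M p.

Lemma anchor_cst_ge0 : 0 <= anchor_cst.
Proof. by rewrite addr_ge0 ?sqf_ge0 // mulr_ge0 // divr_ge0 // ltW. Qed.

(** In [<x - p, a - w>], strict negativity of [a] gives [<x, a> <= - eta mass], the entropy bound
    gives [- <x, w> <= d / b], and Young's inequality handles [<p, w - a>]; the last two make up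
    [anchor_cst]. The mass term is kept on the left because it is what [flows_close] absorbs
    into. *)
Lemma anchor_derive_ub t : 0 <= t ->
  2 * inner (expcol b (w t) - p) (a - w t) + 2 * eta * mass b (w t)
  <= anchor_cst + V (w t - a).
Proof.
move=> t0; rewrite innerBl innerBr.
have h1 := inner_expcol_ub b (w t) a_neg.
have h2 := inner_expcol_self (w t) b_gt0.
have := inner_le_pinvf p (anchor_in_span t0).
rewrite -[w t - a]opprB innerNr opprB /anchor_cst; lra.
Qed.

Lemma anchor_gronwall t : 0 <= t ->
  anchor_cst + V (w t - a) <= (anchor_cst + V (w 0 - a)) * expR t.
Proof.
move=> t0; set c := anchor_cst.
pose f r := (c + V (w r - a)) * expR (- 1 * r).
suff : f t <= f 0.
  rewrite /f mulr0 expR0 mulr1 mulN1r expRN => h.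
  by rewrite -ler_pdivrMr ?expR_gt0.
eapply (derive_le0_le t0).
- apply: continuous_subspaceT => r; apply: cvgM.
    by apply: cvgD; [exact: cvg_cst|exact: continuous_anchor].
  by apply: continuous_comp; [exact: linc|exact: continuous_expR].
- move=> r /(pos_of (lexx 0)) r0.
  exact: is_deriveM_fun (is_deriveD_fun (is_derive_cst c r 1) (is_derive_anchor r0))
     (is_derive_expR_fun (is_derive_lin _ r)).
move=> r /andP[r0 _]; rewrite /= add0r.
have := anchor_derive_ub (ltW r0); rewrite -/c.
have : 0 <= 2 * eta * mass b (w r) by rewrite mulr_ge0 ?mass_ge0 // mulr_ge0 // ltW.
move=> h1 h2; set e := expR _; set D := 2 * inner _ _.
rewrite (_ : _ + _ = (D - (c + V (w r - a))) * e); last by ring.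
rewrite mulr_le0_ge0 ?expR_ge0 //; move: h2; rewrite -/D; lra.
Qed.

End strict_anchor.
End anchor.
End one_flow.

Definition anchor_bound (S b : R) a (w : R -> 'cV[R]_d) : R :=
  (anchor_cst b + V (w 0 - a)) * expR S.

(** In the derivative of the squared distance, the diagonal terms [- <x_j, w_j>] cost [d / b_j],
    while the cross terms and those with the initial gap cost at most [k] times a mass each. The
    masses are cancelled by adding multiples of [V (w_j - a_j)]. The initial gap is subtracted
    because only then does the difference lie in the span of [M]. *)
Lemma flows_close (b1 b2 : R) w1 w2 a1 a2 (eta k S : R) :
  0 < b1 -> 0 < b2 -> flow b1 w1 -> flow b2 w2 ->
  in_span M P (w1 0 - a1) -> in_span M P (w2 0 - a2) ->
  0 < eta -> (forall i, a1 i 0 <= - eta) -> (forall i, a2 i 0 <= - eta) ->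
  0 <= k ->
  (forall t i, 0 <= t <= S -> w1 t i 0 <= k) ->
  (forall t i, 0 <= t <= S -> w2 t i 0 <= k) ->
  (forall i, `|w1 0 i 0 - w2 0 i 0| <= k) ->
  forall t, 0 <= t <= S ->
  V ((w1 t - w2 t) - (w1 0 - w2 0)) <=
    2 * (d%:R / b1 + d%:R / b2) * t +
    2 * k / eta * ((anchor_bound S b1 a1 w1 + anchor_bound S b2 a2 w2) * t + V (w1 0 - a1) + V (w2 0 - a2)).
Proof.
move=> b10 b20 fl1 fl2 s1 s2 eta0 an1 an2 k0 ub1 ub2 dk t /andP[t0 tS].
(* [2 eta K = 4 k]: each mass occurs twice with coefficient [k], inside an inner product multiplied
   by [2]. *)
pose K := 2 * k / eta.
have K0 : 0 <= K by rewrite divr_ge0 ?mulr_ge0 // ltW.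
set c1 := anchor_bound _ b1 _ _; set c2 := anchor_bound _ b2 _ _.
set L := 2 * (d%:R / b1 + d%:R / b2) + K * (c1 + c2).
pose E r := V ((w1 r - w2 r) - (w1 0 - w2 0)).
have spE r : 0 <= r -> in_span M P ((w1 r - w2 r) - (w1 0 - w2 0)).
  move=> r0; have -> : (w1 r - w2 r) - (w1 0 - w2 0) = (w1 r - w1 0) - (w2 r - w2 0).
    by rewrite !opprB addrACA [RHS]addrACA [- w2 r + _]addrC [- w1 0 + _]addrC.
  by apply: in_spanB; [exact: (flow_in_span MPM fl1)|exact: (flow_in_span MPM fl2)].
have E0 : E 0 = 0 by rewrite /E subrr /V /pinvf inner0l.
have V1 : 0 <= V (w1 t - a1) by apply: pinvf_ge0 => //; exact: (anchor_in_span fl1).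
have V2 : 0 <= V (w2 t - a2) by apply: pinvf_ge0 => //; exact: (anchor_in_span fl2).
pose f r := E r + K * (V (w1 r - a1) + V (w2 r - a2)) + - L * r.
suff : f t <= f 0.
  rewrite /f E0 /L -/(E t).
  have : 0 <= K * (V (w1 t - a1) + V (w2 t - a2)) by rewrite mulr_ge0 ?addr_ge0.
  rewrite -/K; lra.
have Ec : continuous E.
  apply: continuous_pinvf; apply: col_continuousB; last exact: col_continuous_cst.
  by apply: col_continuousB; [exact: fl1.1|exact: fl2.1].
have V1c := continuous_anchor fl1 (a := a1); have V2c := continuous_anchor fl2 (a := a2).
eapply (derive_le0_le t0).
- apply: continuous_subspaceT => r; apply: cvgD; last first.
    by apply: cvgM; [exact: cvg_cst|exact: cvg_id].
  apply: cvgD; first exact: Ec.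
  by apply: cvgM; [exact: cvg_cst|apply: cvgD; [exact: V1c|exact: V2c]].
- move=> r /andP[r0 rt].
  have dE : is_derive r 1 E (2 * inner (- (expcol b1 (w1 r) - expcol b2 (w2 r)))
      ((w1 r - w2 r) - (w1 0 - w2 0))).
    apply: is_derive_pinvf; last exact/spE/ltW.
    rewrite -[M *m _]subr0; apply: col_deriveB; last exact: col_derive_cst.
    rewrite (_ : M *m _ = - (M *m (expcol b1 (w1 r) - p)) - - (M *m (expcol b2 (w2 r) - p))).
      by apply: col_deriveB; [exact: fl1.2|exact: fl2.2].
    rewrite -!mulmxN -mulmxDr; congr (M *m _).
    by apply/matrixP => i j; rewrite !mxE; ring.
  exact: is_deriveD_fun (is_deriveD_fun dE (is_deriveZ_fun K
    (is_deriveD_fun (is_derive_anchor fl1 s1 r0) (is_derive_anchor fl2 s2 r0))))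
    (is_derive_lin _ r).
move=> r /andP[r0 rt].
have rS : r <= S by rewrite (le_trans _ tS) // ltW.
have r0S : 0 <= r <= S by rewrite ltW.
have C j a w (fl : flow j w) (j0 : 0 < j) : in_span M P (w 0 - a) ->
   (forall i, a i 0 <= - eta) ->
   K * (2 * inner (expcol j (w r) - p) (a - w r)) + 4 * k * mass j (w r) <= K * anchor_bound S j a w.
  move=> sw aw; have /= h1 := anchor_derive_ub j0 fl sw aw (ltW r0).
  have h2 := anchor_gronwall j0 fl sw eta0 aw (ltW r0).
  have h3 : anchor_cst j + V (w r - a) <= anchor_bound S j a w.
    apply: le_trans h2 _; rewrite ler_wpM2l ?ler_expR //.
    by rewrite addr_ge0 ?(anchor_cst_ge0 j0) ?(pinvf_ge0 M_psd MPM sw).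
  have := ler_wpM2l K0 (le_trans h1 h3).
  have -> : K * (2 * inner (expcol j (w r) - p) (a - w r) + 2 * eta * mass j (w r)) =
     K * (2 * inner (expcol j (w r) - p) (a - w r)) + 4 * k * mass j (w r).
    by rewrite /K; field; rewrite gt_eqF.
  by [].
have := C _ _ _ fl1 b10 s1 an1; rewrite -/c1.
have := C _ _ _ fl2 b20 s2 an2; rewrite -/c2.
have m1 := mass_ge0 b1 (w1 r); have m2 := mass_ge0 b2 (w2 r).
have i12 : inner (expcol b1 (w1 r)) (w2 r) <= k * mass b1 (w1 r).
  by apply: inner_expcol_ub => i; exact: ub2.
have i21 : inner (expcol b2 (w2 r)) (w1 r) <= k * mass b2 (w2 r).
  by apply: inner_expcol_ub => i; exact: ub1.
have i1d : inner (expcol b1 (w1 r)) (w1 0 - w2 0) <= k * mass b1 (w1 r).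
  by apply: inner_expcol_ub => i; rewrite !mxE (le_trans (ler_norm _) (dk i)).
have i2d : - inner (expcol b2 (w2 r)) (w1 0 - w2 0) <= k * mass b2 (w2 r).
  rewrite -innerNr; apply: inner_expcol_ub => i; rewrite !mxE.
  by rewrite (le_trans (ler_norm _)) // normrN.
have e1 := inner_expcol_self (w1 r) b10.
have e2 := inner_expcol_self (w2 r) b20.
move: i1d i2d; set Q1 := inner _ (w1 0 - w2 0); set Q2 := inner _ (w1 0 - w2 0).
have -> : inner (- (expcol b1 (w1 r) - expcol b2 (w2 r))) (w1 r - w2 r - (w1 0 - w2 0)) =
  - inner (expcol b1 (w1 r)) (w1 r) + inner (expcol b1 (w1 r)) (w2 r) + Q1
  + inner (expcol b2 (w2 r)) (w1 r) - inner (expcol b2 (w2 r)) (w2 r) - Q2.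
  rewrite innerNl innerBl (innerBr (w1 r - w2 r)) (innerBr (w1 r - w2 r)).
  by rewrite (innerBr (w1 r)) (innerBr (w1 r)) -/Q1 -/Q2; ring.
rewrite /L.
lra.
Qed.

End entropic_flow_estimates.

(** * Differentiability of the limit *)

Lemma feasible_coord {R : realType} {d : nat} (w y : 'cV[R]_d) :
  (forall i, w i 0 <= 0) -> feasible w y -> forall i, w i 0 < 0 -> y i 0 = 0.
Proof.
move=> w0 [y0 wy] i wi; apply/eqP.
have h : forall j, true -> 0 <= - (w j 0 * y j 0).
  by move=> j _; rewrite oppr_ge0 mulr_le0_ge0.
have : \sum_j - (w j 0 * y j 0) = 0 by rewrite sumrN -/(inner w y) wy oppr0.
move=> /eqP; rewrite psumr_eq0 // => /allP /(_ i (mem_index_enum _)) /=.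
by rewrite oppr_eq0 mulf_eq0 lt_eqF.
Qed.

Lemma inner_feasible_le0 {R : realType} {d : nat} (w y : 'cV[R]_d) :
  (forall i, w i 0 <= 0) -> (forall i, 0 <= y i 0) -> inner y w <= 0.
Proof. by move=> w0 y0; apply: sumr_le0 => i _; rewrite mulr_ge0_le0. Qed.

Section differentiability.
Context {R : realType} {d : nat}.
Variables (M : 'M[R]_d) (p : 'cV[R]_d) (w : R -> 'cV[R]_d).
Hypothesis M_psd : forall x : 'cV[R]_d, 0 <= inner x (M *m x).
Implicit Types (i : 'I_d) (r s t k : R) (y z : 'cV[R]_d).

Let F t := - inner p (w t).
Let slope s t := (t - s)^-1 * (F s - F t).

Hypothesis w_cont : col_continuous w.
Hypothesis w_le0 : forall t i, 0 <= t -> w t i 0 <= 0.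
Hypothesis F_convex : forall r s t, 0 < r -> r < s -> s < t ->
  (s - r) * (F s - F t) <= (t - s) * (F r - F s).
Hypothesis w_quotient : forall z i s t, 0 < s -> s < t ->
  ((t - s)^-1 * (w t i 0 - w s i 0) + (M *m z) i 0) ^+ 2 <=
  M i i * ((t - s)^-1 * (F s - F t) + sqf M z + 2 * (t - s)^-1 * inner z (w t - w s)).
Hypothesis w_primal : forall s, 0 < s -> exists y : 'cV[R]_d, feasible (w s) y /\
  forall r, 0 < r -> r < s -> (s - r) * sqf M (y - p) <= F r - F s.

Lemma slope_nincr r s t : 0 < r -> r < s -> s < t -> slope s t <= slope r s.
Proof.
move=> r0 rs st; rewrite /slope ![_^-1 * _]mulrC ler_pdivrMr ?subr_gt0 // mulrAC ler_pdivlMr ?subr_gt0 //.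
by rewrite mulrC [leRHS]mulrC; exact: F_convex.
Qed.

Lemma slope_nincr_r s t t' : 0 < s -> s < t -> t <= t' -> slope s t' <= slope s t.
Proof.
move=> s0 st; rewrite le_eqVlt => /predU1P[->//|tt'].
have st' := lt_trans st tt'.
have := F_convex s0 st tt'; rewrite /slope => h.
rewrite ![_^-1 * _]mulrC ler_pdivrMr ?subr_gt0 // mulrAC ler_pdivlMr ?subr_gt0 //.
lra.
Qed.

(** The slopes are monotone, so one pair of slopes within [k], for each [k], already says that the
    one-sided derivatives agree; no limit is taken. *)
Definition regular_time s := forall k, 0 < k ->
  exists r t, [/\ 0 < r, r < s, s < t & slope r s - slope s t < k].

(* At an irregular time the left and right slopes of the convex function [F] are
   the ends of a nonempty open interval, and these intervals are disjoint. *)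
Lemma irregular_countable : countable [set s | 0 < s /\ ~ regular_time s].
Proof.
set D := [set s | _].
pose A s := [set slope s t | t in [set t | s < t]].
(* On [D] this is the open gap between the right and left slopes. Elsewhere the value [setT] only
   makes every [B s] open and nonempty; disjointness is asked on [D] alone. *)
pose B s := if `[< D s >] then
  [set v | exists2 k, 0 < k & forall r t, 0 < r -> r < s -> s < t ->
    slope s t + k < v /\ v < slope r s - k] else setT.
apply: (@separated_open_countable _ _ B D).
- move=> s; rewrite /B; case: asboolP => _; last exact: openT.
  rewrite openE => v [k k0 hv] /=; apply/nbhs_ballP; exists (k / 2) => /=.
    by rewrite divr_gt0.
  move=> v' /=; rewrite /ball /= => vv'; exists (k / 2); first by rewrite divr_gt0.
  move=> r t r0 rs st; have [h1 h2] := hv r t r0 rs st.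
  by move: vv'; rewrite ltr_norml => /andP[]; lra.
- move=> s; rewrite /B; case: asboolP => [[s0 Ds]|_]; last by exists 0.
  have [k k0 hk] : exists2 k, 0 < k & forall r t, 0 < r -> r < s -> s < t ->
      k <= slope r s - slope s t.
    apply: contrapT => h; apply: Ds => k k0; apply: contrapT => h'.
    apply: h; exists k => // r t r0 rs st; rewrite leNgt; apply/negP => h''.
    by apply: h'; exists r, t.
  have s20 : 0 < s / 2 by rewrite divr_gt0.
  have s2s : s / 2 < s by rewrite ltr_pdivrMr // mulr_natr mulr2n ltrDl.
  have Aub : ubound (A s) (slope (s / 2) s).
    by move=> _ [t /= st <-]; have := hk _ _ s20 s2s st; lra.
  have A0 : A s !=set0 by exists (slope s (s + 1)); exists (s + 1) => //=; rewrite ltrDl.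
  exists (sup (A s) + k / 2); exists (k / 4); first by rewrite divr_gt0.
  move=> r t r0 rs st; split.
    have : slope s t <= sup (A s).
      by apply: ub_le_sup; [exists (slope (s / 2) s)|exists t].
    lra.
  have : sup (A s) <= slope r s - k.
    by apply: ge_sup => // _ [t' /= st' <-]; have := hk _ _ r0 rs st'; lra.
  lra.
(* The slope over [[s, s']] lies below [v] as a right slope at [s], and above [v] as a left slope at
   [s']. *)
have tI s s' v : D s -> D s' -> B s v -> B s' v -> ~ s < s'.
  rewrite /B => Ds Ds'; rewrite !asboolT // => -[k k0 hk] [k' k'0 hk'] ss'.
  have [s0 _] := Ds.
  have s20 : 0 < s / 2 by rewrite divr_gt0.
  have s2s : s / 2 < s by rewrite ltr_pdivrMr // mulr_natr mulr2n ltrDl.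
  have [h1 _] := hk (s / 2) s' s20 s2s ss'.
  have s'1 : s' < s' + 1 by rewrite ltrDl.
  have [_ h2] := hk' s (s' + 1) s0 ss' s'1.
  by lra.
move=> s s' Ds Ds' [v [Bs Bs']].
by have [/(tI _ _ _ Ds Ds' Bs Bs')|/(tI _ _ _ Ds' Ds Bs' Bs)|] := ltgtP s s'.
Qed.

(** Take [z = y - p] in [w_quotient]: the part in [p] contributes minus twice the slope, turning
    [slope + |y - p|_M^2] into [|y - p|_M^2 - slope], and the part in [y] is nonpositive. *)
Lemma quotient_close y i s t k : 0 < s -> s < t ->
  inner y (w t - w s) <= 0 -> sqf M (y - p) - slope s t <= k ->
  ((t - s)^-1 * (w t i 0 - w s i 0) + (M *m (y - p)) i 0) ^+ 2 <= M i i * k.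
Proof.
move=> s0 st yw hk; apply: le_trans (w_quotient _ _ s0 st) _.
rewrite ler_wpM2l ?(diag_ge0 M_psd) // innerBl -/(slope s t).
have ts : 0 < (t - s)^-1 by rewrite invr_gt0 subr_gt0.
have : (t - s)^-1 * inner y (w t - w s) <= 0 by rewrite mulr_ge0_le0 // ltW.
have : (t - s)^-1 * inner p (w t - w s) = slope s t.
  by rewrite /slope /F innerBr; congr (_ * _); ring.
lra.
Qed.

(** To the right of [s], [<y, w>] is maximal at [s] and [quotient_close] applies with [y]. To the
    left its sign condition goes the wrong way for [y], so the primal point [y'] of the nearby time
    [s'] is used instead. As [y'] is also feasible at [s], the quotient over the fixed interval
    [[s, t]] is close to both [- M (y' - p)] and [- M (y - p)], and links the two; hence the three
    errors [e / 3]. *)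
Lemma regular_derive s y : 0 < s -> regular_time s -> feasible (w s) y ->
  (forall r, 0 < r -> r < s -> (s - r) * sqf M (y - p) <= F r - F s) ->
  col_derive w s (- (M *m (y - p))).
Proof.
move=> s0 sreg [y0 yw] yp i; rewrite mxE.
suff h : (fun h => h^-1 *: (w (h *: 1 + s) i 0 - w s i 0)) @ (0 : R)^'
    --> - (M *m (y - p)) i 0.
  by split; [apply/cvg_ex; eexists; exact: h|exact: cvg_lim h].
apply/cvgrPdist_le => e e0.
have D0 : 0 < 1 + M i i by rewrite ltr_pwDl ?(diag_ge0 M_psd).
(* Chosen so that [M i i * k <= (e / 3)^2]; the [1 +] covers a zero diagonal entry. *)
pose k := (e / 3) ^+ 2 / (1 + M i i).
have e30 : 0 < e / 3 by rewrite divr_gt0.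
have k0 : 0 < k by rewrite divr_gt0 ?exprn_gt0.
have kE x : x ^+ 2 <= M i i * k -> `|x| <= e / 3.
  move=> h; have : x ^+ 2 <= (e / 3) ^+ 2.
    apply: le_trans h _; rewrite /k mulrA ler_pdivrMr // mulrC ler_wpM2l ?sqr_ge0 //.
    by rewrite lerDr.
  by rewrite -[X in X <= _]real_normK ?num_real // ler_pXn2r // nnegrE ltW.
have [r [t [r0 rs st hk]]] := sreg _ k0.
have slopeE r' s' x : r' < s' -> (s' - r') * x <= F r' - F s' -> x <= slope r' s'.
  move=> rs' h; rewrite /slope mulrC ler_pdivlMr ?subr_gt0 // mulrC; exact: h.
have ysq : sqf M (y - p) <= slope r s by apply: slopeE => //; exact: yp.
have yinc t' : 0 <= t' -> inner y (w t' - w s) <= 0.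
  move=> t'0; rewrite innerBr [inner y (w s)]innerC yw subr0.
  by apply: inner_feasible_le0 => // j; exact: w_le0.
have close_t : `|(t - s)^-1 * (w t i 0 - w s i 0) + (M *m (y - p)) i 0| <= e / 3.
  by apply: kE; apply: quotient_close => //; [apply: yinc; lra|lra].
have nsupp : \forall s' \near s, forall j, w s j 0 < 0 -> w s' j 0 < 0.
  apply: (@filter_forall R _ _ (nbhs s)) => j.
  have [wj|wj] := ltP (w s j 0) 0; last first.
    by apply: nearW.
  have /cvgr_lt := @w_cont j s => /(_ 0 wj) h.
  by near=> s' => _; near: s'.
have nslope : \forall s' \near s, slope r s' < slope s t + k.
  have /cvgr_lt : slope r s' @[s' --> s] --> slope r s.
    apply: cvgM.
      apply: cvgV; first by rewrite subr_eq0 gt_eqF.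
      by apply: cvgB; [exact: cvg_id|exact: cvg_cst].
    apply: cvgB; first exact: cvg_cst.
    apply: cvgN; apply: continuous_inner => //; exact: col_continuous_cst.
  by apply; lra.
have nr : \forall s' \near s, r < s' by have /cvgr_gt := @cvg_id R (nbhs s); apply.
have nt : \forall s' \near s, s' < t by have /cvgr_lt := @cvg_id R (nbhs s); apply.
have shift (Q : R -> Prop) : (\forall s' \near s, Q s') -> \forall h \near (0 : R)^', Q (h *: 1 + s).
  move=> Qs; apply: (@cvg_within _ (nbhs (0 : R))).
  suff : (fun h : R => h *: (1 : R) + s) @ (0 : R) --> s by apply.
  rewrite -[X in _ --> X]add0r; apply: cvgD; last exact: cvg_cst.
  have -> : (fun h : R => h *: (1 : R)) = id by apply/funext => h /=; rewrite /GRing.scale /= mulr1.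
  exact: cvg_id.
near=> h.
have hn0 : h != 0 by near: h; exact: nbhs_dnbhs_neq.
have hr : r < h *: 1 + s by near: h; exact: (shift (fun s' => r < s')).
have ht : h *: 1 + s < t by near: h; exact: (shift (fun s' => s' < t)).
have hslope : slope r (h *: 1 + s) < slope s t + k.
  by near: h; exact: (shift (fun s' => slope r s' < slope s t + k)).
have hsupp : forall j, w s j 0 < 0 -> w (h *: 1 + s) j 0 < 0.
  by near: h; exact: (shift (fun s' => forall j, w s j 0 < 0 -> w s' j 0 < 0)).
have h1E : h *: (1 : R) = h by exact: mulr1.
move: hr ht hslope hsupp; rewrite h1E.
set s' := h + s => hr ht hslope hsupp.
have s'0 : 0 < s' := lt_trans r0 hr.
rewrite -opprD normrN addrC.
case: (ltgtP h 0) hn0 => // h0 _.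
  have s's : s' < s by rewrite /s' gtrDr.
  have [y' [[y'0 y'w] y'p]] := w_primal s'0.
  have hE : h = - (s - s') by rewrite /s'; ring.
  have y'sq : sqf M (y' - p) <= slope r s' by apply: slopeE => //; exact: y'p.
  (* Coordinates negative at [s] are still negative at the nearby [s'], so feasibility at [s'] makes
     [y'] vanish there. *)
  have y's : inner y' (w s) = 0.
    rewrite /inner big1 // => j _.
    have := w_le0 j (ltW s0); rewrite le_eqVlt => /predU1P[->|wj]; first by rewrite mulr0.
    rewrite (feasible_coord _ (conj y'0 y'w)) ?mul0r //; last exact: hsupp.
    by move=> ?; apply: w_le0; exact: ltW.
  have c1 : `|(t - s)^-1 * (w t i 0 - w s i 0) + (M *m (y' - p)) i 0| <= e / 3.
    apply: kE; apply: quotient_close => //; last by lra.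
    rewrite innerBr y's subr0.
    by apply: inner_feasible_le0 => // j; apply: w_le0; lra.
  have c2 : `|(s - s')^-1 * (w s i 0 - w s' i 0) + (M *m (y' - p)) i 0| <= e / 3.
    apply: kE; apply: quotient_close => //.
      by rewrite innerBr y's [inner y' _]innerC y'w subr0.
    have := slope_nincr s'0 s's st; lra.
  have -> : h^-1 *: (w s' i 0 - w s i 0) = (s - s')^-1 * (w s i 0 - w s' i 0).
    by rewrite hE /GRing.scale /= invrN; ring.
  move: c1 c2 close_t; rewrite !ler_norml => /andP[? ?] /andP[? ?] /andP[? ?].
  by apply/andP; split; lra.
have ss' : s < s' by rewrite /s' ltrDr.
have hE : h = s' - s by rewrite /s'; ring.
have c : `|(s' - s)^-1 * (w s' i 0 - w s i 0) + (M *m (y - p)) i 0| <= e / 3.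
  apply: kE; apply: quotient_close => //; first by apply: yinc; exact: ltW.
  have := slope_nincr_r s0 ss' (ltW ht); lra.
by rewrite hE /GRing.scale /= (le_trans c) // ler_pdivrMr // ler_peMr ?ler1n // ltW.
Unshelve. all: by end_near. Qed.

End differentiability.

(** * Monotonicity from almost everywhere derivatives *)

Section ae_monotonicity.
Context {R : realType}.
Local Notation mu := (@lebesgue_measure R).
Implicit Types (a b c r s t k : R) (f g : R -> R).

Lemma ae_imply (Q1 Q2 : R -> Prop) : (forall t, Q1 t -> Q2 t) ->
  {ae mu, forall t, Q1 t} -> {ae mu, forall t, Q2 t}.
Proof. by move=> h; apply: negligibleS => t /= nQ2 /h. Qed.

Lemma ae_imply2 (Q1 Q2 Q3 : R -> Prop) : (forall t, Q1 t -> Q2 t -> Q3 t) ->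
  {ae mu, forall t, Q1 t} -> {ae mu, forall t, Q2 t} -> {ae mu, forall t, Q3 t}.
Proof.
move=> h h1 h2; apply: negligibleS (negligibleU h1 h2) => t /= nQ3.
by apply: contrapT => /not_orP[/contrapT q1 /contrapT q2]; apply: nQ3; exact: h.
Qed.

(** Induction along an interval: the supremum of the points of [E] in [[a, b]] belongs to [E] by the
    closure hypothesis, and the step hypothesis forbids it to be less than [b]. *)
Lemma right_induction (E : set R) a b : a <= b -> E a ->
  (forall c, a < c <= b -> (forall r, r < c -> exists2 t, E t & r < t <= c) -> E c) ->
  (forall c, a <= c < b -> E c -> exists2 t, E t & c < t <= b) -> E b.
Proof.
move=> ab Ea Eclosed Estep.
pose A := E `&` [set t | a <= t <= b].
have Aa : A a by split => //=; rewrite lexx.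
have Aub : ubound A b by move=> t [_ /andP[]].
have Asup : has_sup A by split; [exists a|exists b].
set c := sup A.
have ac : a <= c by apply: ub_le_sup => //; exists b.
have cb : c <= b by apply: ge_sup => //; exists a.
have Ec : E c.
  move: (ac); rewrite le_eqVlt => /predU1P[<-//|ac'].
  apply: Eclosed => [|r rc]; first by rewrite ac' cb.
  have rc0 : 0 < c - r by rewrite subr_gt0.
  have [t [Et tab] ht] := sup_adherent rc0 Asup.
  exists t => //; rewrite -/c in ht; apply/andP; split; first by lra.
  by apply: ub_le_sup; [exists b|split].
move: (cb); rewrite le_eqVlt => /predU1P[<-//|cb'].
have [|t Et /andP[ct tb]] := Estep c _ Ec; first by rewrite ac cb'.
have : t <= c by apply: ub_le_sup; [exists b|split => //=; rewrite tb (le_trans ac) // ltW].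
by rewrite leNgt ct.
Qed.

Lemma is_derive_right_ub f c df k : is_derive c 1 f df -> df < k ->
  \forall h \near (0 : R)^'+, f (c + h) - f c <= k * h.
Proof.
move=> fd dfk.
have h1 : (fun h => h^-1 *: (f (h *: 1 + c) - f c)) @ (0 : R)^' --> df.
  rewrite -(@derive_val _ _ _ _ _ _ _ fd); exact: ex_derive.
have /cvgr_lt := cvg_dnbhs_at_right h1 => /(_ k dfk) h2.
near=> h.
have h0 : 0 < h by near: h; exact: nbhs_right_gt.
have : h^-1 *: (f (h *: 1 + c) - f c) < k by near: h.
rewrite /GRing.scale /= mulr1 mulrC ltr_pdivrMr // => h3.
by rewrite [c + h]addrC ltW.
Unshelve. all: by end_near. Qed.

Definition lip_itv a b f :=
  exists2 L, 0 <= L & forall s t, a <= s -> s <= t -> t <= b -> `|f t - f s| <= L * (t - s).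

(* The null exceptional set is covered by an open set [U] of small measure; the
   growth of [f] on it is charged to the nondecreasing function [|U `&` [a, t]|]. *)
Lemma ae_derive_le0_le a b f : a <= b -> lip_itv a b f ->
  {ae mu, forall t, a < t < b -> exists2 df, is_derive t 1 f df & df <= 0} ->
  f b <= f a.
Proof.
rewrite le_eqVlt => /predU1P[->//|ab] [L L0 fL] [N [mN N0 hN]].
apply/ler_addgt0Pr => e e0.
(* The tolerance [e] is shared: [eta (b - a) = e / 2] for the growth off the open cover,
   [L de <= e / 2] for the growth on it. *)
pose eta := e / (2 * (b - a)).
have ba : 0 < b - a by rewrite subr_gt0.
have eta0 : 0 < eta by rewrite divr_gt0 ?mulr_gt0.
pose de := e / (2 * (L + 1)).
have L1 : 0 < L + 1 by rewrite ltr_wpDl.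
have de0 : 0 < de by rewrite divr_gt0 ?mulr_gt0.
(* The endpoint [a] joins the null set: no derivative is assumed there, and the induction has to
   start at it. *)
have mNa : measurable (N `|` [set a]) by apply: measurableU => //; exact: measurable_set1.
have Na0 : mu (N `|` [set a]) = 0%E.
  apply/eqP; rewrite -measure_le0.
  apply: le_trans (measureU2 _ mN (measurable_set1 a)) _.
  rewrite -[leRHS]adde0; apply: leeD; first by move: N0 => /= ->.
  by move: (lebesgue_measure_set1 a) => /= ->.
have Nafin : (mu (N `|` [set a]) < +oo)%E by rewrite Na0 ltry.
have [U [oU NU Ude]] := lebesgue_regularity_outer mNa Nafin de0.
have mUa : measurable U by exact: open_measurable.
have Ude' : (mu U < de%:E)%E.
  rewrite -(setDUK NU) measureU //.
  - by rewrite [X in (X + _ < _)%E]Na0 add0e.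
  - exact: measurableD.
  by rewrite setDE setICA setICr setI0.
pose m t := mu (U `&` `]a, t]).
have mm t : measurable (U `&` `]a, t] : set R) by exact: measurableI.
have mfin t : m t \is a fin_num.
  rewrite ge0_fin_numE ?measure_ge0 // (le_lt_trans _ (lt_trans Ude' (ltry _))) //.
  by apply: le_measure; [exact: (mem_set (mm _))|exact: mem_set|exact: subIsetl].
pose phi t := fine (m t).
have phi_de t : phi t <= de.
  rewrite -lee_fin /phi fineK // (le_trans _ (ltW Ude')) //.
  by apply: le_measure; [exact: (mem_set (mm _))|exact: mem_set|exact: subIsetl].
have phi_a : phi a = 0 by rewrite /phi /m set_itvoc0 setI0 measure0.
have phi_le s t : s <= t -> phi s <= phi t.
  move=> st; rewrite /phi fine_le //.
  apply: le_measure; [exact: (mem_set (mm _))|exact: (mem_set (mm _))|] => x [Ux] /=.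
  by rewrite !in_itv /= => /andP[-> xs]; split => //; rewrite (le_trans xs).
have phi_U s t : a <= s -> s <= t -> `]s, t] `<=` U -> phi s + (t - s) <= phi t.
  move=> as_ st stU.
  have : (m s + (t - s)%:E <= m t)%E.
    have -> : ((t - s)%:E = mu `]s, t])%E.
      rewrite lebesgue_measure_itv /= lte_fin.
      by move: st; rewrite le_eqVlt => /predU1P[->|->]; rewrite ?ltxx ?subrr // EFinB.
    have dj : (U `&` `]a, s]) `&` `]s, t] = set0.
      rewrite -subset0 => x [[_ /=]]; rewrite !in_itv /= => /andP[_ xs] /andP[sx _].
      by have := lt_le_trans sx xs; rewrite ltxx.
    have muU := @measureU _ _ _ mu _ _ (mm s) (measurable_itv `]s, t]) dj.
    rewrite -[leLHS]muU.
    apply: le_measure; [apply: mem_set; apply: measurableU; [exact: mm|exact: measurable_itv]|exact: (mem_set (mm _))|].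
    move=> x [[Ux]|/= xst].
      rewrite /= !in_itv /= => /andP[ax xs].
      split; [exact: Ux|]; rewrite /= ?in_itv /=; apply/andP; split=> //; exact: le_trans st.
    split; first exact: stU.
    move: xst; rewrite /= !in_itv /= => /andP[sx ->].
    by rewrite (le_lt_trans as_ sx).
  by move=> h; rewrite -lee_fin EFinD /phi (fineK (mfin s)) (fineK (mfin t)).
pose E t := f t <= f a + eta * (t - a) + L * (phi t - phi a).
suff : E b.
  rewrite /E phi_a subr0 => /le_trans; apply.
  have h1 : eta * (b - a) = e / 2 by rewrite /eta; field; rewrite subr_eq0 gt_eqF.
  have h2 : L * phi b <= e / 2.
    have h3 : (L + 1) * de = e / 2 by rewrite /de; field; rewrite gt_eqF.
    have := ler_wpM2l L0 (phi_de b); lra.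
  rewrite h1; lra.
apply: (@right_induction E a b (ltW ab)); first by rewrite /E !subrr !mulr0 !addr0.
- move=> c /andP[ac cb] Ec; rewrite /E; apply/ler_addgt0Pr => k k0.
  have mc : Num.max a (c - k / (L + 1)) < c by rewrite gt_max ac /= gtrBl divr_gt0.
  have [t Et /andP[ht tc]] := Ec _ mc.
  move: ht; rewrite gt_max => /andP[at_ ht].
  have := fL t c (ltW at_) tc cb; move/(le_trans (ler_norm _)) => h1.
  have h2 : L * (c - t) <= k.
    apply: (@le_trans _ _ ((L + 1) * (k / (L + 1)))).
      by apply: ler_pM; rewrite ?subr_ge0 // ?lerDl //; lra.
    by rewrite mulrCA divff ?gt_eqF ?mulr1.
  have h3 := ler_wpM2l L0 (phi_le _ _ tc).
  have h4 : eta * t <= eta * c by rewrite ler_pM2l.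
  move: Et; rewrite /E; lra.
move=> c /andP[ac cb] Ec.
have [Uc|Uc] := pselect (U c).
  have /nbhs_ballP[r /= r0 rU] := open_nbhs_nbhs (conj oU Uc).
  set t := Num.min b (c + r / 2).
  have ct : c < t by rewrite lt_min cb ltrDl divr_gt0.
  have tb : t <= b by rewrite ge_min lexx.
  have tr : t <= c + r / 2 by rewrite ge_min lexx orbT.
  exists t; last by rewrite ct.
  have := phi_U c t ac (ltW ct).
  have /[swap]/[apply] : `]c, t] `<=` U.
    move=> x /=; rewrite in_itv /= => /andP[cx xt]; apply: rU.
    by rewrite /ball /= ltr_norml; apply/andP; split; lra.
  move=> h1; have := fL c t ac (ltW ct) tb; move/(le_trans (ler_norm _)) => h2.
  have h3 : L * (phi c + (t - c)) <= L * phi t by rewrite ler_wpM2l.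
  have h4 : eta * c <= eta * t by rewrite ler_pM2l // ltW.
  move: Ec; rewrite /E; lra.
have ac' : a < c.
  rewrite lt_neqAle ac andbT; apply/eqP => acE; apply: Uc; rewrite -acE.
  by apply: NU; right.
have [df fd df0] : exists2 df, is_derive c 1 f df & df <= 0.
  apply: contrapT => h; apply: Uc; apply: NU; left; apply: hN => /= /(_ _)hc.
  by apply: h; apply: hc; rewrite ac' cb.
have h1 := is_derive_right_ub fd (le_lt_trans df0 eta0).
have bc0 : 0 < b - c by rewrite subr_gt0.
have [h [[hu h0] hb]] := filter_ex (filterI (filterI h1 (nbhs_right_gt (0 : R))) (nbhs_right_le bc0)).
have hc : c <= c + h by rewrite lerDl ltW.
exists (c + h); last by apply/andP; split; [rewrite ltrDl|lra].
have := ler_wpM2l L0 (phi_le _ _ hc).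
move: Ec; rewrite /E; lra.
Qed.

Lemma lip_itvD a b f g : lip_itv a b f -> lip_itv a b g -> lip_itv a b (fun t => f t + g t).
Proof.
move=> [L L0 fL] [K K0 gK]; exists (L + K); first exact: addr_ge0.
move=> s t as_ st tb; rewrite opprD addrACA mulrDl (le_trans (ler_normD _ _)) //.
by rewrite lerD ?fL ?gK.
Qed.

Lemma lip_itvZ a b k f : lip_itv a b f -> lip_itv a b (fun t => k * f t).
Proof.
move=> [L L0 fL]; exists (`|k| * L); first by rewrite mulr_ge0.
by move=> s t as_ st tb; rewrite -mulrBr normrM -mulrA ler_wpM2l // fL.
Qed.

Lemma lip_itvM a b f g : a <= b -> lip_itv a b f -> lip_itv a b g ->
  lip_itv a b (fun t => f t * g t).
Proof.
move=> ab [L L0 fL] [K K0 gK].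
have bnd (h : R -> R) (J : R) : 0 <= J -> (forall s t, a <= s -> s <= t -> t <= b -> `|h t - h s| <= J * (t - s)) ->
    forall t, a <= t -> t <= b -> `|h t| <= `|h a| + J * (b - a).
  move=> J0 hJ t at_ tb; rewrite -[h t](subrK (h a)) addrC (le_trans (ler_normD _ _)) //.
  by rewrite lerD2l (le_trans (hJ _ _ _ at_ tb)) // ler_wpM2l // lerD2r.
set A := `|f a| + L * (b - a); set B := `|g a| + K * (b - a).
have A0 : 0 <= A by rewrite addr_ge0 // mulr_ge0 // subr_ge0.
have B0 : 0 <= B by rewrite addr_ge0 // mulr_ge0 // subr_ge0.
exists (A * K + L * B); first by rewrite addr_ge0 // mulr_ge0.
move=> s t as_ st tb.
rewrite (_ : _ - _ = f t * (g t - g s) + (f t - f s) * g s); last by ring.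
rewrite (le_trans (ler_normD _ _)) // [leRHS]mulrDl; apply: lerD; rewrite normrM.
  rewrite -[leRHS]mulrA; apply: ler_pM => //; last exact: gK.
  exact: (bnd f L L0 fL t (le_trans as_ st) tb).
rewrite mulrAC; apply: ler_pM => //; first exact: fL.
exact: (bnd g K K0 gK s as_ (le_trans st tb)).
Qed.

Lemma lip_itv_sum a b n (f : 'I_n -> R -> R) : (forall i, lip_itv a b (f i)) ->
  lip_itv a b (fun t => \sum_i f i t).
Proof.
move=> fL; suff h (r : seq 'I_n) : lip_itv a b (fun t => \sum_(i <- r) f i t) by exact: h.
elim: r => [|i r IH].
  by exists 0 => // s t _ _ _; rewrite !big_nil subrr normr0 mul0r.
rewrite (_ : (fun t => _) = (fun t => f i t + \sum_(j <- r) f j t)); first exact: lip_itvD.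
by apply/funext => t; rewrite big_cons.
Qed.

Lemma ae_derive_eq0_eq a b f : a <= b -> lip_itv a b f ->
  {ae mu, forall t, a < t < b -> is_derive t 1 f 0} -> f b = f a.
Proof.
move=> ab fL fd; apply/eqP; rewrite eq_le; apply/andP; split.
  apply: (ae_derive_le0_le ab fL).
  by apply: ae_imply fd => t h tab; exists 0 => //; exact: h.
rewrite -lerN2; apply: (@ae_derive_le0_le a b (fun t => - f t) ab).
  by have [L L0 h] := fL; exists L => // s t ? ? ?; rewrite -opprD normrN h.
apply: ae_imply fd => t h tab; exists (- 0); last by rewrite oppr0.
by have := h tab => ?; exact: is_deriveN.
Qed.

End ae_monotonicity.

(** * Mirror flows of a quadratic loss *)

Section gradients.
Context {R : realType} {d : nat}.
Variables (M : 'M[R]_d) (q : 'cV[R]_d) (c : R).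
Hypothesis M_sym : M^T = M.
Implicit Types (x v : 'cV[R]_d).
Let l := quadratic M q c.

Lemma derive_of_slope (f : 'cV[R]_d -> R) x v (g : R -> R) : {for 0, continuous g} ->
  (forall h, f (h *: v + x) - f x = h * g h) -> 'D_v f x = g 0.
Proof.
move=> gc fg; apply: cvg_lim => //.
apply: cvg_trans (_ : g @ (0 : R)^' `=>` nbhs (g 0)).
  apply: near_eq_cvg; near=> h.
  rewrite fg /GRing.scale /= mulrA mulVf ?mul1r //.
  by near: h; exact: nbhs_dnbhs_neq.
by move=> A /gc; exact: nbhs_dnbhs.
Unshelve. all: by end_near. Qed.

Lemma quadraticDZ x v k :
  l (x + k *: v) = l x + k * inner v (M *m x - q) + k ^+ 2 / 2 * sqf M v.
Proof.
have := sqfDZ M_sym k x v.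
rewrite /l /quadratic /sqf innerDr innerZr innerBr (inner_symmx M_sym x v) (innerC q v) => ->.
by field.
Qed.

Lemma grad_quadratic x : grad l x = M *m x - q.
Proof.
apply/matrixP => i j; rewrite (ord1 j) [LHS]mxE.
pose g h : R := inner (delta_mx i 0) (M *m x - q) + h * (2^-1 * sqf M (delta_mx i 0)).
rewrite (@derive_of_slope l x _ g).
- by rewrite /g mul0r addr0 inner_delta.
- apply: cvgD; first exact: cvg_cst.
  by apply: cvgM; [exact: cvg_id|exact: cvg_cst].
by move=> h; rewrite [h *: _ + x]addrC quadraticDZ /g; field.
Qed.

Lemma grad_quadratic_hadamard x :
  grad (fun v => l (hadamard v v)) x = 2 *: hadamard x (M *m hadamard x x - q).
Proof.
apply/matrixP => i j; rewrite (ord1 j) [LHS]mxE.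
set y := hadamard x x.
(* [(x_i + h)^2 - x_i^2 = h (2 x_i + h)], so moving [x] along a basis vector moves [hadamard x x]
   along the same vector by [h * k h]. *)
pose k h := 2 * x i 0 + h.
pose g h : R := k h * inner (delta_mx i 0) (M *m y - q) +
  h * (k h ^+ 2 / 2 * sqf M (delta_mx i 0)).
rewrite (@derive_of_slope (fun v => l (hadamard v v)) x _ g).
- by rewrite /g /k mul0r !addr0 inner_delta !mxE; ring.
- have kc : k @ (0 : R) --> k 0 by apply: cvgD; [exact: cvg_cst|exact: cvg_id].
  apply: cvgD; first by apply: cvgM; [exact: kc|exact: cvg_cst].
  apply: cvgM; first exact: cvg_id.
  apply: cvgM; last exact: cvg_cst.
  apply: cvgM; last exact: cvg_cst.
  by rewrite expr2; under eq_cvg do rewrite expr2; exact: cvgM.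
move=> h; have -> : hadamard (h *: delta_mx i 0 + x) (h *: delta_mx i 0 + x) =
    y + (h * k h) *: delta_mx i 0.
  apply/matrixP => a b; rewrite (ord1 b) !mxE /k eqxx andbT.
  by have [->|_] := eqVneq a i; rewrite ?mulr1 ?mulr0; ring.
by rewrite quadraticDZ /g; field.
Qed.

End gradients.

Section subdifferential.
Context {R : realType} {d : nat}.
Implicit Types (x y w : 'cV[R]_d).
Let g : 'cV[R]_d -> \bar R := indicator_fun (@vec_nonneg R d).

(** The normal cone of the orthant. Testing at [0] forces [x] into the orthant, since the indicator
    is infinite outside; then [x + e_i] gives the sign of [w_i], and [x + x] and [0] give the two
    halves of orthogonality. *)
Lemma subdifferential_indicator x w : subdifferential g x w <->
  [/\ forall i, 0 <= x i 0, forall i, w i 0 <= 0 & inner w x = 0].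
Proof.
have gE y : (forall i, 0 <= y i 0) -> g y = 0%E.
  by move=> y0; rewrite /g /indicator_fun asboolT.
split=> [h|[x0 w0 wx] y]; last first.
  rewrite gE // add0e /g /indicator_fun; case: asboolP => [y0|_]; last exact: leey.
  rewrite lee_fin innerBr wx subr0 innerC.
  exact: inner_feasible_le0.
have x0 : forall i, 0 <= x i 0.
  apply: contrapT => nx; have := h 0; rewrite /g {1}/indicator_fun asboolF //.
  by rewrite -/g gE // => i; rewrite mxE.
have h' y : (forall i, 0 <= y i 0) -> inner w (y - x) <= 0.
  by move=> y0; have := h y; rewrite !gE // add0e lee_fin.
split => // [i|].
  have := h' (x + delta_mx i 0); rewrite [x + _]addrC addrK innerC inner_delta; apply.
  by move=> j; rewrite !mxE addr_ge0.
apply/eqP; rewrite eq_le; apply/andP; split.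
  have := h' (x + x); rewrite addrK; apply => j.
  by rewrite !mxE addr_ge0.
by have := h' 0; rewrite sub0r innerNr oppr_le0; apply => j; rewrite mxE.
Qed.

End subdifferential.

Section mirror_flows.
Context {R : realType} {d : nat}.
Variables (M P : 'M[R]_d) (p q : 'cV[R]_d) (c : R).
Hypothesis M_sym : M^T = M.
Hypothesis M_psd : forall x : 'cV[R]_d, 0 <= inner x (M *m x).
Hypothesis MPM : M *m P *m M = M.
Hypothesis qE : q = M *m p.
Implicit Types (w x : R -> 'cV[R]_d) (s t : R).
Local Notation mu := (@lebesgue_measure R).
Let l := quadratic M q c.
Let g : 'cV[R]_d -> \bar R := indicator_fun (@vec_nonneg R d).

Definition mirror_at w (y : 'cV[R]_d) t := [/\ col_derive w t (- (M *m (y - p))),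
  forall i, 0 <= y i 0, forall i, w t i 0 <= 0 & inner (w t) y = 0].

Lemma mirror_atP w (y : 'cV[R]_d) t :
  is_derive t 1 w (- grad l y) /\ subdifferential g y (w t) <-> mirror_at w y t.
Proof.
rewrite grad_quadratic // qE -mulmxBr subdifferential_indicator.
split=> [[/col_deriveP wd [? ? ?]]|[wd ? ? ?]]; first by split.
by split => //; exact/col_deriveP.
Qed.

Lemma associated_primalP w x : associated_primal g l w x <->
  {ae mu, forall t, 0 <= t -> mirror_at w (x t) t}.
Proof.
by split; apply: ae_imply => t h t0; exact/mirror_atP/h.
Qed.

Lemma mx_norm_le (v : 'cV[R]_d) (k : R) : 0 <= k ->
  (`|v| <= k) <-> (forall i, `|v i 0| <= k).
Proof.
move=> k0; rewrite /Num.norm /= mx_normrE; split.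
  move=> h i; apply: le_trans h.
  exact: (le_bigmax _ (fun ij : 'I_d * 'I_1 => `|v ij.1 ij.2|) (i, 0)).
by move=> h; apply: bigmax_le => // -[i j] _ /=; rewrite (ord1 j); exact: h.
Qed.

Lemma lipschitzP w : [lipschitz w s | s in `[0, +oo[] <->
  exists2 C : R, 0 <= C & forall i s t, 0 <= s -> s <= t -> `|w t i 0 - w s i 0| <= C * (t - s).
Proof.
split.
  rewrite /lipschitz_on => h; have [C [hC C0]] := filter_ex (@filterI _ (pinfty_nbhs R) _ _ _ h (nbhs_pinfty_ge (num_real (0 : R)))).
  exists C => // i s t s0 st.
  have /= := hC (t, s) _; rewrite /= !in_itv /= !andbT => /(_ (conj (le_trans s0 st) s0)).
  rewrite [`|t - s|]ger0_norm ?subr_ge0 // => /mx_norm_le.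
  by rewrite mulr_ge0 ?subr_ge0 // => /(_ isT i); rewrite !mxE.
move=> [C C0 hC]; rewrite /lipschitz_on; near=> K => -[s t] /=; rewrite !in_itv /= !andbT => -[s0 t0].
have CK : C <= K by near: K; exact: (nbhs_pinfty_ge (num_real C)).
have K0 : 0 <= K := le_trans C0 CK.
apply/mx_norm_le => [|i]; first by rewrite mulr_ge0.
rewrite !mxE; apply: (@le_trans _ _ (C * `|s - t|)); last by rewrite ler_wpM2r.
have [st|ts] := leP s t.
  by rewrite distrC [`|s - t|]distrC [`|t - s|]ger0_norm ?subr_ge0 // hC.
by rewrite [`|s - t|]ger0_norm ?subr_ge0 ?(ltW ts) // hC // ltW.
Unshelve. all: by end_near. Qed.

Lemma lipschitz_lip_itv w b i : [lipschitz w s | s in `[0, +oo[] ->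
  lip_itv 0 b (fun t => w t i 0).
Proof. by move=> /lipschitzP [C C0 h]; exists C => // s t s0 st _; exact: h. Qed.

Lemma lip_itv_mulmx w b (A : 'M[R]_d) : (forall i, lip_itv 0 b (fun t => w t i 0)) ->
  forall i, lip_itv 0 b (fun t => (A *m w t) i 0).
Proof.
move=> h i; rewrite (_ : (fun t => _) = (fun t => \sum_j A i j * w t j 0)).
  by apply: lip_itv_sum => j; exact: lip_itvZ.
by apply/funext => t; rewrite mxE.
Qed.

(* Two solutions approach each other in the dual form of [M], by monotonicity
   of the subdifferential. *)
Lemma mirror_flow_unique w1 w2 (w0 : 'cV[R]_d) :
  Lipschitz_mirror_flow g l w0 w1 -> Lipschitz_mirror_flow g l w0 w2 ->
  forall s, 0 <= s -> w1 s = w2 s.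
Proof.
move=> [lip1 [x1 /associated_primalP ap1] w10] [lip2 [x2 /associated_primalP ap2] w20] s s0.
pose v t := w1 t - w2 t.
have vlip b i : lip_itv 0 b (fun t => v t i 0).
  rewrite (_ : (fun t => _) = (fun t => w1 t i 0 + (-1) * w2 t i 0)).
    by apply: lip_itvD; [|apply: lip_itvZ]; exact: lipschitz_lip_itv.
  by apply/funext => t; rewrite !mxE mulN1r.
have vd : {ae mu, forall t, 0 <= t -> [/\ mirror_at w1 (x1 t) t, mirror_at w2 (x2 t) t &
     col_derive v t (M *m (- (x1 t - x2 t)))]}.
  apply: ae_imply2 ap1 ap2 => t h1 h2 t0; have m1 := h1 t0; have m2 := h2 t0; split => //.
  have [d1 _ _ _] := m1; have [d2 _ _ _] := m2.
  have := col_deriveB d1 d2; congr col_derive.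
  by rewrite -!mulmxN -mulmxDr; congr (M *m _); apply/matrixP => i j; rewrite !mxE; ring.
have vM t : 0 <= t -> in_span M P (v t).
  move=> t0; rewrite /in_span; apply/eqP; rewrite -subr_eq0; apply/eqP.
  pose A := M *m P - 1%:M.
  have AE u : M *m (P *m u) - u = A *m u by rewrite mulmxBl mul1mx -mulmxA.
  rewrite AE; apply/matrixP => i j; rewrite (ord1 j) [RHS]mxE.
  have -> : 0 = (A *m v 0) i 0 by rewrite /v w10 w20 subrr mulmx0 mxE.
  apply: (@ae_derive_eq0_eq _ 0 t (fun r => (A *m v r) i 0) t0); first exact: lip_itv_mulmx.
  apply: ae_imply vd => r h /andP[r0 _]; have [_ _ dv] := h (ltW r0).
  have := col_derive_mulmx A dv i.
  by rewrite mulmxA mulmxBl mul1mx MPM subrr mul0mx mxE.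
have V0 : pinvf P (v s) <= pinvf P (v 0).
  apply: (@ae_derive_le0_le _ 0 s (fun r => pinvf P (v r)) s0).
    by apply: lip_itv_sum => i; apply: lip_itvM => //; exact: lip_itv_mulmx.
  apply: ae_imply vd => r h /andP[r0 _].
  have [[_ x1p w1n e1] [_ x2p w2n e2] dv] := h (ltW r0).
  eexists; first exact: (is_derive_pinvf M_sym MPM dv (vM r (ltW r0))).
  rewrite innerNl mulrN oppr_le0 mulr_ge0 // innerBl !innerBr.
  rewrite innerC e1 [inner (x2 r) (w2 r)]innerC e2.
  have := inner_feasible_le0 w2n x1p; have := inner_feasible_le0 w1n x2p; lra.
have v00 : v 0 = 0 by rewrite /v w10 w20 subrr.
move: V0; rewrite v00 [X in _ <= X -> _]/pinvf inner0l => V0.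
apply/eqP; rewrite -subr_eq0; apply/eqP/matrixP => i j; rewrite (ord1 j) [RHS]mxE.
have := pinvf_coord_sq M_sym M_psd MPM i (vM s s0).
move=> /le_trans /(_ (_ : _ <= 0)) h; apply/eqP.
rewrite -sqrf_eq0 eq_le sqr_ge0 andbT; apply: h.
by rewrite mulr_ge0_le0 // (diag_ge0 M_psd).
Qed.

Lemma local_max_derive (f : R -> R) s D : 0 < s -> is_derive s 1 f D ->
  (forall t, 0 <= t -> f t <= f s) -> D = 0.
Proof.
have ub (h : R -> R) E : 0 < s -> is_derive s 1 h E ->
    (\forall t \near (0 : R)^'+, h (s + t) <= h s) -> E <= 0.
  move=> s0 hd hmax; rewrite leNgt; apply/negP => E0.
  have hN : is_derive s 1 (fun t => - h t) (- E) by exact: is_deriveN.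
  have EN : - E < - (E / 2) by rewrite ltrN2 ltr_pdivrMr // mulr_natr mulr2n ltrDl.
  have h1 := is_derive_right_ub hN EN.
  have [t [[h2 h3] t0]] := filter_ex (filterI (filterI h1 hmax) (nbhs_right_gt (0 : R))).
  have : 0 < E / 2 * t by rewrite !mulr_gt0.
  move: h2 h3 => /=; lra.
move=> s0 fd fmax; apply/eqP; rewrite eq_le; apply/andP; split.
  apply: (ub f) => //; near=> t; apply: fmax.
  have t0 : 0 < t by near: t; exact: nbhs_right_gt.
  by apply: addr_ge0; exact: ltW.
(* The reflection [t -> 2 s - t] turns the left side of [s] into its right side. *)
rewrite -oppr_le0; apply: (ub (fun t => f (2 * s - t))) => //.
  have hd : is_derive s 1 (fun t => 2 * s - t) (0 - 1).
    by apply: is_deriveB_fun.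
  have fd' : is_derive (2 * s - s) 1 f D by rewrite (_ : 2 * s - s = s) //; ring.
  have := @is_derive1_comp _ f (fun t => 2 * s - t) s _ _ fd' hd.
  by rewrite (_ : D * (0 - 1) = - D); last by ring.
near=> t; rewrite (_ : 2 * s - s = s); last by ring.
apply: fmax; rewrite (_ : 2 * s - (s + t) = s - t); last by ring.
by rewrite subr_ge0; near: t; exact: nbhs_right_le.
Unshelve. all: by end_near. Qed.

Lemma mirror_at_orthogonal w (y z : 'cV[R]_d) s : 0 < s ->
  (forall t i, 0 <= t -> w t i 0 <= 0) -> mirror_at w y s ->
  feasible (w s) z -> inner z (M *m (y - p)) = 0.
Proof.
move=> s0 w_le0 [wd y0 _ _] [z0 zw].
have fd := is_derive_inner (col_derive_cst z s) wd.
have := local_max_derive s0 fd _; rewrite inner0l add0r innerNr => h.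
apply/eqP; rewrite -oppr_eq0; apply/eqP; apply: h => t t0.
rewrite [inner z (w s)]innerC zw; apply: inner_feasible_le0 => // i; exact: w_le0.
Qed.

(** Expand [l] around [y]: towards any feasible [z] the linear term vanishes, because [z] and [y]
    are both orthogonal to [M (y - p)], and a nonnegative square remains. *)
Lemma mirror_at_argmin w (y : 'cV[R]_d) s : 0 < s ->
  (forall t i, 0 <= t -> w t i 0 <= 0) -> mirror_at w y s ->
  argmin (feasible (w s)) l y.
Proof.
move=> s0 w_le0 ym; have [_ y0 _ yw] := ym.
have yf : feasible (w s) y by split.
split => // z zf.
have := quadraticDZ q c M_sym y (z - y) 1; rewrite scale1r addrC subrK -/l => ->.
rewrite qE -mulmxBr innerBl (mirror_at_orthogonal s0 w_le0 ym zf).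
rewrite (mirror_at_orthogonal s0 w_le0 ym yf).
have := sqf_ge0 M_psd (z - y); lra.
Qed.

End mirror_flows.

(** * Integral estimates *)

Import HBNNSimple.

Section integrals.
Context {R : realType}.
Local Notation mu := (@lebesgue_measure R).

(* No measurability of [f]: the integral of a nonnegative function is a supremum
   over the simple functions below it. *)
Lemma integral_le_ae (D : set R) (f g : R -> \bar R) : measurable D ->
  (forall x, D x -> (0 <= f x)%E) -> (forall x, D x -> (0 <= g x)%E) ->
  measurable_fun D g -> {ae mu, forall x, D x -> (f x <= g x)%E} ->
  (\int[mu]_(x in D) f x <= \int[mu]_(x in D) g x)%E.
Proof.
move=> mD f0 g0 mg fg; rewrite ge0_integralE //; apply: ge_ereal_sup => _ [h hf <-].
rewrite -integralT_nnsfun [leRHS]integral_mkcond.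
apply: ae_ge0_le_integral => //.
- by move=> x _; rewrite lee_fin.
- exact/measurable_EFinP.
- by move=> x _; apply: erestrict_ge0.
- by apply/(measurable_restrictT _ _).1.
apply: ae_imply fg => x fgx _; apply: le_trans (hf x) _.
by rewrite /patch; case: ifP => // /set_mem; exact: fgx.
Qed.

(** Dominated convergence is a statement on sequences; a failure near [0^'+] yields a sequence of
    counterexamples with [u n < 1 / (n + 1)]. [P0] keeps the whole sequence, not only its tail,
    where the flow hypotheses hold. *)
Lemma near_seq (P0 Q : R -> Prop) : (\forall e \near (0 : R)^'+, P0 e) ->
  (forall u : nat -> R, (forall n, 0 < u n) -> (forall n, P0 (u n)) ->
    u n @[n --> \oo] --> 0 -> \forall n \near \oo, Q (u n)) ->
  \forall e \near (0 : R)^'+, Q e.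
Proof.
move=> hP hQ; apply: contrapT => nQ.
have /choice[u hu] : forall n : nat, exists e : R, [/\ 0 < e < n.+1%:R^-1, P0 e & ~ Q e].
  move=> n; apply: contrapT => h; apply: nQ.
  have n0 : 0 < n.+1%:R^-1 :> R by rewrite invr_gt0.
  near=> e; apply: contrapT => Qe; apply: h; exists e; split => //; last by near: e.
  apply/andP; split; near: e; [exact: nbhs_right_gt|exact: nbhs_right_lt].
have u0 : u n @[n --> \oo] --> 0.
  apply: (@squeeze_cvgr _ _ _ _ (fun=> 0) (fun n => n.+1%:R^-1)).
  - by apply: nearW => n; have [/andP[/ltW -> /ltW ->]] := hu n.
  - exact: cvg_cst.
  exact: cvg_harmonic.
have up n : 0 < u n by have [/andP[]] := hu n.
have uP n : P0 (u n) by have [] := hu n.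
have [N _ hN] := hQ u up uP u0.
by have [_ _] := hu N; apply; apply: hN => /=.
Unshelve. all: by end_near. Qed.

(** A Borel representative of a pointwise limit. It stands in for expressions in the primal
    variable, which is not given as a measurable function. *)
Definition lim_rep (f_ : nat -> R -> R) s := fine (limn_esup (fun n => (f_ n s)%:E)).

Lemma measurable_lim_rep (D : set R) (f_ : nat -> R -> R) :
  (forall n, measurable_fun D (f_ n)) -> measurable_fun D (lim_rep f_).
Proof.
move=> mf; apply: measurableT_comp; first exact: fine_measurable measurableT.
by apply: measurable_fun_limn_esup => n; exact/measurable_EFinP.
Qed.

Lemma lim_repE (f_ : nat -> R -> R) s l : f_ n s @[n --> \oo] --> l -> lim_rep f_ s = l.
Proof.
move=> h; have h' : (f_ n s)%:E @[n --> \oo] --> l%:E.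
  by apply: cvg_EFin; [exact: nearW|exact: h].
by rewrite /lim_rep (cvg_limn_einf_sup h').2.
Qed.

Lemma ae_neq0 : {ae mu, forall s : R, s != 0}.
Proof.
exists [set 0]; split; [exact: measurable_set1|exact: lebesgue_measure_set1|].
by move=> s /= /negP/negPn/eqP.
Qed.

(* Dominated convergence away from [0]; near [0] only the integrals of the
   dominating functions are controlled. *)
Lemma integral_small (S A : R) (phi v : nat -> R -> R) : 0 < S -> 0 <= A ->
  (forall n, measurable_fun `[0, S] (phi n)) -> (forall n s, 0 <= phi n s) ->
  (forall n, measurable_fun `[0, S] (v n)) -> (forall n s, 0 <= v n s) ->
  {ae mu, forall s, 0 < s <= S -> phi n s @[n --> \oo] --> 0} ->
  {ae mu, forall s, 0 < s <= S -> forall n, phi n s <= A * v n s} ->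
  (forall s0, 0 < s0 -> exists C : R, \forall n \near \oo,
     forall s, s0 <= s <= S -> v n s <= C) ->
  (forall k, 0 < k -> \forall s0 \near (0 : R)^'+, \forall n \near \oo,
     (\int[mu]_(s in `[0%R, s0]) (s * v n s)%:E <= k%:E)%E) ->
  forall k, 0 < k -> \forall n \near \oo,
     (\int[mu]_(s in `[0%R, S]) (phi n s * s)%:E <= k%:E)%E.
Proof.
move=> S0 A0 mphi phi0 mv v0 phi_cvg phi_v v_bnd v_small k k0.
pose k1 := k / 2 / (A + 1).
have A1 : 0 < A + 1 by rewrite ltr_wpDl.
have k10 : 0 < k1 by rewrite !divr_gt0.
have k20 : 0 < k / 2 by rewrite divr_gt0.
have [s0 [[hs0 s00] s0S]] := filter_ex (filterI (filterI (v_small _ k10)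
  (nbhs_right_gt (0 : R))) (nbhs_right_lt S0)).
have mid (D : set R) : measurable_fun D (fun s : R => s) by exact: measurable_id.
have sub0 : `[0, s0] `<=` `[0, S].
  by move=> x /=; rewrite !in_itv /= => /andP[-> xs]; rewrite (le_trans xs) // ltW.
have sub1 : `[s0, S] `<=` `[0, S].
  by move=> x /=; rewrite !in_itv /= => /andP[xs ->]; rewrite (le_trans (ltW s00)).
have sub2 : `]s0, S] `<=` `[s0, S].
  by move=> x /=; rewrite !in_itv /= => /andP[/ltW -> ->].
have mf n : measurable_fun `[0, S] (fun s => (phi n s * s)%:E).
  by apply/measurable_EFinP; apply: measurable_funM.
have mvs n : measurable_fun `[0, S] (fun s => (s * v n s)%:E).
  by apply/measurable_EFinP; apply: measurable_funM.
have f0 n s : `[0, S]%classic s -> (0 <= (phi n s * s)%:E)%E.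
  by rewrite /= in_itv /= => /andP[s0' _]; rewrite lee_fin mulr_ge0.
have part1 : \forall n \near \oo, (\int[mu]_(s in `[0%R, s0]) (phi n s * s)%:E <= (k / 2)%:E)%E.
  apply: filterS hs0 => n hn.
  have mvs0 : measurable_fun `[0, s0] (fun s => (s * v n s)%:E).
    by apply: measurable_funS (mvs n).
  have vs0 s : `[0, s0]%classic s -> (0 <= (s * v n s)%:E)%E.
    by rewrite /= in_itv /= => /andP[? _]; rewrite lee_fin mulr_ge0.
  apply: (@le_trans _ _ (\int[mu]_(s in `[0%R, s0]) (A%:E * (s * v n s)%:E))%E).
    apply: integral_le_ae => //.
    - by move=> s /sub0; exact: f0.
    - by move=> s /vs0 ?; rewrite mule_ge0.
    - exact: measurable_funeM.
    apply: ae_imply phi_v => s h; rewrite /= in_itv /= => /andP[].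
    rewrite le_eqVlt => /predU1P[<- _|s_gt0 ss0]; first by rewrite mulr0 mul0r mule0.
    rewrite -EFinM lee_fin mulrC mulrCA ler_wpM2l ?(ltW s_gt0) // h // s_gt0.
    exact: le_trans (ltW s0S).
  rewrite ge0_integralZl // (le_trans (lee_wpmul2l _ hn)) // -EFinM lee_fin.
  apply: (@le_trans _ _ ((A + 1) * k1)); first by rewrite ler_wpM2r ?lerDl // ltW.
  by rewrite /k1 mulrC divfK // gt_eqF.
have part2 : \forall n \near \oo, (\int[mu]_(s in `[s0, S]) (phi n s * s)%:E <= (k / 2)%:E)%E.
  have [C [N _ hC]] := v_bnd _ s00.
  have mD : measurable (`[s0, S] : set R) by exact: measurable_itv.
  have C0 : 0 <= C by rewrite (le_trans (v0 N S)) // hC //= lexx ltW.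
  (* The bound [v n <= C] holds from rank [N] on, whereas domination is asked of every term; hence
     the shift by [N]. *)
  have [] := @dominated_convergence _ _ R mu `[s0, S] mD
    (fun n s => (phi (n + N)%N s * s)%:E) (cst 0%E) (cst (A * C * S)%:E) _ _ _ _ _.
  - move=> n; exact: measurable_funS (mf (n + N)%N).
  - exact: measurable_cst.
  - apply: ae_imply phi_cvg => s h; rewrite /= in_itv /= => /andP[ss0 sS].
    apply: cvg_EFin; first exact: nearW.
    rewrite -[X in _ --> X](mul0r s); apply: cvgM; last exact: cvg_cst.
    have hs : 0 < s <= S by rewrite (lt_le_trans s00).
    by have := h hs; rewrite -(cvg_shiftn N).
  - apply: (@continuous_compact_integrable R (cst (A * C * S)) `[s0, S]).
      exact: segment_compact.
    by apply: continuous_subspaceT; exact: cst_continuous.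
  - apply: ae_imply phi_v => s h n; rewrite /= in_itv /= => /andP[ss0 sS].
    have s_gt0 : 0 < s by rewrite (lt_le_trans s00).
    rewrite ger0_norm; last by rewrite mulr_ge0 // ltW.
    rewrite lee_fin ler_pM ?(ltW s_gt0) //.
    apply: (@le_trans _ _ (A * v (n + N)%N s)); first by apply: h; rewrite s_gt0.
    by rewrite ler_wpM2l // hC /= ?leq_addl // ss0.
  move=> _ _; rewrite integral0 => h.
  have : \forall n \near \oo, (\int[mu]_(s in `[s0, S]) (phi (n + N)%N s * s)%:E < (k / 2)%:E)%E.
    have o0 : nbhs 0%E [set x : \bar R | (x < (k / 2)%:E)%E].
      by apply: open_nbhs_nbhs; split; [exact: open_ereal_lt_ereal|rewrite /= lte_fin].
    exact: h o0.
  move=> [N' _ hN']; exists (N' + N)%N => // n /= Nn.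
  have NN : (N <= n)%N := leq_trans (leq_addl N' N) Nn.
  have hm : (N' <= n - N)%N by rewrite leq_subRL // addnC.
  by have /ltW := hN' _ hm; rewrite /= subnK.
apply: filterS2 part1 part2 => n h1 h2.
have SE : `[0, S]%classic = `[0, s0]%classic `|` `]s0, S]%classic :> set R.
  by rewrite -itv_bndbnd_setU // bnd_simp ltW.
have mfU := mf n; rewrite SE in mfU.
have dj : [disjoint `[0, s0]%classic & `]s0, S]%classic].
  apply/disj_set2P; rewrite -subset0 => x [] /=; rewrite !in_itv /=.
  move=> /andP[_ xs] /andP[sx _]; have := lt_le_trans sx xs; by rewrite ltxx.
have fU0 x : (`[0, s0]%classic `|` `]s0, S]%classic) x -> (0 <= (phi n x * x)%:E)%E.
  by rewrite -SE; exact: f0.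
rewrite SE (ge0_integral_setU mu (measurable_itv _) (measurable_itv _) mfU fU0 dj).
rewrite [k in leRHS]splitr EFinD leeD // (le_trans _ h2) //.
apply: ge0_subset_integral => //; first exact: measurable_funS (mf n).
by move=> s /sub1; exact: f0.
Qed.

End integrals.

Lemma continuous_measurable_itv {R : realType} (f : R -> R) (a b : R) : continuous f ->
  measurable_fun `[a, b] f.
Proof.
by move=> fc; apply: subspace_continuous_measurable_fun => //; exact: continuous_subspaceT.
Qed.

Section near_zero.
Context {R : realType} {d : nat}.
Variables (M P : 'M[R]_d) (p : 'cV[R]_d).
Hypothesis M_sym : M^T = M.
Hypothesis M_psd : forall x : 'cV[R]_d, 0 <= inner x (M *m x).
Hypothesis MPM : M *m P *m M = M.

(* [2 s |x - p|_M^2 <= - d/ds (|w - a|^2 + 2 s (pot w - pot a))] *)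
Lemma integral_speed2_near0 (b : R) (w : R -> 'cV[R]_d) (a : 'cV[R]_d) (K s0 : R) :
  0 < b -> entropic_flow M p b w -> in_span M P (w 0 - a) -> 0 <= K -> 0 < s0 ->
  (\int[@lebesgue_measure R]_(s in `[0%R, s0]) (s * (speed2 M p b (w s) + K))%:E <=
  (2^-1 * (pinvf P (w 0 - a) - pinvf P (w s0 - a)) - s0 * (pot p b (w s0) - pot p b a)
   + K / 2 * s0 ^+ 2)%:E)%E.
Proof.
move=> b0 fl aM K0 s00.
(* [h = H'] is the integrand plus [- <x - p, a - w> - (pot w - pot a)], which is nonnegative by
   [pot_convex]; the term [s * speed2] comes from differentiating [pot] in the product. *)
pose H (s : R) := - 2^-1 * pinvf P (w s - a) - s * (pot p b (w s) - pot p b a) + K / 2 * (s * s).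
pose h (s : R) := - inner (expcol b (w s) - p) (a - w s) - (pot p b (w s) - pot p b a)
  + s * (speed2 M p b (w s) + K).
have wc := fl.1.
have xc := col_continuous_expcol fl.
have idc : continuous (fun s : R => s) by move=> s; exact: cvg_id.
have potc : continuous (fun s => pot p b (w s)) by exact: continuous_pot fl.
have spc : continuous (fun s => speed2 M p b (w s)) by exact: continuous_speed2 fl.
have hc : continuous h.
  move=> s; apply: cvgD; first apply: cvgB.
  - apply: cvgN; apply: continuous_inner.
      by apply: col_continuousB => //; exact: col_continuous_cst.
    by apply: col_continuousB => //; exact: col_continuous_cst.
  - by apply: cvgB; [exact: potc|exact: cvg_cst].
  by apply: cvgM; [exact: cvg_id|apply: cvgD; [exact: spc|exact: cvg_cst]].
have vc : continuous (fun s : R => s * (speed2 M p b (w s) + K)).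
  by move=> s; apply: cvgM; [exact: cvg_id|apply: cvgD; [exact: spc|exact: cvg_cst]].
have Hc : continuous H.
  move=> s; apply: cvgD; first apply: cvgB.
  - apply: cvgM; [exact: cvg_cst|exact: (continuous_anchor fl (a := a))].
  - by apply: cvgM; [exact: cvg_id|apply: cvgB; [exact: potc|exact: cvg_cst]].
  by apply: cvgM; [exact: cvg_cst|apply: cvgM; exact: cvg_id].
have Hd (s : R) : 0 < s -> is_derive s 1 H (h s).
  move=> s_gt0.
  have d1 := is_deriveZ_fun (- 2^-1) (is_derive_anchor M_sym MPM fl aM s_gt0).
  have d2 := is_deriveM_fun (is_derive_id s 1)
    (is_deriveB_fun (is_derive_pot b0 fl s_gt0) (is_derive_cst (pot p b a) s 1)).
  have d3 := is_deriveZ_fun (K / 2) (is_deriveM_fun (is_derive_id s 1) (is_derive_id s 1)).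
  apply: is_derive_eq (is_deriveD_fun (is_deriveB_fun d1 d2) d3) _.
  by rewrite /h /=; field.
have -> : 2^-1 * (pinvf P (w 0 - a) - pinvf P (w s0 - a)) - s0 * (pot p b (w s0) - pot p b a)
   + K / 2 * s0 ^+ 2 = H s0 - H 0 by rewrite /H; ring.
rewrite EFinB -(@continuous_FTC2 R h H 0 s0 s00).
- apply: ge0_le_integral => //.
  + move=> s; rewrite /= in_itv /= => /andP[? _].
    by rewrite lee_fin mulr_ge0 // addr_ge0 // sqf_ge0.
  + by apply/measurable_EFinP; exact: continuous_measurable_itv.
  + by apply/measurable_EFinP; exact: continuous_measurable_itv.
  move=> s _; rewrite lee_fin /h lerDr.
  have := pot_convex p (w s) a b0; lra.
- exact: continuous_subspaceT.
- split.
  + move=> s; rewrite in_itv /= => /andP[s_gt0 _].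
    by have := Hd s s_gt0 => ?; exact: ex_derive.
  + by apply: cvg_at_right_filter; exact: Hc.
  + by apply: cvg_at_left_filter; exact: Hc.
move=> s; rewrite in_itv /= => /andP[s_gt0 _].
by have := Hd s s_gt0 => ?; rewrite derive1E derive_val.
Qed.

End near_zero.

(** * The limit of a family of flows *)

Section filter_limits.
Context {R : realType} {T : Type} (G : set_system T) {GG : ProperFilter G}.

Lemma le_of_cvg (f g : T -> R) l l' : f x @[x --> G] --> l -> g x @[x --> G] --> l' ->
  (\forall x \near G, f x <= g x) -> l <= l'.
Proof.
move=> fl gl fg; rewrite -subr_ge0; apply: (cvgr_to_ge (cvgB gl fl)).
by near=> x; rewrite subr_ge0; near: x.
Unshelve. all: by end_near. Qed.

Lemma cvg_sqr (f : T -> R) (l : R) :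
  f x @[x --> G] --> l -> f x ^+ 2 @[x --> G] --> l ^+ 2.
Proof. by move=> h; rewrite expr2; under eq_cvg do rewrite expr2; exact: cvgM. Qed.

Lemma inner_cvg d (f g : T -> 'cV[R]_d) (u v : 'cV[R]_d) :
  (forall i, f x i 0 @[x --> G] --> u i 0) -> (forall i, g x i 0 @[x --> G] --> v i 0) ->
  inner (f x) (g x) @[x --> G] --> inner u v.
Proof. by move=> fu gv; apply: cvg_sum_ord => i; apply: cvgM. Qed.

Lemma ultra_bounded_cvg (f : T -> R) C : UltraFilter G ->
  (\forall x \near G, 0 <= f x <= C) -> exists l : R, f x @[x --> G] --> l.
Proof.
move=> GU fC; have [l [_ lf]] := @segment_compact R 0 C (fmap f G) _ fC.
exists l => A Al.
have [//|GA] := in_ultra_setVsetC (f @^-1` A) GU.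
by have [x []] := lf (~` A) A GA Al.
Qed.

End filter_limits.

Lemma le_at_right0 {R : realType} (f g : R -> R) t : continuous f -> continuous g ->
  0 < t -> (forall r, 0 < r <= t -> f r <= g r) -> f 0 <= g 0.
Proof.
move=> fc gc t0 fg; apply: (@le_of_cvg _ _ ((0 : R)^'+) _ f g).
- by apply: cvg_at_right_filter; exact: fc.
- by apply: cvg_at_right_filter; exact: gc.
near=> r; apply: fg; apply/andP; split; near: r; first exact: nbhs_right_gt.
exact: nbhs_right_le.
Unshelve. all: by end_near. Qed.

Section flow_family.
Context {R : realType} {d : nat}.
Variables (M P : 'M[R]_d) (p : 'cV[R]_d).
Hypothesis M_sym : M^T = M.
Hypothesis M_psd : forall x : 'cV[R]_d, 0 <= inner x (M *m x).
Hypothesis MPM : M *m P *m M = M.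
Context {T : Type} (G : set_system T) {GG : ProperFilter G}.
Variables (b_ : T -> R) (w_ : T -> R -> 'cV[R]_d) (w0 zeta : 'cV[R]_d).
Hypothesis b_cvg : b_ e @[e --> G] --> +oo.
Hypothesis fl : \forall e \near G, entropic_flow M p (b_ e) (w_ e).
Hypothesis w0_cvg : forall i, w_ e 0 i 0 @[e --> G] --> w0 i 0.
Hypothesis w0_le0 : forall i, w0 i 0 <= 0.
Hypothesis w0_anchor : forall i, (w0 - M *m zeta) i 0 < 0.
Implicit Types (r s t : R) (i : 'I_d) (z : 'cV[R]_d).

Let V := pinvf P.
(** The anchor moves with [e]: [w_ e 0 - w0] may leave the span of [M], whereas
    [w_ e 0 - a_ e = M zeta] is always in it, at the fixed squared distance [sqf M zeta]. *)
Let a_ e := w_ e 0 - M *m zeta.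

Lemma family_b_ge k : \forall e \near G, k <= b_ e.
Proof. by move: b_cvg => /cvgryPge /(_ k). Qed.

Lemma family_b_gt0 : \forall e \near G, 0 < b_ e.
Proof. by apply: filterS (family_b_ge 1) => e; exact: lt_le_trans. Qed.

Lemma family_anchor_span e : in_span M P (w_ e 0 - a_ e).
Proof. by rewrite /a_ opprB addrC subrK; exact: in_span_mul. Qed.

Lemma family_anchor0 e : V (w_ e 0 - a_ e) = sqf M zeta.
Proof. by rewrite /a_ opprB addrC subrK; exact: pinvf_mul. Qed.

Lemma family_eta : exists2 eta, 0 < eta & \forall e \near G, forall i, a_ e i 0 <= - eta.
Proof.
have [eta eta0 heta] : exists2 eta : R, 0 < eta & forall i, (w0 - M *m zeta) i 0 < - eta.
  have h : \forall eta \near (0 : R)^'+, forall i, eta < - (w0 - M *m zeta) i 0.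
    by apply: filter_forall => i; apply: nbhs_right_lt; rewrite oppr_gt0.
  have [eta [eta0 etah]] := filter_ex (filterI (nbhs_right_gt (0 : R)) h).
  by exists eta => // i; rewrite ltrNr.
exists eta => //; apply: filter_forall => i.
have /(cvgr_le) : a_ e i 0 @[e --> G] --> (w0 - M *m zeta) i 0.
  under eq_cvg do rewrite mxE.
  rewrite mxE; apply: cvgD; [exact: w0_cvg|exact: cvg_cst].
by apply.
Qed.

Definition family_cst S := (2 * d%:R + sqf M p + sqf M zeta) * expR S.

Lemma family_cst_ge0 S : 0 <= family_cst S.
Proof. by rewrite mulr_ge0 ?expR_ge0 // !addr_ge0 ?mulr_ge0 ?sqf_ge0. Qed.

Lemma anchor_cst_le b : 1 <= b -> anchor_cst M p b <= 2 * d%:R + sqf M p.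
Proof.
move=> b1; rewrite lerD2r ler_pM2l // ler_piMr //.
by rewrite invf_le1 // (lt_le_trans ltr01 b1).
Qed.

Lemma anchor_bound_le e S : 1 <= b_ e ->
  anchor_bound M P p S (b_ e) (a_ e) (w_ e) <= family_cst S.
Proof.
move=> b1; rewrite /anchor_bound /family_cst -/V family_anchor0.
by rewrite ler_wpM2r ?expR_ge0 // lerD2r anchor_cst_le.
Qed.

Lemma family_anchor S : \forall e \near G, forall t, 0 <= t <= S ->
  anchor_cst M p (b_ e) + V (w_ e t - a_ e) <= family_cst S.
Proof.
have [eta eta0 heta] := family_eta.
near=> e => t /andP[t0 tS].
have b1 : 1 <= b_ e by near: e; exact: family_b_ge.
have b0 : 0 < b_ e by exact: lt_le_trans b1.
have fe : entropic_flow M p (b_ e) (w_ e) by near: e.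
have ae : forall i, a_ e i 0 <= - eta by near: e.
have := anchor_gronwall M_sym M_psd MPM b0 fe (family_anchor_span e) eta0 ae t0.
move/le_trans; apply; apply: le_trans (anchor_bound_le S b1).
rewrite ler_wpM2l ?ler_expR // addr_ge0 ?anchor_cst_ge0 //.
by apply: pinvf_ge0 => //; exact: family_anchor_span.
Unshelve. all: by end_near. Qed.

(* [pot] decreases along the flow, so [e^{b w_i(t)} <= sum_j e^{b w_j(0)} + O(b)]. *)
Lemma family_ub S k : 0 < k ->
  \forall e \near G, forall t i, 0 <= t <= S -> w_ e t i 0 <= k.
Proof.
move=> k0; set C := sqf M p + family_cst S.
have C0 : 0 <= C by rewrite !addr_ge0 ?family_cst_ge0 ?sqf_ge0.
have nwk : \forall e \near G, forall j, w_ e 0 j 0 <= k / 2.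
  apply: filter_forall => j; have /cvgr_le := @w0_cvg j; apply.
  by apply: le_lt_trans (w0_le0 j) _; rewrite divr_gt0.
near=> e => t i t0S; have /andP[t0 tS] := t0S.
rewrite leNgt; apply/negP => kw.
have b1 : 1 <= b_ e by near: e; exact: family_b_ge.
(* With [y = e^{b k / 2}], a coordinate above [k] would give [y^2 <= d y + b C]. As
   [y >= 1 + b k / 2], this fails once [b k / 2 >= d + 2 C / k], which is the present threshold. *)
have bbig : 2 / k * (d%:R + 2 * C / k) <= b_ e by near: e; exact: family_b_ge.
have b0 : 0 < b_ e by exact: lt_le_trans b1.
have fe : entropic_flow M p (b_ e) (w_ e) by near: e.
have wk : forall j, w_ e 0 j 0 <= k / 2.
  by near: e.
have hV : forall t, 0 <= t <= S -> anchor_cst M p (b_ e) + V (w_ e t - a_ e) <= family_cst S.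
  by near: e; exact: family_anchor.
have hp t' : 0 <= t' <= S -> V (w_ e t' - a_ e) <= family_cst S.
  by move=> /hV; have := anchor_cst_ge0 p M_psd b0; lra.
have sp t' (h : 0 <= t') := anchor_in_span MPM fe (family_anchor_span e) h.
set y := expR (b_ e * (k / 2)).
have m0 : mass (b_ e) (w_ e 0) <= d%:R * y.
  rewrite /mass -[d in d%:R]card_ord -sum1_card natr_sum mulr_suml.
  by apply: ler_sum => j _; rewrite mul1r ler_expR ler_pM2l.
have mt : y ^+ 2 <= mass (b_ e) (w_ e t).
  rewrite /mass (bigD1 i) //= -[leLHS]addr0 lerD //; last first.
    by apply: sumr_ge0 => j _; exact: expR_ge0.
  rewrite /y expr2 -expRD ler_expR -mulrDr ler_pM2l //.
  by rewrite (le_trans _ (ltW kw)) // -splitr.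
have pn := pot_nincr M_sym M_psd b0 fe (lexx 0) t0.
have h1 := inner_le_pinvf M_sym M_psd MPM p (sp t t0).
have h2 := inner_le_pinvf M_sym M_psd MPM (- p) (sp 0 (lexx 0)).
have S0 : (0 : R) <= 0 <= S by apply/andP; split; [exact: lexx|exact: le_trans tS].
have := hp _ t0S; have := hp _ S0.
move: h1 h2; rewrite sqfN // innerNl !innerBr -/V => h1 h2 V0 Vt.
have key : mass (b_ e) (w_ e t) <= mass (b_ e) (w_ e 0) + b_ e * C.
  have : (b_ e)^-1 * mass (b_ e) (w_ e t) <= (b_ e)^-1 * mass (b_ e) (w_ e 0) + C.
    move: pn; rewrite /pot /C. lra.
  rewrite -(ler_pM2l b0) mulrDr !mulrA divff ?gt_eqF // !mul1r.
  by [].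
have yb : 1 + b_ e * (k / 2) <= y by exact: expR_ge1Dx.
have e1 : d%:R + 2 * C / k <= b_ e * (k / 2).
  rewrite -ler_pdivrMr ?divr_gt0 //; apply: le_trans bbig.
  by rewrite le_eqVlt; apply/orP; left; apply/eqP; field; rewrite gt_eqF.
have e2 : b_ e * C <= (b_ e * (k / 2)) * (2 * C / k).
  by rewrite le_eqVlt; apply/orP; left; apply/eqP; field; rewrite gt_eqF.
have b20 : 0 <= b_ e * (k / 2) by rewrite mulr_ge0 ?divr_ge0 // ltW.
have C20 : 0 <= 2 * C / k by rewrite divr_ge0 ?mulr_ge0 // ltW.
have d0 : 0 <= d%:R :> R by [].
move: mt m0 key yb e1 e2 b20 C20 d0.
move: (b_ e * (k / 2)) (2 * C / k) (b_ e * C) => B D E.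
nra.
Unshelve. all: by end_near. Qed.

Lemma diag_le_sum i : M i i <= \sum_j M j j.
Proof.
rewrite (bigD1 i) //= lerDl; apply: sumr_ge0 => j _; exact: diag_ge0 M_psd j.
Qed.

(** Every error in [flows_close] is brought below one number [h]: the quotients [d / b], the upper
    bound on [w], and the initial gap. The resulting bound is [h C] with [C] independent of the two
    flows. *)
Lemma family_cauchy S k : 0 < k ->
  \forall e \near G & e' \near G, forall t i, 0 <= t <= S ->
    `|w_ e t i 0 - w_ e' t i 0| <= k.
Proof.
move=> k0; have [eta eta0 heta] := family_eta.
have [S0|S0] := ltP S 0.
  near=> e e' => t i /andP[t0 tS].
  by have := le_lt_trans (le_trans t0 tS) S0; rewrite ltxx.
pose C := 4 * S + 2 / eta * (2 * family_cst S * S + 2 * sqf M zeta).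
have C0 : 0 <= C.
  apply: addr_ge0; first by rewrite mulr_ge0.
  apply: mulr_ge0; first by rewrite divr_ge0 // ltW.
  apply: addr_ge0; last by rewrite mulr_ge0 ?sqf_ge0.
  by rewrite mulr_ge0 // mulr_ge0 // family_cst_ge0.
pose D := 1 + (\sum_j M j j) * C.
have tr0 : 0 <= \sum_j M j j by apply: sumr_ge0 => j _; exact: diag_ge0 M_psd j.
have D0 : 0 < D by rewrite ltr_wpDr // mulr_ge0.
(* The first entry controls the initial gap; the second gives
   [(sum_j M j j) * (h * C) <= (k / 2)^2], a bound on the squared coordinates. The [1 +] in [D]
   keeps it positive. *)
pose h := Num.min (k / 2) ((k / 2) ^+ 2 / D).
have k20 : 0 < k / 2 by rewrite divr_gt0.
have h0 : 0 < h by rewrite lt_min k20 divr_gt0 ?exprn_gt0.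
have hD : h * D <= (k / 2) ^+ 2 by rewrite -ler_pdivlMr // ge_min lexx orbT.
have hk : h <= k / 2 by rewrite ge_min lexx.
have nw0 : \forall e \near G, forall i, `|w0 i 0 - w_ e 0 i 0| <= h / 2.
  apply: filter_forall => i; have /cvgr_dist_le := @w0_cvg i; apply.
  by rewrite divr_gt0.
have nub := family_ub S h0.
have nb : \forall e \near G, d%:R / h <= b_ e by exact: family_b_ge.
have nb1 := family_b_ge 1.
near=> e e' => t i t0S; have /andP[t0 tS] := t0S.
have b1 : 1 <= b_ e by near: e.
have b1' : 1 <= b_ e' by near: e'.
have b0 := lt_le_trans ltr01 b1.
have b0' := lt_le_trans ltr01 b1'.
have fe : entropic_flow M p (b_ e) (w_ e) by near: e.
have fe' : entropic_flow M p (b_ e') (w_ e') by near: e'.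
have ae : forall i, a_ e i 0 <= - eta by near: e.
have ae' : forall i, a_ e' i 0 <= - eta by near: e'.
have ube : forall t i, 0 <= t <= S -> w_ e t i 0 <= h by near: e.
have ube' : forall t i, 0 <= t <= S -> w_ e' t i 0 <= h by near: e'.
have we : forall i, `|w0 i 0 - w_ e 0 i 0| <= h / 2 by near: e.
have we' : forall i, `|w0 i 0 - w_ e' 0 i 0| <= h / 2 by near: e'.
have ww j : `|w_ e 0 j 0 - w_ e' 0 j 0| <= h.
  rewrite (splitr h) (le_trans _ (lerD (we j) (we' j))) //.
  by rewrite [leRHS]addrC [X in _ <= _ + X]distrC -[X in `|X| <= _](subrKA (w0 j 0)) addrC ler_normD.
have db : d%:R / b_ e <= h.
  by rewrite ler_pdivrMr // mulrC -ler_pdivrMr //; near: e.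
have db' : d%:R / b_ e' <= h.
  by rewrite ler_pdivrMr // mulrC -ler_pdivrMr //; near: e'.
have := flows_close M_sym M_psd MPM b0 b0' fe fe' (family_anchor_span e)
  (family_anchor_span e') eta0 ae ae' (ltW h0) ube ube' ww t0S.
rewrite -/V !family_anchor0; set E := V _ => hE.
have c1 := anchor_bound_le S b1; have c2 := anchor_bound_le S b1'.
have hEC : E <= h * C.
  apply: le_trans hE _.
  have -> : h * C = 2 * (h + h) * S +
     2 * h / eta * ((family_cst S + family_cst S) * S + sqf M zeta + sqf M zeta).
    by rewrite /C; field; rewrite gt_eqF.
  have hh := ltW h0.
  apply: lerD.
    apply: ler_pM => //; first by rewrite mulr_ge0 // addr_ge0 // divr_ge0 // ltW.
    by rewrite ler_wpM2l // lerD.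
  apply: ler_wpM2l; first by rewrite divr_ge0 ?mulr_ge0 // ltW.
  rewrite !lerD2r ler_pM ?lerD // addr_ge0 //.
    by rewrite mulr_ge0 ?expR_ge0 // addr_ge0 ?anchor_cst_ge0 // -/V family_anchor0 sqf_ge0.
  by rewrite mulr_ge0 ?expR_ge0 // addr_ge0 ?anchor_cst_ge0 // -/V family_anchor0 sqf_ge0.
set v := (w_ e t - w_ e' t) - (w_ e 0 - w_ e' 0) in E hE hEC.
have vM : in_span M P v.
  have -> : v = (w_ e t - w_ e 0) - (w_ e' t - w_ e' 0).
    by apply/matrixP => ? ?; rewrite !mxE; ring.
  by apply: in_spanB; [exact: (flow_in_span MPM fe)|exact: (flow_in_span MPM fe')].
have v2 : v i 0 ^+ 2 <= (k / 2 - h / 2 + h / 2) ^+ 2.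
  rewrite subrK; apply: le_trans hD; apply: le_trans (pinvf_coord_sq M_sym M_psd MPM i vM) _.
  rewrite -/V -/E; apply: (@le_trans _ _ ((\sum_j M j j) * (h * C))).
    apply: ler_pM => //; first exact: diag_ge0 M_psd i.
      exact: pinvf_ge0.
    exact: diag_le_sum.
  have -> : h * D = h + (\sum_j M j j) * (h * C) by rewrite /D; ring.
  by rewrite lerDr ltW.
have vk : `|v i 0| <= k / 2.
  by move: v2; rewrite subrK -[X in X <= _]real_normK ?num_real // ler_pXn2r // nnegrE ltW.
have -> : w_ e t i 0 - w_ e' t i 0 = v i 0 + (w_ e 0 i 0 - w_ e' 0 i 0).
  by rewrite !mxE; ring.
by rewrite (le_trans (ler_normD _ _)) // (splitr k) lerD // (le_trans (ww i)).
Unshelve. all: by end_near. Qed.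

(* Times are truncated at [0] so that the limit is continuous on the whole line. *)
Definition limit_flow t : 'cV[R]_d := \col_i lim (w_ e (Num.max t 0) i 0 @[e --> G]).
Local Notation wb := limit_flow.

Lemma limit_flow_unif S k : 0 < k ->
  \forall e \near G, forall t i, 0 <= t <= S -> `|w_ e t i 0 - wb t i 0| <= k.
Proof.
move=> k0.
have cv t i : 0 <= t <= S -> w_ e t i 0 @[e --> G] --> wb t i 0.
  move=> t0S; rewrite mxE /= (max_l (proj1 (andP t0S))).
  apply/cauchy_cvgP/cauchy_ballP => r r0.
  have r20 : 0 < r / 2 by rewrite divr_gt0.
  have := family_cauchy S r20.
  move=> [[A B] /= [GA GB] AB].
  exists ((fun e => w_ e t i 0) @` A, (fun e => w_ e t i 0) @` B) => /=.
    by split; [apply: filterS GA => x Ax; exists x|apply: filterS GB => x Bx; exists x].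
  move=> [_ _] /= [[x Ax <-] [y By <-]].
  rewrite /ball /= (le_lt_trans (AB (x, y) (conj Ax By) t i t0S)) //.
  by rewrite ltr_pdivrMr // mulr_natr mulr2n ltrDl.
have k20 : 0 < k / 2 by rewrite divr_gt0.
have := family_cauchy S k20 => -[[A B] /= [GA GB] AB].
apply: filterS GA => e Ae t i t0S.
have /cvgr_dist_le := cv t i t0S => /(_ _ k20) h.
have [e' [Be' he']] := filter_ex (filterI GB h).
rewrite -(subrKA (w_ e' t i 0)) (splitr k) (le_trans (ler_normD _ _)) //.
by rewrite lerD //; [exact: (AB (e, e') (conj Ae Be'))|rewrite distrC].
Qed.

Lemma limit_flow_cvg t i : 0 <= t -> w_ e t i 0 @[e --> G] --> wb t i 0.
Proof.
move=> t0; apply/cvgrPdist_le => k k0.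
have := limit_flow_unif t k0; apply: filterS => e /(_ t i).
by rewrite t0 lexx distrC => ->.
Qed.

Lemma limit_flow_continuous : col_continuous wb.
Proof.
move=> i s; apply/cvgrPdist_le => k k0.
have k30 : 0 < k / 3 by rewrite divr_gt0.
set S := Num.max s 0 + 1.
have [e [[fe _] he]] := filter_ex (filterI fl (limit_flow_unif S k30)).
have wbE t : wb t = wb (Num.max t 0).
  by apply/matrixP => a b; rewrite !mxE -maxA maxxx.
have mc : {for s, continuous (fun t : R => Num.max t 0)}.
  by apply: continuous_max; [exact: cvg_id|exact: cvg_cst].
have mS : \forall t \near s, Num.max t 0 <= S.
  by have /cvgr_le := mc; apply; rewrite ltrDl.
have : \forall t \near s, `|w_ e (Num.max s 0) i 0 - w_ e (Num.max t 0) i 0| <= k / 3.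
  have /cvgr_dist_le : w_ e (Num.max t 0) i 0 @[t --> s] --> w_ e (Num.max s 0) i 0.
    by apply: (@continuous_comp _ _ _ (fun t : R => Num.max t 0) (fun t => w_ e t i 0)) => //; exact: fe.
  by apply.
apply: filterS2 mS => t tS ht.
rewrite wbE (wbE t).
have h1 : `|w_ e (Num.max s 0) i 0 - wb (Num.max s 0) i 0| <= k / 3.
  by apply: he; apply/andP; split; [rewrite le_max lexx orbT|rewrite /S lerDl].
have h2 : `|w_ e (Num.max t 0) i 0 - wb (Num.max t 0) i 0| <= k / 3.
  by apply: he; apply/andP; split; [rewrite le_max lexx orbT|].
rewrite distrC in h1.
have -> : k = k / 3 + (k / 3 + k / 3) by field.
rewrite (_ : _ - _ = (wb (Num.max s 0) i 0 - w_ e (Num.max s 0) i 0) +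
  ((w_ e (Num.max s 0) i 0 - w_ e (Num.max t 0) i 0) +
   (w_ e (Num.max t 0) i 0 - wb (Num.max t 0) i 0))); last by ring.
rewrite (le_trans (ler_normD _ _)) // lerD // (le_trans _ (lerD ht h2)) //.
by rewrite ler_normD.
Qed.

Lemma limit_flow0 : wb 0 = w0.
Proof.
apply/matrixP => i j; rewrite (ord1 j).
have := @limit_flow_cvg 0 i (lexx 0) => /cvg_unique; apply => //.
exact: w0_cvg.
Qed.

Lemma limit_flow_le0 t i : 0 <= t -> wb t i 0 <= 0.
Proof.
move=> t0; rewrite leNgt; apply/negP => wt.
have k0 : 0 < wb t i 0 / 2 by rewrite divr_gt0.
have : wb t i 0 <= wb t i 0 / 2.
  have /cvgr_to_le := @limit_flow_cvg t i t0; apply.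
  by apply: filterS (family_ub t k0) => e; apply; rewrite t0 lexx.
by rewrite leNgt ltr_pdivrMr // mulr_natr mulr2n ltrDl wt.
Qed.

Let wbi t (t0 : 0 <= t) i : w_ e t i 0 @[e --> G] --> wb t i 0 := @limit_flow_cvg t i t0.

Lemma inner_limit_flow z t : 0 <= t -> inner z (w_ e t) @[e --> G] --> inner z (wb t).
Proof. by move=> t0; apply: inner_cvg => i; [exact: cvg_cst|exact: wbi]. Qed.

(** Smoothing at positive times. [pot_anchor] bounds the potential at [t / 2], and the drop of the
    potential over [[t / 2, t]] bounds the speed at [t]. The mass then follows from
    [anchor_derive_ub], where Young's inequality with [z = x - p] controls the remaining inner
    product by the speed. *)
Lemma family_speed_mass_bound s S : 0 < s -> exists C : R, \forall e \near G,
  forall t, s <= t <= S -> speed2 M p (b_ e) (w_ e t) <= C /\ mass (b_ e) (w_ e t) <= C.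
Proof.
move=> s0; have [eta eta0 heta] := family_eta.
set f := family_cst S.
(* [K] bounds [t * (t / 2) * speed2]: [sqf M zeta] comes from [pot_anchor], and
   [S * (d + sqf M p + f)] bounds [t] times the potential gap between the anchor and time [t]. *)
pose K := S * d%:R + sqf M zeta + S * (sqf M p + f).
pose C1 := K / (s * (s / 2)).
pose C2 := (2 * f + C1) / (2 * eta).
exists (Num.max C1 C2).
have nA := family_anchor S.
have nb := family_b_ge 1.
near=> e => t /andP[st tS].
have t0 : 0 < t := lt_le_trans s0 st.
have b1 : 1 <= b_ e by near: e.
have b0 := lt_le_trans ltr01 b1.
have fe : entropic_flow M p (b_ e) (w_ e) by near: e.
have ae : forall i, a_ e i 0 <= - eta by near: e.
have tS' : 0 <= t <= S by rewrite (ltW t0).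
have : anchor_cst M p (b_ e) + V (w_ e t - a_ e) <= f.
  by move: t tS' {st tS t0}; near: e.
have ac := anchor_cst_ge0 p M_psd b0.
have sp := anchor_in_span MPM fe (family_anchor_span e) (ltW t0).
have V0 : 0 <= V (w_ e t - a_ e) by exact: pinvf_ge0.
move=> Vf; rewrite !le_max.
have t20 : 0 <= t / 2 by rewrite divr_ge0 // ltW.
have t2t : t / 2 <= t by rewrite ler_pdivrMr // mulr_natr mulr2n lerDl ltW.
have h1 := pot_slope_lb M_sym b0 fe t20 t2t.
have h2 := pot_anchor M_sym M_psd MPM b0 fe (family_anchor_span e) t20.
have h3 : 0 <= V (w_ e (t / 2) - a_ e).
  by apply: pinvf_ge0 => //; exact: (anchor_in_span MPM fe (family_anchor_span e) t20).
have h4 := inner_le_pinvf M_sym M_psd MPM p sp.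
move: h2; rewrite -/V family_anchor0 => h2.
have ma : (b_ e)^-1 * mass (b_ e) (a_ e) <= d%:R.
  rewrite -[leRHS]mul1r ler_pM ?mass_ge0 ?invr_ge0 ?(ltW b0) //.
    by rewrite invf_le1.
  rewrite /mass -[d in leRHS]card_ord -sum1_card natr_sum ler_sum // => j _.
  rewrite -expR0 ler_expR mulr_ge0_le0 ?(ltW b0) // (le_trans (ae j)) //.
  by rewrite oppr_le0 ltW.
have mt : 0 <= (b_ e)^-1 * mass (b_ e) (w_ e t) by rewrite mulr_ge0 ?mass_ge0 // invr_ge0 ltW.
set sp2 := speed2 _ _ _ _ in h1 *.
have sp20 : 0 <= sp2 by exact: sqf_ge0.
have D0 : 0 < s * (s / 2) by rewrite mulr_gt0 // divr_gt0.
have key : sp2 <= C1.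
  rewrite /C1 ler_pdivlMr //.
  apply: (@le_trans _ _ (sp2 * (t * (t / 2)))).
    by rewrite ler_wpM2l // ler_pM ?divr_ge0 ?(ltW s0) // ler_pM2r.
  have tt : t - t / 2 = t / 2 by field.
  move: h1; rewrite tt => /(ler_wpM2l (ltW t0)) h1.
  have /(ler_wpM2l (ltW t0)) h5 : pot p (b_ e) (a_ e) - pot p (b_ e) (w_ e t) <= d%:R + (sqf M p + f).
    move: h4; rewrite /pot innerBr -/V => h4.
    have := sqf_ge0 M_psd p; lra.
  have /(ler_wpM2r (le_trans (ltW t0) tS)) h6 : 0 <= d%:R + (sqf M p + f).
    by rewrite !addr_ge0 ?sqf_ge0 ?family_cst_ge0.
  have h7 : t * (d%:R + (sqf M p + f)) <= S * (d%:R + (sqf M p + f)).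
    by rewrite ler_wpM2r // !addr_ge0 ?sqf_ge0 ?family_cst_ge0.
  have tt2 : 2 * (t / 2) = t by field.
  move: h2; rewrite tt2 /K; lra.
rewrite key; split=> //; apply/orP; right.
rewrite /C2 ler_pdivlMr ?mulr_gt0 //.
have := anchor_derive_ub M_sym M_psd MPM b0 fe (family_anchor_span e) ae (ltW t0).
have := inner_le_pinvf M_sym M_psd MPM (expcol (b_ e) (w_ e t) - p) sp.
rewrite -[_ - a_ e]opprB innerNr opprB -/V -/(speed2 _ _ _ _) -/sp2; lra.
Unshelve. all: by end_near. Qed.

(** The mass is bounded at a positive time while [b] diverges. At [t = 0] this may fail: a
    coordinate of [w_ e 0] can tend to [0] from above while its product with [b_ e] diverges. *)
Lemma family_mass_scaled t : 0 < t -> (b_ e)^-1 * mass (b_ e) (w_ e t) @[e --> G] --> 0.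
Proof.
move=> t0; have [C hC] := family_speed_mass_bound t t0.
apply/cvgrPdist_le => k k0.
near=> e.
have b0 : 0 < b_ e by near: e; exact: family_b_gt0.
have m0 : mass (b_ e) (w_ e t) <= C.
  have h : forall t', t <= t' <= t ->
    speed2 M p (b_ e) (w_ e t') <= C /\ mass (b_ e) (w_ e t') <= C by near: e.
  by have [] := h t; rewrite ?lexx.
rewrite sub0r normrN ger0_norm ?mulr_ge0 ?mass_ge0 ?invr_ge0 ?(ltW b0) //.
rewrite mulrC ler_pdivrMr // (le_trans m0) // mulrC -ler_pdivrMr //.
by near: e; exact: family_b_ge.
Unshelve. all: by end_near. Qed.

Definition limit_pot t : R := - inner p (wb t).
Local Notation Fb := limit_pot.

Lemma family_pot_cvg t : 0 < t -> pot p (b_ e) (w_ e t) @[e --> G] --> Fb t.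
Proof.
move=> t0; rewrite /Fb -[- _]add0r; apply: cvgB; first exact: family_mass_scaled.
exact/inner_limit_flow/ltW.
Qed.

Lemma limit_pot_continuous : continuous Fb.
Proof.
move=> t; apply: cvgN; apply: continuous_inner; first exact: col_continuous_cst.
exact: limit_flow_continuous.
Qed.

Lemma limit_inner_sq z s t : 0 <= s -> s <= t ->
  inner z (wb t - wb s) ^+ 2 <= sqf M z * ((t - s) * (Fb s - Fb t)).
Proof.
have pos s' : 0 < s' -> s' <= t ->
    inner z (wb t - wb s') ^+ 2 <= sqf M z * ((t - s') * (Fb s' - Fb t)).
  move=> s0 st; have t0 := lt_le_trans s0 st.
  apply: (le_of_cvg (G := G) (f := fun e => inner z (w_ e t - w_ e s') ^+ 2)
    (g := fun e => sqf M z * ((t - s') * (pot p (b_ e) (w_ e s') - pot p (b_ e) (w_ e t))))).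
  - have h : inner z (w_ e t - w_ e s') @[e --> G] --> inner z (wb t - wb s').
      rewrite innerBr; under eq_cvg do rewrite innerBr.
      by apply: cvgB; exact/inner_limit_flow/ltW.
    exact: (cvg_sqr h).
  - apply: cvgM; first exact: cvg_cst.
    by apply: cvgM; [exact: cvg_cst|apply: cvgB; exact: family_pot_cvg].
  near=> e; apply: (flow_inner_sq M_sym M_psd MPM) => //; last exact: ltW.
    by near: e; exact: family_b_gt0.
  by near: e.
(* The potentials converge at positive times only, so [s = 0] is reached by continuity of both
   sides. *)
rewrite le_eqVlt => /predU1P[<-|]; last exact: pos.
rewrite le_eqVlt => /predU1P[<-|t0].
  by rewrite !subrr inner0r mul0r mulr0 expr0n.
apply: (@le_at_right0 _ (fun s => inner z (wb t - wb s) ^+ 2)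
   (fun s => sqf M z * ((t - s) * (Fb s - Fb t))) t _ _ t0).
- have h : continuous (fun s => inner z (wb t - wb s)).
    apply: continuous_inner; first exact: col_continuous_cst.
    by apply: col_continuousB; [exact: col_continuous_cst|exact: limit_flow_continuous].
  by move=> x; exact: (cvg_sqr (@h x)).
- move=> x; apply: cvgM; first exact: cvg_cst.
  apply: cvgM; first by apply: cvgB; [exact: cvg_cst|exact: cvg_id].
  by apply: cvgB; [exact: limit_pot_continuous|exact: cvg_cst].
by move=> r /andP[]; exact: pos.
Unshelve. all: by end_near. Qed.

Lemma limit_potB s t : Fb s - Fb t = inner p (wb t - wb s).
Proof. by rewrite /Fb innerBr opprK addrC. Qed.

(** For [z = p] the left side of [limit_inner_sq] is [(Fb s - Fb t)^2], and one factor cancels. *)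
Lemma limit_pot_lip s t : 0 <= s -> s <= t -> Fb s - Fb t <= sqf M p * (t - s).
Proof.
move=> s0 st; have ts : 0 <= t - s by rewrite subr_ge0.
have [D0|D0] := leP (Fb s - Fb t) 0.
  by rewrite (le_trans D0) // mulr_ge0 ?sqf_ge0.
have := limit_inner_sq p s0 st; rewrite -limit_potB mulrA expr2 ler_pM2r //.
Qed.

Lemma limit_flow_lip : exists2 C : R, 0 <= C &
  forall i s t, 0 <= s -> s <= t -> `|wb t i 0 - wb s i 0| <= C * (t - s).
Proof.
have tr0 : 0 <= \sum_j M j j by apply: sumr_ge0 => j _; exact: diag_ge0 M_psd j.
(* The squared increment is bounded by [C (t - s)^2]; the [1 +] gives [C <= C^2], which spares a
   square root. *)
set C := 1 + (\sum_j M j j) * sqf M p.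
have m0 : 0 <= (\sum_j M j j) * sqf M p by rewrite mulr_ge0 ?sqf_ge0.
have C1 : 1 <= C by rewrite lerDl.
have C0 : 0 <= C := le_trans ler01 C1.
exists C => // i s t s0 st; have ts : 0 <= t - s by rewrite subr_ge0.
have : (wb t i 0 - wb s i 0) ^+ 2 <= (C * (t - s)) ^+ 2.
  have -> : wb t i 0 - wb s i 0 = inner (delta_mx i 0) (wb t - wb s).
    by rewrite inner_delta !mxE.
  apply: le_trans (limit_inner_sq _ s0 st) _; rewrite sqf_delta.
  apply: (@le_trans _ _ (M i i * ((t - s) * (sqf M p * (t - s))))).
    by rewrite ler_wpM2l ?diag_ge0 // ler_wpM2l // limit_pot_lip.
  have -> : M i i * ((t - s) * (sqf M p * (t - s))) = (M i i * sqf M p) * (t - s) ^+ 2 by ring.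
  rewrite exprMn ler_wpM2r ?sqr_ge0 //.
  apply: (@le_trans _ _ C); last by rewrite expr2 ler_peMl.
  by rewrite ler_wpDl // ler_wpM2r ?sqf_ge0 // diag_le_sum.
by rewrite -[X in X <= _]real_normK ?num_real // ler_pXn2r // nnegrE mulr_ge0.
Qed.

Lemma limit_flow_quotient z i s t : 0 < s -> s < t ->
  ((t - s)^-1 * (wb t i 0 - wb s i 0) + (M *m z) i 0) ^+ 2 <=
  M i i * ((t - s)^-1 * (Fb s - Fb t) + sqf M z
           + 2 * (t - s)^-1 * inner z (wb t - wb s)).
Proof.
move=> s0 st; have t0 := lt_trans s0 st.
apply: (le_of_cvg (G := G)
  (f := fun e => ((t - s)^-1 * (w_ e t i 0 - w_ e s i 0) + (M *m z) i 0) ^+ 2)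
  (g := fun e => M i i * ((t - s)^-1 * (pot p (b_ e) (w_ e s) - pot p (b_ e) (w_ e t))
      + sqf M z + 2 * (t - s)^-1 * inner z (w_ e t - w_ e s)))).
- apply: cvg_sqr; apply: cvgD; last exact: cvg_cst.
  apply: cvgM; first exact: cvg_cst.
  by apply: cvgB; apply: limit_flow_cvg; exact: ltW.
- apply: cvgM; first exact: cvg_cst.
  apply: cvgD; first apply: cvgD; try exact: cvg_cst.
    by apply: cvgM; [exact: cvg_cst|apply: cvgB; exact: family_pot_cvg].
  apply: cvgM; first exact: cvg_cst.
  rewrite innerBr; under eq_cvg do rewrite innerBr.
  by apply: cvgB; exact/inner_limit_flow/ltW.
near=> e; apply: (flow_quotient M_sym M_psd MPM) => //; last exact: ltW.
  by near: e; exact: family_b_gt0.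
by near: e.
Unshelve. all: by end_near. Qed.

Lemma family_speed_ub r s k : 0 < r -> r < s -> 0 < k ->
  \forall e \near G, (s - r) * speed2 M p (b_ e) (w_ e s) <= Fb r - Fb s + k.
Proof.
move=> r0 rs k0; have s0 := lt_trans r0 rs.
have : pot p (b_ e) (w_ e r) - pot p (b_ e) (w_ e s) @[e --> G] --> Fb r - Fb s.
  by apply: cvgB; exact: family_pot_cvg.
move=> /cvgr_le /(_ (Fb r - Fb s + k)); rewrite ltrDl => /(_ k0) h.
near=> e.
have hp : pot p (b_ e) (w_ e r) - pot p (b_ e) (w_ e s) <= Fb r - Fb s + k by near: e.
apply: le_trans hp.
have b0 : 0 < b_ e by near: e; exact: family_b_gt0.
have fe : entropic_flow M p (b_ e) (w_ e) by near: e.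
exact: (pot_slope_lb M_sym b0 fe (ltW r0) (ltW rs)).
Unshelve. all: by end_near. Qed.

Lemma family_speed_lb s t k : 0 < s -> s < t -> 0 < k ->
  \forall e \near G, Fb s - Fb t - k <= (t - s) * speed2 M p (b_ e) (w_ e s).
Proof.
move=> s0 st k0; have t0 := lt_trans s0 st.
have : pot p (b_ e) (w_ e s) - pot p (b_ e) (w_ e t) @[e --> G] --> Fb s - Fb t.
  by apply: cvgB; exact: family_pot_cvg.
move=> /cvgr_ge /(_ (Fb s - Fb t - k)); rewrite ltrBlDr ltrDl => /(_ k0) h.
near=> e.
have hp : Fb s - Fb t - k <= pot p (b_ e) (w_ e s) - pot p (b_ e) (w_ e t) by near: e.
apply: le_trans hp _.
have b0 : 0 < b_ e by near: e; exact: family_b_gt0.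
have fe : entropic_flow M p (b_ e) (w_ e) by near: e.
exact: (pot_slope_ub M_sym b0 fe (ltW s0) (ltW st)).
Unshelve. all: by end_near. Qed.

Lemma limit_pot_convex r s t : 0 < r -> r < s -> s < t ->
  (s - r) * (Fb s - Fb t) <= (t - s) * (Fb r - Fb s).
Proof.
move=> r0 rs st; have s0 := lt_trans r0 rs.
have h1 : 0 < s - r by rewrite subr_gt0.
have h2 : 0 < t - s by rewrite subr_gt0.
apply/ler_addgt0Pr => k k0.
have k10 : 0 < k / (t - r) by rewrite divr_gt0 // subr_gt0 (lt_trans rs).
have [e [u l]] := filter_ex (filterI (family_speed_ub r0 rs k10) (family_speed_lb s0 st k10)).
have := ler_wpM2l (ltW h1) l; have := ler_wpM2l (ltW h2) u.
have : (s - r) * (k / (t - r)) + (t - s) * (k / (t - r)) = k.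
  by field; rewrite subr_eq0 gt_eqF // (lt_trans rs).
set sp := speed2 _ _ _ _; lra.
Qed.

Lemma family_expcol_cvg0 s i : 0 <= s -> wb s i 0 < 0 ->
  expR (b_ e * w_ e s i 0) @[e --> G] --> 0.
Proof.
move=> s0 ws.
have hw : \forall e \near G, w_ e s i 0 <= wb s i 0 / 2.
  have /cvgr_le := @limit_flow_cvg s i s0; apply.
  by rewrite ltr_pdivlMr // mulr_natr mulr2n gtrDl.
apply/cvgrPdist_le => k k0; near=> e.
rewrite sub0r normrN ger0_norm ?expR_ge0 //.
have b0 : 0 < b_ e by near: e; exact: family_b_gt0.
set y := - wb s i 0 / 2.
have y0 : 0 < y by rewrite divr_gt0 // oppr_gt0.
have we : w_ e s i 0 <= - y by rewrite /y mulNr opprK; near: e.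
apply: (@le_trans _ _ (expR (- (b_ e * y)))).
  by rewrite ler_expR -mulrN ler_pM2l.
rewrite expRN -[k]invrK lef_pV2 ?posrE ?expR_gt0 ?invr_gt0 //.
apply: le_trans (ltW (expR_gt1Dx _)); last by rewrite gt_eqF // mulr_gt0.
apply: (@le_trans _ _ (b_ e * y)); last by rewrite lerDr.
by rewrite -ler_pdivrMr //; near: e; exact: family_b_ge.
Unshelve. all: by end_near. Qed.

(** The coordinates of [x] are bounded by the mass, so they converge along an ultrafilter finer than
    [G]. The limit vanishes wherever [wb s] is negative, which is feasibility, and the speed bound
    passes to the limit by continuity of the quadratic form. *)
Lemma limit_primal s : 0 < s -> exists y : 'cV[R]_d, feasible (wb s) y /\
  forall r, 0 < r -> r < s -> (s - r) * sqf M (y - p) <= Fb r - Fb s.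
Proof.
move=> s0; have [C hC] := family_speed_mass_bound s s0.
have [U [UU GU]] := ultraFilterLemma GG.
have UP : ProperFilter U by exact: ultra_proper.
have /choice[y hy] : forall i, exists l : R, expR (b_ e * w_ e s i 0) @[e --> U] --> l.
  move=> i; apply: (@ultra_bounded_cvg _ _ U _ _ C UU); apply: GU.
  apply: filterS hC => e /(_ s); rewrite !lexx => /(_ isT)[_ mC].
  rewrite expR_ge0 /= (le_trans _ mC) // /mass (bigD1 i) //= lerDl.
  by apply: sumr_ge0 => j _; exact: expR_ge0.
exists (\col_i y i); split.
  split=> [i|].
    rewrite mxE; apply: (cvgr_to_ge (hy i)); apply: nearW => e; exact: expR_ge0.
  rewrite /inner big1 // => i _; rewrite mxE.
  have := limit_flow_le0 i (ltW s0); rewrite le_eqVlt => /predU1P[->|ws].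
    by rewrite mul0r.
  have h : expR (b_ e * w_ e s i 0) @[e --> U] --> 0.
    by apply: cvg_trans (family_expcol_cvg0 (ltW s0) ws); move=> A /GU.
  by rewrite (cvg_unique _ (hy i) h) // mulr0.
move=> r r0 rs; apply/ler_addgt0Pr => k k0.
apply: (cvgr_to_le (f := fun e => (s - r) * speed2 M p (b_ e) (w_ e s)) (F := U)).
  have hc i : (expcol (b_ e) (w_ e s) - p) i 0 @[e --> U] --> (\col_i y i - p) i 0.
    rewrite !mxE; under eq_cvg do rewrite !mxE.
    by apply: cvgB; [exact: hy|exact: cvg_cst].
  apply: cvgM; first exact: cvg_cst.
  apply: inner_cvg => // i; rewrite mxE; under eq_cvg do rewrite mxE.
  by apply: cvg_sum_ord => j; apply: cvgM; [exact: cvg_cst|exact: hc].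
by apply: GU; exact: family_speed_ub.
Qed.

Lemma limit_flow_mirror : exists x : R -> 'cV[R]_d,
  {ae @lebesgue_measure R, forall t, 0 <= t -> mirror_at M p wb (x t) t}.
Proof.
have /choice[x hx] : forall s, exists y : 'cV[R]_d, 0 < s -> feasible (wb s) y /\
    forall r, 0 < r -> r < s -> (s - r) * sqf M (y - p) <= Fb r - Fb s.
  move=> s; have [s0|s0] := ltP 0 s; last by exists 0.
  by have [y hy] := limit_primal s0; exists y.
exists x; set D := [set s | 0 < s /\ ~ regular_time p wb s].
have cD : countable D by exact: irregular_countable.
have nD : (@lebesgue_measure R).-negligible D.
  exists D; split => //; last exact: countable_lebesgue_measure0.
  by apply: countable_measurable => // t; exact: measurable_set1.
have n0 : (@lebesgue_measure R).-negligible [set 0].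
  by exists [set 0]; split => //; exact: lebesgue_measure_set1.
apply: negligibleS (negligibleU nD n0) => t /= /not_implyP[t0 nm].
have [->|tn0] := eqVneq t 0; [by right|left].
have t_gt0 : 0 < t by rewrite lt_neqAle eq_sym tn0.
split => // treg; apply: nm; have [[y0 yw] hy] := hx t t_gt0.
split => // [|i]; last exact: limit_flow_le0.
apply: regular_derive => //; [exact: limit_flow_continuous|exact: limit_flow_le0
  |exact: limit_pot_convex|exact: limit_flow_quotient|exact: limit_primal].
Qed.

Section at_mirror_time.
Variables (s : R) (y : 'cV[R]_d).
Hypothesis s_gt0 : 0 < s.
Hypothesis ym : mirror_at M p wb y s.

Let orth z (hz : feasible (wb s) z) : inner z (M *m (y - p)) = 0 :=
  mirror_at_orthogonal s_gt0 limit_flow_le0 ym hz.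

Lemma mirror_speed : inner p (M *m (y - p)) = - sqf M (y - p).
Proof.
have [_ y0 _ yw] := ym.
by rewrite /sqf innerBl (orth (conj y0 yw)) sub0r opprK.
Qed.

(** Pythagoras: [y] is orthogonal to [y - p] for the form of [M]. The bound is uniform in [s], and
    serves for domination. *)
Lemma mirror_speed_le : sqf M (y - p) <= sqf M p.
Proof.
have h : sqf M p = sqf M (y - (y - p)) by rewrite opprB addrC subrK.
have [_ y0 _ yw] := ym.
rewrite h [leRHS](sqfB M_sym) (orth (conj y0 yw)) mulr0 subr0 lerDr; exact: sqf_ge0.
Qed.

Lemma is_derive_limit_pot : is_derive s 1 Fb (- sqf M (y - p)).
Proof.
have [wd _ _ _] := ym.
have h := is_derive_inner (col_derive_cst p s) wd.
have h' := is_deriveN h; apply: is_derive_eq h' _.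
by rewrite inner0l add0r innerNr mirror_speed opprK.
Qed.

(** Up to an error [k / 2 * h], the speed times [h] lies between the drops of [Fb] over [[s, s + h]]
    and [[s - h, s]]. Differentiability of [Fb] at [s] bounds the first from below and the second
    from above. *)
Lemma family_speed_cvg : speed2 M p (b_ e) (w_ e s) @[e --> G] --> sqf M (y - p).
Proof.
set K := sqf M (y - p); apply/cvgrPdist_le => k k0.
have k20 : 0 < k / 2 by rewrite divr_gt0.
have Kk : - K < - K + k / 2 by rewrite ltrDl.
have Kk' : K < K + k / 2 by rewrite ltrDl.
have hr := is_derive_right_ub is_derive_limit_pot Kk.
have hl : \forall h \near (0 : R)^'+, Fb (2 * s - (s + h)) - Fb (2 * s - s) <= (K + k / 2) * h.
  apply: (is_derive_right_ub (f := fun t => Fb (2 * s - t)) _ Kk').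
  have hd : is_derive s 1 (fun t => 2 * s - t) (0 - 1) by apply: is_deriveB_fun.
  have fd' : is_derive (2 * s - s) 1 Fb (- K).
    by rewrite (_ : 2 * s - s = s); [exact: is_derive_limit_pot|ring].
  have := @is_derive1_comp _ Fb (fun t => 2 * s - t) s _ _ fd' hd.
  by rewrite (_ : - K * (0 - 1) = K); last by ring.
have [h [[[h1 h2] h0] hs]] := filter_ex (filterI (filterI (filterI hr hl)
  (nbhs_right_gt (0 : R))) (nbhs_right_lt s_gt0)).
have rs : s - h < s by rewrite gtrBl.
have r0 : 0 < s - h by rewrite subr_gt0.
have st : s < s + h by rewrite ltrDl.
have e0 : 0 < k / 2 * h by rewrite mulr_gt0.
move: h2; rewrite (_ : 2 * s - (s + h) = s - h); last by ring.
rewrite (_ : 2 * s - s = s); last by ring.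
move=> h2; apply: filterS2 (family_speed_ub r0 rs e0) (family_speed_lb s_gt0 st e0) => e.
rewrite (_ : s - (s - h) = h); last by ring.
rewrite (_ : s + h - s = h); last by ring.
set sp := speed2 _ _ _ _ => u l.
have u' : sp <= K + k.
  by rewrite -(ler_pM2l h0); lra.
have l' : K - k <= sp.
  by rewrite -(ler_pM2l h0); lra.
by rewrite ler_norml; apply/andP; split; lra.
Qed.

(** Expanding [|x - y|_M^2] around [p] leaves the convergence of the speed and
    [<x, M (y - p)> -> 0]. The latter holds coordinatewise: where [wb s] is negative, [x_i] tends to
    [0]; where it is [0], the coordinate is maximal at [s], so its derivative [- (M (y - p))_i]
    vanishes. *)
Lemma family_expcol_cvg : sqf M (expcol (b_ e) (w_ e s) - y) @[e --> G] --> 0.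
Proof.
have [wd y0 w0' yw] := ym.
set K := sqf M (y - p).
have E e : sqf M (expcol (b_ e) (w_ e s) - y) = speed2 M p (b_ e) (w_ e s) + K
   - 2 * (inner (expcol (b_ e) (w_ e s)) (M *m (y - p)) + K).
  have -> : expcol (b_ e) (w_ e s) - y = (expcol (b_ e) (w_ e s) - p) - (y - p).
    by apply/matrixP => i j; rewrite !mxE; ring.
  by rewrite sqfB // innerBl mirror_speed /speed2 -/K; ring.
suff h : speed2 M p (b_ e) (w_ e s) + K
    - 2 * (inner (expcol (b_ e) (w_ e s)) (M *m (y - p)) + K) @[e --> G]
    --> K + K - 2 * (0 + K).
  by under eq_cvg do rewrite E; move: h; rewrite (_ : K + K - 2 * (0 + K) = 0) //; ring.
apply: cvgB; first by apply: cvgD; [exact: family_speed_cvg|exact: cvg_cst].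
apply: cvgM; first exact: cvg_cst.
apply: cvgD; last exact: cvg_cst.
suff : inner (expcol (b_ e) (w_ e s)) (M *m (y - p)) @[e --> G] --> \sum_(i < d) (0 : R).
  by rewrite big1_eq.
apply: cvg_sum_ord => i.
have [wi|wi] := eqVneq (wb s i 0) 0.
  have -> : (M *m (y - p)) i 0 = 0.
    have fd := wd i; have h := local_max_derive s_gt0 fd.
    have e : (- (M *m (y - p))) i 0 = - (M *m (y - p)) i 0 by rewrite [LHS]mxE.
    rewrite e in h.
    apply/eqP; rewrite -oppr_eq0; apply/eqP; apply: h => t t0.
    by rewrite wi; exact: limit_flow_le0.
  by under eq_cvg do rewrite mulr0; exact: cvg_cst.
rewrite -[X in _ --> X](mul0r ((M *m (y - p)) i 0)).
apply: cvgM; last exact: cvg_cst.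
under eq_cvg do rewrite mxE.
by apply: family_expcol_cvg0; [exact: ltW|rewrite lt_neqAle wi w0'].
Qed.

Lemma family_mulmx_expcol_cvg i :
  (M *m expcol (b_ e) (w_ e s)) i 0 @[e --> G] --> (M *m y) i 0.
Proof.
apply/cvgrPdist_le => k k0.
have D0 : 0 < 1 + M i i by rewrite ltr_pwDl ?(diag_ge0 M_psd).
have k10 : 0 < k ^+ 2 / (1 + M i i) by rewrite divr_gt0 ?exprn_gt0.
have /cvgr_le /(_ _ k10) := family_expcol_cvg.
apply: filterS => e he.
have : (M *m (expcol (b_ e) (w_ e s) - y)) i 0 ^+ 2 <= k ^+ 2.
  apply: le_trans (mulmx_coord_sq M_sym M_psd _ i) _.
  apply: le_trans (ler_wpM2l (diag_ge0 M_psd i) he) _.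
  by rewrite mulrA ler_pdivrMr // mulrC ler_wpM2l ?sqr_ge0 // lerDr.
have -> : (M *m (expcol (b_ e) (w_ e s) - y)) i 0 =
    (M *m expcol (b_ e) (w_ e s)) i 0 - (M *m y) i 0.
  by rewrite mulmxBr colB.
rewrite distrC.
by rewrite -[X in X <= _ -> _]real_normK ?num_real // ler_pXn2r // nnegrE ltW.
Qed.

End at_mirror_time.

(** For fixed [s0], the bound of [integral_speed2_near0] is at most a quantity converging to [B s0];
    [B] is continuous with [B 0 = 0], because [wb 0 - a = M zeta]. In [B], [d%:R] dominates
    [b^-1 mass] at the negative anchor. *)
Lemma family_small_integral K k : 0 <= K -> 0 < k ->
  \forall s0 \near (0 : R)^'+, \forall e \near G,
    (\int[@lebesgue_measure R]_(s in `[0%R, s0])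
      (s * (speed2 M p (b_ e) (w_ e s) + K))%:E <= k%:E)%E.
Proof.
move=> K0 k0.
pose a := w0 - M *m zeta.
pose B s := 2^-1 * (sqf M zeta - V (wb s - a)) - s * (Fb s - d%:R + inner p a) + K / 2 * (s * s).
have Bc : continuous B.
  have Vc : continuous (fun s => V (wb s - a)).
    apply: continuous_pinvf; apply: col_continuousB; first exact: limit_flow_continuous.
    exact: col_continuous_cst.
  move=> s; apply: cvgD; first apply: cvgB.
  - by apply: cvgM; [exact: cvg_cst|apply: cvgB; [exact: cvg_cst|exact: Vc]].
  - apply: cvgM; first exact: cvg_id.
    apply: cvgD; last exact: cvg_cst.
    by apply: cvgB; [exact: limit_pot_continuous|exact: cvg_cst].
  by apply: cvgM; [exact: cvg_cst|apply: cvgM; exact: cvg_id].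
have B0 : B 0 = 0.
  have -> : B 0 = 2^-1 * (sqf M zeta - V (M *m zeta)).
    by rewrite /B limit_flow0 /a opprB [w0 + _]addrC subrK; ring.
  by rewrite /V pinvf_mul // subrr mulr0.
have nB : \forall s0 \near (0 : R)^'+, B s0 < k / 2.
  have /cvgr_lt : B s @[s --> (0 : R)^'+] --> B 0 by apply: cvg_at_right_filter; exact: Bc.
  by apply; rewrite B0 divr_gt0.
have [eta eta0 heta] := family_eta.
near=> s0.
have s00 : 0 < s0 by near: s0; exact: nbhs_right_gt.
have Bs0 : B s0 < k by apply: lt_trans (_ : k / 2 < k); [near: s0|rewrite ltr_pdivrMr // mulr_natr mulr2n ltrDl].
pose Be e := 2^-1 * (sqf M zeta - V (w_ e s0 - a_ e))
  - s0 * (pot p (b_ e) (w_ e s0) - d%:R + inner p (a_ e)) + K / 2 * (s0 * s0).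
have ai i : a_ e i 0 @[e --> G] --> a i 0.
  under eq_cvg do rewrite mxE.
  by rewrite mxE; apply: cvgD; [exact: w0_cvg|exact: cvg_cst].
have wai i : (w_ e s0 - a_ e) i 0 @[e --> G] --> (wb s0 - a) i 0.
  under eq_cvg do rewrite mxE [(- a_ _) _ _]mxE.
  rewrite mxE [(- a) _ _]mxE; apply: cvgB; last exact: ai.
  by apply: limit_flow_cvg; exact: ltW.
have Bec : Be e @[e --> G] --> B s0.
  apply: cvgD; last exact: cvg_cst.
  apply: cvgB.
    apply: cvgM; first exact: cvg_cst.
    apply: cvgB; first exact: cvg_cst.
    apply: inner_cvg => // i; rewrite mxE; under eq_cvg do rewrite mxE.
    by apply: cvg_sum_ord => j; apply: cvgM; [exact: cvg_cst|exact: wai].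
  apply: cvgM; first exact: cvg_cst.
  apply: cvgD; last by apply: inner_cvg => i; [exact: cvg_cst|exact: ai].
  by apply: cvgB; [exact: family_pot_cvg|exact: cvg_cst].
have nBe : \forall e \near G, Be e <= k by have /cvgr_le := Bec; apply.
near=> e.
have b1 : 1 <= b_ e by near: e; exact: family_b_ge.
have b0 := lt_le_trans ltr01 b1.
have fe : entropic_flow M p (b_ e) (w_ e) by near: e.
have ae : forall i, a_ e i 0 <= - eta by near: e.
have hBe : Be e <= k by near: e.
apply: le_trans (integral_speed2_near0 M_sym M_psd MPM b0 fe (family_anchor_span e) K0 s00) _.
rewrite lee_fin; apply: le_trans hBe; rewrite /Be -/V family_anchor0 expr2 lerD2r lerD2l lerN2.
rewrite ler_pM2l // -addrA lerD2l.
have ma : (b_ e)^-1 * mass (b_ e) (a_ e) <= d%:R.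
  rewrite -[leRHS]mul1r ler_pM ?mass_ge0 ?invr_ge0 ?(ltW b0) //.
    by rewrite invf_le1.
  rewrite /mass -[d in leRHS]card_ord -sum1_card natr_sum ler_sum // => j _.
  rewrite -expR0 ler_expR mulr_ge0_le0 ?(ltW b0) // (le_trans (ae j)) //.
  by rewrite oppr_le0 ltW.
by rewrite /pot; lra.
Unshelve. all: by end_near. Qed.

End flow_family.

(** * Convergence of integrals along sequences *)

Section flow_sequence.
Context {R : realType} {d : nat}.
Variables (M P : 'M[R]_d) (p : 'cV[R]_d).
Hypothesis M_sym : M^T = M.
Hypothesis M_psd : forall x : 'cV[R]_d, 0 <= inner x (M *m x).
Hypothesis MPM : M *m P *m M = M.
Variables (b_ : nat -> R) (w_ : nat -> R -> 'cV[R]_d) (w0 zeta : 'cV[R]_d).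
Hypothesis b_cvg : b_ n @[n --> \oo] --> +oo.
Hypothesis fl : forall n, entropic_flow M p (b_ n) (w_ n).
Hypothesis w0_cvg : forall i, w_ n 0 i 0 @[n --> \oo] --> w0 i 0.
Hypothesis w0_le0 : forall i, w0 i 0 <= 0.
Hypothesis w0_anchor : forall i, (w0 - M *m zeta) i 0 < 0.
Local Notation wb := (limit_flow \oo w_).
Local Notation mu := (@lebesgue_measure R).
Variable xb : R -> 'cV[R]_d.
Hypothesis xb_mirror : {ae mu, forall t, 0 <= t -> mirror_at M p wb (xb t) t}.
Variable S : R.
Hypothesis S_gt0 : 0 < S.
Implicit Types (s t k : R).

Let flN : \forall n \near \oo, entropic_flow M p (b_ n) (w_ n).
Proof. exact: nearW. Qed.

Let x_ n s := expcol (b_ n) (w_ n s).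
Let spd n s := speed2 M p (b_ n) (w_ n s).
Let good s := 0 < s /\ mirror_at M p wb (xb s) s.

Let good_ae : {ae mu, forall s, 0 <= s -> good s}.
Proof.
apply: ae_imply2 xb_mirror (@ae_neq0 R) => s h s_neq0 s0; split; last exact: h.
by rewrite lt_neqAle eq_sym s_neq0.
Qed.

Let spd_ge0 n s : 0 <= spd n s.
Proof. exact: sqf_ge0. Qed.

Let spd_cvg s : good s -> spd n s @[n --> \oo] --> sqf M (xb s - p).
Proof.
by move=> [s0 sm]; exact: (family_speed_cvg M_sym M_psd MPM b_cvg flN w0_cvg w0_le0 w0_anchor s0 sm).
Qed.

Let spd_le s : good s -> sqf M (xb s - p) <= sqf M p.
Proof.
by move=> [s0 sm]; exact: (mirror_speed_le M_sym M_psd MPM b_cvg flN w0_cvg w0_le0 w0_anchor s0 sm).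
Qed.

Let grad_cvg s i : good s -> (M *m x_ n s) i 0 @[n --> \oo] --> (M *m xb s) i 0.
Proof.
move=> [s0 sm]; apply: (family_mulmx_expcol_cvg M_sym M_psd MPM b_cvg flN w0_cvg w0_le0 w0_anchor s0 sm).
Qed.

Let grad_cont n i : continuous (fun s => (M *m x_ n s) i 0).
Proof. by move: i; apply: col_continuous_mulmx; exact: col_continuous_expcol (fl n). Qed.

Let spd_cont n : continuous (spd n).
Proof. exact: continuous_speed2 (fl n). Qed.

(** [psi] is the integrand of interest, built on the arbitrary [xb]; [phi] is a Borel version
    agreeing with it at almost every time. In the domination, [sqf M p] accounts for the limit
    speed. *)
Let dominated_small (A : R) (phi psi : nat -> R -> R) : 0 <= A ->
  (forall n, measurable_fun `[0, S] (phi n)) -> (forall n s, 0 <= phi n s) ->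
  (forall n s, 0 <= psi n s) ->
  (forall s n, good s -> psi n s = phi n s) ->
  (forall s, good s -> phi n s @[n --> \oo] --> 0) ->
  (forall s n, good s -> phi n s <= A * (spd n s + sqf M p)) ->
  forall k, 0 < k -> \forall n \near \oo,
    (\int[mu]_(s in `[0%R, S]) (psi n s * s)%:E <= k%:E)%E.
Proof.
move=> A0 mphi phi0 psi0 psiE phi_cvg phi_le k k0.
have p0 : 0 <= sqf M p by exact: sqf_ge0.
have := @integral_small R S A phi (fun n s => spd n s + sqf M p) S_gt0 A0 mphi phi0.
have mv n : measurable_fun `[0, S] (fun s => spd n s + sqf M p).
  apply: continuous_measurable_itv => s; apply: cvgD; last exact: cvg_cst.
  exact: spd_cont.
move=> /(_ mv); have v0 n s : 0 <= spd n s + sqf M p by rewrite addr_ge0.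
move=> /(_ v0); have h1 : {ae mu, forall s, 0 < s <= S -> phi n s @[n --> \oo] --> 0}.
  by apply: ae_imply good_ae => s h /andP[s0 _]; exact/phi_cvg/h/ltW.
move=> /(_ h1).
have h2 : {ae mu, forall s, 0 < s <= S -> forall n, phi n s <= A * (spd n s + sqf M p)}.
  by apply: ae_imply good_ae => s h /andP[s0 _] n; exact/phi_le/h/ltW.
move=> /(_ h2).
have h3 s0 : 0 < s0 -> exists C : R, \forall n \near \oo,
     forall s, s0 <= s <= S -> spd n s + sqf M p <= C.
  move=> s00.
  have [C hC] := family_speed_mass_bound M_sym M_psd MPM b_cvg flN w0_cvg w0_anchor S s00.
  exists (C + sqf M p); apply: filterS hC => n h s hs.
  by rewrite lerD2r; have [] := h s hs.
have h4 k' : 0 < k' -> \forall s0 \near (0 : R)^'+, \forall n \near \oo,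
     (\int[mu]_(s in `[0%R, s0]) (s * (spd n s + sqf M p))%:E <= k'%:E)%E.
  move=> k'0; exact: (family_small_integral M_sym M_psd MPM b_cvg flN
    w0_cvg w0_le0 w0_anchor p0 k'0).
move=> /(_ h3) /(_ h4) /(_ k k0).
apply: filterS => n; apply: le_trans.
have I0 s : `[0, S]%classic s -> 0 <= s by rewrite /= in_itv /= => /andP[].
apply: integral_le_ae => //.
- by move=> s /I0 s0; rewrite lee_fin mulr_ge0.
- by move=> s /I0 s0; rewrite lee_fin mulr_ge0.
- by apply/measurable_EFinP; apply: measurable_funM => //; exact: measurable_id.
by apply: ae_imply good_ae => s h /I0 s0; rewrite psiE //; exact: h.
Qed.

Lemma grad_integral_small k : 0 < k -> \forall n \near \oo,
  (\int[mu]_(s in `[0%R, S])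
    ((\sum_i ((M *m x_ n s) i 0 - (M *m xb s) i 0) ^+ 2) * s)%:E <= k%:E)%E.
Proof.
pose h i := lim_rep (fun n s => (M *m x_ n s) i 0).
have hE s i : good s -> h i s = (M *m xb s) i 0.
  by move=> gs; apply: lim_repE; exact: grad_cvg.
have tr0 : 0 <= \sum_j M j j by apply: sumr_ge0 => j _; exact: diag_ge0 M_psd j.
apply: (@dominated_small (2 * \sum_j M j j)
  (fun n s => \sum_i ((M *m x_ n s) i 0 - h i s) ^+ 2)).
- by rewrite mulr_ge0.
- move=> n; apply: measurable_sum => i.
  apply: measurable_funX; apply: measurable_funB.
    exact: continuous_measurable_itv.
  apply: measurable_lim_rep => m; exact: continuous_measurable_itv.
- by move=> n s; apply: sumr_ge0 => i _; exact: sqr_ge0.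
- by move=> n s; apply: sumr_ge0 => i _; exact: sqr_ge0.
- by move=> s n gs; apply: eq_bigr => i _; rewrite hE.
- move=> s gs; suff : \sum_i ((M *m x_ n s) i 0 - h i s) ^+ 2 @[n --> \oo]
      --> \sum_(i < d) ((M *m xb s) i 0 - h i s) ^+ 2.
    by rewrite [X in _ --> X]big1 // => i _; rewrite hE // subrr expr0n.
  apply: cvg_sum_ord => i; apply: cvg_sqr; apply: cvgB; last exact: cvg_cst.
  exact: grad_cvg.
move=> s n gs.
have step i : ((M *m x_ n s) i 0 - h i s) ^+ 2 <= M i i * (2 * (spd n s + sqf M p)).
  rewrite hE //.
  have -> : (M *m x_ n s) i 0 - (M *m xb s) i 0 = (M *m (x_ n s - xb s)) i 0.
    by rewrite mulmxBr colB.
  apply: le_trans (mulmx_coord_sq M_sym M_psd _ i) _.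
  rewrite ler_wpM2l ?(diag_ge0 M_psd) //.
  have -> : x_ n s - xb s = (x_ n s - p) + (-1) *: (xb s - p).
    by apply/matrixP => a b; rewrite !mxE; ring.
  (* Parallelogram inequality: [|x - xb|_M^2 <= 2 (|x - p|_M^2 + |xb - p|_M^2)]. *)
  have := sqf_ge0 M_psd ((x_ n s - p) + 1 *: (xb s - p)).
  rewrite !sqfDZ //; have := spd_le gs.
  rewrite /spd /speed2 -/(x_ n s); lra.
apply: le_trans (ler_sum _ (fun i _ => step i)) _.
by rewrite -mulr_suml mulrCA mulrA.
Qed.

Lemma speed_integral_small k : 0 < k -> \forall n \near \oo,
  (\int[mu]_(s in `[0%R, S]) (`|spd n s - sqf M (xb s - p)| * s)%:E <= k%:E)%E.
Proof.
pose h := lim_rep spd.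
have hE s : good s -> h s = sqf M (xb s - p).
  by move=> gs; apply: lim_repE; exact: spd_cvg.
apply: (@dominated_small 1 (fun n s => `|spd n s - h s|)) => //.
- move=> n; apply: measurableT_comp => //; apply: measurable_funB.
    exact: continuous_measurable_itv.
  apply: measurable_lim_rep => m; exact: continuous_measurable_itv.
- by move=> s n gs; rewrite hE.
- move=> s gs; suff : `|spd n s - h s| @[n --> \oo] --> `|h s - h s| by rewrite subrr normr0.
  apply: cvg_norm; apply: cvgB; last exact: cvg_cst.
  by rewrite hE //; exact: spd_cvg.
move=> s n gs; rewrite mul1r (le_trans (ler_normB _ _)) // lerD //.
  by rewrite ger0_norm.
by rewrite hE // ger0_norm ?spd_le // sqf_ge0.
Qed.

Lemma grad_ae_measurable i : ae_measurable `[0, S] (fun s => (M *m xb s) i 0).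
Proof.
exists (lim_rep (fun n s => (M *m x_ n s) i 0)).
  by apply: measurable_lim_rep => m; exact: continuous_measurable_itv.
apply: ae_imply good_ae => s h; rewrite /= in_itv /= => /andP[s0 _].
by rewrite (lim_repE (@grad_cvg s i (h s0))).
Qed.

Lemma speed_ae_measurable : ae_measurable `[0, S] (fun s => sqf M (xb s - p)).
Proof.
exists (lim_rep spd).
  by apply: measurable_lim_rep => m; exact: continuous_measurable_itv.
apply: ae_imply good_ae => s h; rewrite /= in_itv /= => /andP[s0 _].
by rewrite (lim_repE (@spd_cvg s (h s0))).
Qed.

End flow_sequence.

(** * From the gradient flow to the dual flow *)

Lemma continuous_max0 {R : realType} {V : topologicalType} (f : R -> V) :
  {within `[0, +oo[, continuous f} -> continuous (fun t : R => f (Num.max t 0)).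
Proof.
move=> fc s.
have mc : (fun t : R => Num.max t 0) @ s --> Num.max s 0.
  by apply: continuous_max; [exact: cvg_id|exact: cvg_cst].
have m0 (t : R) : `[0, +oo[%classic (Num.max t 0).
  by rewrite /= in_itv /= andbT le_max lexx orbT.
have /subspace_continuousP := fc => /(_ _ (m0 s)) fs.
apply: cvg_comp fs => A.
rewrite /within /= => h; have h' := mc _ h.
exact: (@filterS _ (nbhs s) _ _ _ (fun t ht => ht (m0 t)) h').
Qed.

Section gradient_flow.
Context {R : realType} {d : nat}.
Variables (M : 'M[R]_d) (p q : 'cV[R]_d) (c : R) (u0 : 'cV[R]_d) (u : R -> 'cV[R]_d).
Hypothesis M_sym : M^T = M.
Hypothesis qE : q = M *m p.
Hypothesis u_flow : gradient_flow (fun v => quadratic M q c (hadamard v v)) u0 u.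
Hypothesis u0_neq0 : forall i, u0 i 0 != 0.
Implicit Types (s t : R).

Let U t := u (Num.max t 0).
Let a t : 'cV[R]_d := M *m (hadamard (u t) (u t) - p).

Lemma U_continuous : col_continuous U.
Proof.
move=> i t; have [uc _ _] := u_flow.
apply: (continuous_comp (f := U) (g := fun v : 'cV[R]_d => v i 0)).
  exact: (continuous_max0 uc).
exact: coord_continuous.
Qed.

Lemma UE t : 0 <= t -> U t = u t.
Proof. by move=> t0; rewrite /U max_l. Qed.

Lemma u_derive t i : 0 < t -> is_derive t 1 (fun s => u s i 0) (- 2 * u t i 0 * a t i 0).
Proof.
move=> t0; have [_ _ /(_ t t0)] := u_flow.
rewrite grad_quadratic_hadamard // qE -mulmxBr => /col_deriveP /(_ i) h.
by apply: is_derive_eq h _; rewrite !mxE -/(a t); ring.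
Qed.

Lemma U_derive t i : 0 < t -> is_derive t 1 (fun s => U s i 0) (- 2 * U t i 0 * a t i 0).
Proof.
move=> t0; rewrite (UE (ltW t0)).
apply: (near_eq_is_derive _ (u_derive i t0)).
have /cvgr_gt := @cvg_id R (nbhs t) => /(_ 0 t0); apply: filterS => s s0.
by rewrite UE // ltW.
Qed.

(** [u_i' = - 2 a_i u_i], so if [A] bounds [a_i] on [[0, t]], then [u_i^2 e^{4 A s}] is
    nondecreasing and starts positive. This permits the logarithm at every time. *)
Lemma u_neq0 t i : 0 <= t -> u t i 0 != 0.
Proof.
move=> t0.
have ac : col_continuous (fun s => M *m (hadamard (U s) (U s) - p)).
  apply: col_continuous_mulmx; apply: col_continuousB; last exact: col_continuous_cst.
  move=> j; under [X in continuous X]eq_fun do rewrite mxE.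
  by move=> s; apply: cvgM; exact: U_continuous.
have [A hA] : exists A, forall s, 0 <= s <= t -> (M *m (hadamard (U s) (U s) - p)) i 0 <= A.
  have [|x _ hx] := @EVT_max R (fun s => (M *m (hadamard (U s) (U s) - p)) i 0) 0 t t0.
    by apply: continuous_subspaceT; exact: ac.
  by exists ((M *m (hadamard (U x) (U x) - p)) i 0) => s st; apply: hx; rewrite in_itv.
pose f s := U s i 0 * U s i 0 * expR (4 * A * s).
have f0t : f 0 <= f t.
  eapply (derive_ge0_le t0).
  - apply: continuous_subspaceT => s; apply: cvgM.
      by apply: cvgM; exact: U_continuous.
    apply: continuous_comp; last exact: continuous_expR.
    by apply: cvgM; [exact: cvg_cst|exact: cvg_id].
  - move=> s /andP[s0 _].
    exact: is_deriveM_fun (is_deriveM_fun (U_derive i s0) (U_derive i s0))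
      (is_derive_expR_fun (is_derive_lin (4 * A) s)).
  move=> s /andP[s0 st] /=.
  have hs : 0 <= s <= t by rewrite !ltW.
  have := hA s hs; rewrite (UE (ltW s0)) -/(a s) => h.
  set e := expR _; set v := u s i 0; set k := a s i 0 in h *.
  rewrite (_ : _ + _ = 4 * (A - k) * (v * v * e)); last by ring.
  apply: mulr_ge0; first by rewrite mulr_ge0 // subr_ge0.
  by rewrite -expr2 mulr_ge0 ?sqr_ge0 ?expR_ge0.
apply/eqP => ut0; move: f0t; rewrite /f !UE // ut0 !mul0r mulr0 expR0 mulr1 -expr2.
have [_ -> _] := u_flow.
rewrite leNgt => /negP; apply.
by rewrite lt_neqAle sqr_ge0 eq_sym sqrf_eq0 u0_neq0.
Qed.

Section scaled.
Variable mu : R.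
Hypothesis mu_gt0 : 0 < mu.

(** This is [log x / (4 mu)] in the slow time, since [log x = 2 log |u|]. *)
Definition dual_path s : 'cV[R]_d := (2 * mu)^-1 *: log_abs (U (mu * s)).

Lemma ln_norm_sqr (x : R) : x != 0 -> ln `|x| = 2^-1 * ln (x * x).
Proof.
move=> x0; have nx : 0 < `|x| by rewrite normr_gt0.
have -> : x * x = `|x| * `|x| by rewrite -!expr2 real_normK ?num_real.
by rewrite lnM ?posrE //; field.
Qed.

Lemma dual_path0 : dual_path 0 = (2 * mu)^-1 *: log_abs u0.
Proof. by rewrite /dual_path mulr0 UE //; have [_ -> _] := u_flow. Qed.

Lemma expcol_dual_path s : 0 <= s ->
  expcol (4 * mu) (dual_path s) = hadamard (u (mu * s)) (u (mu * s)).
Proof.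
move=> s0; have ms : 0 <= mu * s by rewrite mulr_ge0 // ltW.
apply/matrixP => i j; rewrite (ord1 j) !mxE UE //.
have u_n0 := u_neq0 i ms.
rewrite ln_norm_sqr // (_ : 4 * mu * _ = ln (u (mu * s) i 0 * u (mu * s) i 0)).
  by rewrite lnK // posrE -expr2 lt_neqAle sqr_ge0 eq_sym sqrf_eq0 u_n0.
by field; rewrite gt_eqF.
Qed.

(** [(log |u|)' = - 2 M (x - p)], and the factor [2 mu] produced with the time change cancels the
    normalization. *)
Lemma dual_path_flow : entropic_flow M p (4 * mu) dual_path.
Proof.
have Un0 s i : U s i 0 != 0 by apply: u_neq0; rewrite le_max lexx orbT.
have U2 s i : 0 < U s i 0 * U s i 0.
  by rewrite -expr2 lt_neqAle sqr_ge0 eq_sym sqrf_eq0 Un0.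
have dE i : (fun s => dual_path s i 0) =
    (fun s => (2 * mu)^-1 * (2^-1 * ln (U (mu * s) i 0 * U (mu * s) i 0))).
  by apply/funext => s; rewrite !mxE ln_norm_sqr.
split=> [i|s s0 i]; rewrite dE.
  move=> s; apply: cvgM; first exact: cvg_cst.
  apply: cvgM; first exact: cvg_cst.
  apply: (continuous_comp (f := fun s => U (mu * s) i 0 * U (mu * s) i 0)); last exact: continuous_ln.
  have Umc : {for s, continuous (fun s => U (mu * s) i 0)}.
    apply: (continuous_comp (f := fun s => mu * s) (g := fun t => U t i 0)).
      by apply: cvgM; [exact: cvg_cst|exact: cvg_id].
    exact: U_continuous.
  by apply: cvgM; exact: Umc.
have ms : 0 < mu * s by rewrite mulr_gt0.
have d1 : is_derive s 1 (fun s => U (mu * s) i 0) (- 2 * U (mu * s) i 0 * a (mu * s) i 0 * mu).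
  exact: (@is_derive1_comp _ (fun t => U t i 0) (fun s => mu * s) s _ _ (U_derive i ms) (is_derive_lin mu s)).
have d2 := is_deriveM_fun d1 d1.
have d3 := @is_derive1_comp _ (@ln R) (fun s => U (mu * s) i 0 * U (mu * s) i 0) s _ _
  (is_derive1_ln (U2 (mu * s) i)) d2.
have d4 := is_deriveZ_fun (2 * mu)^-1 (is_deriveZ_fun 2^-1 d3).
apply: is_derive_eq d4 _; rewrite expcol_dual_path ?(ltW s0) // [RHS]mxE -/(a (mu * s)).
by field; rewrite Un0 gt_eqF.
Qed.

End scaled.
End gradient_flow.

(** * Convergence in weighted Lebesgue spaces *)

Section Lp.
Context {R : realType}.
Local Notation mu := (@lebesgue_measure R).

Lemma enorm_powR2 d (x : 'cV[R]_d) : enorm x `^ 2 = \sum_i x i 0 ^+ 2.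
Proof.
rewrite -[2]/(2%:R) powR_mulrn ?sqrtr_ge0 // sqr_sqrtr.
  by apply: eq_bigr => i _; rewrite expr2.
by apply: sumr_ge0 => i _; rewrite -expr2 sqr_ge0.
Qed.

Lemma enorm_scalar (x : R) : enorm (x%:M : 'cV[R]_1) = `|x|.
Proof. by rewrite /enorm /inner big_ord1 !mxE eqxx mulr1n -expr2 sqrtr_sqr. Qed.

Variables (S p : R).
Hypothesis p_gt0 : 0 < p.

Let I0 (s : R) : `[0, S]%classic s -> 0 <= s.
Proof. by rewrite /= in_itv /= => /andP[]. Qed.

Lemma Lp_integral_ge0 n (f : R -> 'cV[R]_n) :
  (0 <= \int[mu]_(s in `[0%R, S]) (enorm (f s) `^ p * s)%:E)%E.
Proof.
apply: integral_ge0 => s /I0 s0; by rewrite lee_fin mulr_ge0 ?powR_ge0.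
Qed.

Lemma Lp_norm_le n (f : R -> 'cV[R]_n) (k : R) : 0 <= k ->
  (\int[mu]_(s in `[0%R, S]) (enorm (f s) `^ p * s)%:E <= (k `^ p)%:E)%E ->
  (Lp_norm S p f <= k%:E)%E.
Proof.
move=> k0 h; rewrite /Lp_norm.
have -> : k%:E = ((k `^ p)%:E `^ p^-1)%E.
  by rewrite poweR_EFin -powRrM divff ?gt_eqF // powRr1.
apply: gt0_ler_poweR => //; first by rewrite invr_ge0 ltW.
  by rewrite in_itv /= leey andbT Lp_integral_ge0.
by rewrite in_itv /= leey andbT lee_fin powR_ge0.
Qed.

Lemma Lp_norm_cvg0 n T (F : set_system T) (f_ : T -> R -> 'cV[R]_n) : Filter F ->
  (forall k : R, 0 < k -> \forall e \near F,
    (\int[mu]_(s in `[0%R, S]) (enorm (f_ e s) `^ p * s)%:E <= k%:E)%E) ->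
  Lp_norm S p (f_ e) @[e --> F] --> 0%E.
Proof.
move=> FF h.
have N0 e : (0 <= Lp_norm S p (f_ e))%E by exact: poweR_ge0.
have le k : 0 < k -> \forall e \near F, (Lp_norm S p (f_ e) <= k%:E)%E.
  move=> k0; have := h _ (powR_gt0 p k0); apply: filterS => e; exact/Lp_norm_le/ltW.
have fin : \forall e \near F, Lp_norm S p (f_ e) \is a fin_num.
  apply: filterS (le 1 ltr01) => e h1; rewrite ge0_fin_numE //.
  exact: le_lt_trans h1 (ltry _).
apply/fine_cvgP; split => //; apply/cvgrPdist_le => k k0 /=.
apply: filterS2 fin (le k k0) => e fe; rewrite sub0r normrN ger0_norm ?fine_ge0 //.
by rewrite -lee_fin fineK.
Qed.

Lemma in_Lp_bounded n (f : R -> 'cV[R]_n) (C : R) : 0 < S ->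
  (forall i, ae_measurable `[0, S] (fun s => f s i 0)) ->
  {ae mu, forall s, 0 <= s <= S -> enorm (f s) `^ p <= C} ->
  in_Lp S p f.
Proof.
move=> S0 mf bf; split => //.
apply: poweR_lty.
have C0 : 0 <= `|C| * S by rewrite mulr_ge0 // ltW.
apply: (@le_lt_trans _ _ (\int[mu]_(s in `[0%R, S]) (`|C| * S)%:E)%E); last first.
  rewrite integral_cst //= lebesgue_measure_itv /=.
  by case: ifP => _; rewrite ?mule0 ?ltry // -EFinD -EFinM ltry.
apply: integral_le_ae => //.
- by move=> s /I0 s0; rewrite lee_fin mulr_ge0 ?powR_ge0.
apply: ae_imply bf => s h hs; move: (hs); rewrite /= in_itv /= => sS; rewrite lee_fin.
apply: ler_pM; rewrite ?powR_ge0 ?(I0 hs) //; last by case/andP: sS.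
exact: le_trans (h sS) (ler_norm _).
Qed.

End Lp.

Lemma eq_ae_measurable {R : realType} (D : set R) (f g : R -> R) :
  (forall s, D s -> f s = g s) -> ae_measurable D g -> ae_measurable D f.
Proof.
move=> fg [h mh hE]; exists h => //.
by apply: ae_imply hE => s h' Ds; rewrite fg // h'.
Qed.

Section ae_measurable.
Context {R : realType}.
Local Notation mu := (@lebesgue_measure R).
Variable D : set R.
Implicit Types f g : R -> R.

Lemma measurable_ae_measurable f : measurable_fun D f -> ae_measurable D f.
Proof. by move=> mf; exists f => //; apply: aeW. Qed.

Lemma ae_measurable_comp f (g : R -> R) : measurable_fun [set: R] g ->
  ae_measurable D f -> ae_measurable D (g \o f).
Proof.
move=> mg [h mh hE]; exists (g \o h); first exact: measurableT_comp.
by apply: ae_imply hE => s h' /h' /= ->.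
Qed.

End ae_measurable.

Lemma cvg_at_right0 {R : realType} (v : nat -> R) : (forall n, 0 < v n) ->
  v n @[n --> \oo] --> 0 -> v n @[n --> \oo] --> (0 : R)^'+.
Proof.
move=> v0 vc A hA; have := vc _ hA; rewrite /= /nbhs /=.
by apply: filterS => n /= h; exact: h.
Qed.

(** * Transfer from sequences to the limit at [0^'+] *)

Section flow_right.
Context {R : realType} {d : nat}.
Variables (M P : 'M[R]_d) (p : 'cV[R]_d).
Hypothesis M_sym : M^T = M.
Hypothesis M_psd : forall x : 'cV[R]_d, 0 <= inner x (M *m x).
Hypothesis MPM : M *m P *m M = M.
Variables (b_ : R -> R) (w_ : R -> R -> 'cV[R]_d) (w0 zeta : 'cV[R]_d).
Hypothesis b_cvg : b_ e @[e --> 0^'+] --> +oo.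
Hypothesis fl : \forall e \near (0 : R)^'+, entropic_flow M p (b_ e) (w_ e).
Hypothesis w0_cvg : forall i, w_ e 0 i 0 @[e --> 0^'+] --> w0 i 0.
Hypothesis w0_le0 : forall i, w0 i 0 <= 0.
Hypothesis w0_anchor : forall i, (w0 - M *m zeta) i 0 < 0.
Local Notation wb := (limit_flow (0 : R)^'+ w_).
Local Notation mu := (@lebesgue_measure R).
Variable xb : R -> 'cV[R]_d.
Hypothesis xb_mirror : {ae mu, forall t, 0 <= t -> mirror_at M p wb (xb t) t}.
Variable S : R.
Hypothesis S_gt0 : 0 < S.
Implicit Types (s t k : R).

(** One limit curve, hence one primal variable, serves every sequence, as the passage from sequences
    to [0^'+] requires. *)
Lemma limit_flow_seq (v : nat -> R) : (forall n, 0 < v n) ->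
  v n @[n --> \oo] --> 0 -> limit_flow \oo (w_ \o v) = wb.
Proof.
move=> v0 vc; apply/funext => t; apply/matrixP => i j; rewrite (ord1 j) [LHS]mxE.
have -> : wb t i 0 = wb (Num.max t 0) i 0.
  by rewrite !mxE -maxA maxxx.
have m0 : 0 <= Num.max t 0 by rewrite le_max lexx orbT.
have h : w_ e (Num.max t 0) i 0 @[e --> 0^'+] --> wb (Num.max t 0) i 0.
  exact: (limit_flow_cvg M_sym M_psd MPM b_cvg fl w0_cvg w0_le0 w0_anchor m0).
have h' : w_ (v n) (Num.max t 0) i 0 @[n --> \oo] --> wb (Num.max t 0) i 0.
  exact: cvg_comp (cvg_at_right0 v0 vc) h.
by have /cvg_lim := h'; apply.
Qed.

Section sequence.
Variable v : nat -> R.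
Hypothesis v_gt0 : forall n, 0 < v n.
Hypothesis v_cvg0 : v n @[n --> \oo] --> 0.
Let vc := cvg_at_right0 v_gt0 v_cvg0.

Lemma seq_b_cvg : b_ (v n) @[n --> \oo] --> +oo.
Proof. exact: cvg_comp vc b_cvg. Qed.

Lemma seq_w0_cvg i : w_ (v n) 0 i 0 @[n --> \oo] --> w0 i 0.
Proof. exact: cvg_comp vc (@w0_cvg i). Qed.

Lemma seq_mirror :
  {ae mu, forall t, 0 <= t -> mirror_at M p (limit_flow \oo (w_ \o v)) (xb t) t}.
Proof. by rewrite limit_flow_seq. Qed.
End sequence.

Lemma right_grad_integral_small k : 0 < k -> \forall e \near (0 : R)^'+,
  (\int[mu]_(s in `[0%R, S])
    ((\sum_i ((M *m expcol (b_ e) (w_ e s)) i 0 - (M *m xb s) i 0) ^+ 2) * s)%:E <= k%:E)%E.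
Proof.
move=> k0; apply: (near_seq fl) => v v0 flv vc.
exact: (grad_integral_small M_sym M_psd MPM (seq_b_cvg v0 vc) flv (seq_w0_cvg v0 vc)
  w0_le0 w0_anchor (seq_mirror v0 vc) S_gt0 k0).
Qed.

Lemma right_speed_integral_small k : 0 < k -> \forall e \near (0 : R)^'+,
  (\int[mu]_(s in `[0%R, S])
    (`|speed2 M p (b_ e) (w_ e s) - sqf M (xb s - p)| * s)%:E <= k%:E)%E.
Proof.
move=> k0; apply: (near_seq fl) => v v0 flv vc.
exact: (speed_integral_small M_sym M_psd MPM (seq_b_cvg v0 vc) flv (seq_w0_cvg v0 vc)
  w0_le0 w0_anchor (seq_mirror v0 vc) S_gt0 k0).
Qed.

Let good_seq : exists v : nat -> R, [/\ forall n, 0 < v n, v n @[n --> \oo] --> 0 &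
  forall n, entropic_flow M p (b_ (v n)) (w_ (v n))].
Proof.
have [r /= r0 hr] := fl.
have h n : 0 < (n.+2%:R : R) by rewrite ltr0n.
have v0 n : 0 < r / n.+2%:R by rewrite divr_gt0.
exists (fun n => r / n.+2%:R); split => // [|n].
  rewrite -[X in _ --> X](mulr0 r); apply: cvgM; first exact: cvg_cst.
  by have := @cvg_harmonic R; rewrite -cvg_shiftS.
apply: hr => //=; rewrite sub0r normrN gtr0_norm // ltr_pdivrMr //.
by rewrite ltr_pMr // ltr1n.
Qed.

Lemma right_grad_ae_measurable i : ae_measurable `[0, S] (fun s => (M *m xb s) i 0).
Proof.
have [v [v0 vc flv]] := good_seq.
exact: (grad_ae_measurable M_sym M_psd MPM (seq_b_cvg v0 vc) flv (seq_w0_cvg v0 vc)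
  w0_le0 w0_anchor (seq_mirror v0 vc)).
Qed.

Lemma right_speed_ae_measurable : ae_measurable `[0, S] (fun s => sqf M (xb s - p)).
Proof.
have [v [v0 vc flv]] := good_seq.
exact: (speed_ae_measurable M_sym M_psd MPM (seq_b_cvg v0 vc) flv (seq_w0_cvg v0 vc)
  w0_le0 w0_anchor (seq_mirror v0 vc)).
Qed.
End flow_right.

Lemma integral_le_ge0 {R : realType} (D : set R) (f g : R -> \bar R) :
  (forall x, D x -> (0 <= f x)%E) -> (forall x, D x -> (f x <= g x)%E) ->
  (\int[@lebesgue_measure R]_(x in D) f x <= \int[@lebesgue_measure R]_(x in D) g x)%E.
Proof.
move=> f0 fg; rewrite !ge0_integralE //; last by move=> x Dx; exact: le_trans (f0 x Dx) (fg x Dx).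
apply: le_ereal_sup => _ [h hf <-]; exists h => // x.
apply: le_trans (hf x) _; rewrite /patch; case: ifP => // /set_mem; exact: fg.
Qed.

(** * Convergence of gradients and losses, and minimality *)

Section loss_convergence.
Context {R : realType} {d : nat}.
Variables (M P : 'M[R]_d) (p q : 'cV[R]_d) (c : R).
Hypothesis M_sym : M^T = M.
Hypothesis M_psd : forall x : 'cV[R]_d, 0 <= inner x (M *m x).
Hypothesis MPM : M *m P *m M = M.
Hypothesis qE : q = M *m p.
Variables (b_ : R -> R) (w_ : R -> R -> 'cV[R]_d) (w0 zeta : 'cV[R]_d).
Hypothesis b_cvg : b_ e @[e --> 0^'+] --> +oo.
Hypothesis fl : \forall e \near (0 : R)^'+, entropic_flow M p (b_ e) (w_ e).
Hypothesis w0_cvg : forall i, w_ e 0 i 0 @[e --> 0^'+] --> w0 i 0.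
Hypothesis w0_le0 : forall i, w0 i 0 <= 0.
Hypothesis w0_anchor : forall i, (w0 - M *m zeta) i 0 < 0.
Local Notation wb := (limit_flow (0 : R)^'+ w_).
Local Notation mu := (@lebesgue_measure R).
Local Notation l := (quadratic M q c).
Variable x_ : R -> R -> 'cV[R]_d.
Hypothesis xE : \forall e \near (0 : R)^'+, forall s : R, 0 <= s -> x_ e s = expcol (b_ e) (w_ e s).
Variable xb : R -> 'cV[R]_d.
Hypothesis xb_mirror : {ae mu, forall t, 0 <= t -> mirror_at M p wb (xb t) t}.
Variable S : R.
Hypothesis S_gt0 : 0 < S.
Implicit Types (s t k : R).

Let K : R := c - 2^-1 * sqf M p.

(** Completing the square with [q = M p]: up to a constant the loss is half the squared speed, so
    its convergence is that of the speed. *)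
Lemma quadraticE x : l x = 2^-1 * sqf M (x - p) + K.
Proof.
rewrite sqfB // /quadratic /K qE (innerC _ x) /sqf; by field.
Qed.

Let good_ae : {ae mu, forall s, 0 <= s -> 0 < s /\ mirror_at M p wb (xb s) s}.
Proof.
apply: ae_imply2 xb_mirror (@ae_neq0 R) => s h s_neq0 s0; split; last exact: h.
by rewrite lt_neqAle eq_sym s_neq0.
Qed.

Let IE s : `[0, S]%classic s -> 0 <= s.
Proof. by rewrite /= in_itv /= => /andP[]. Qed.

Let xb_speed_le : {ae mu, forall s, 0 <= s <= S -> sqf M (xb s - p) <= sqf M p}.
Proof.
apply: ae_imply good_ae => s h /andP[s0 _]; have [s1 sm] := h s0.
exact: (mirror_speed_le M_sym M_psd MPM b_cvg fl w0_cvg w0_le0 w0_anchor s1 sm).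
Qed.

Let b_gt0 : \forall e \near (0 : R)^'+, 0 < b_ e.
Proof. by have /cvgryPgt := b_cvg; apply. Qed.

Let grad_coordE x i : grad l x i 0 = (M *m x) i 0 - q i 0.
Proof. by rewrite grad_quadratic // colB. Qed.

Let grad_enorm_le x : enorm (grad l x) `^ 2 <= (\sum_j M j j) * sqf M (x - p).
Proof.
rewrite enorm_powR2 mulr_suml; apply: ler_sum => i _.
by rewrite grad_quadratic // qE -mulmxBr; exact: mulmx_coord_sq.
Qed.

Let tr_ge0 : 0 <= \sum_j M j j.
Proof. by apply: sumr_ge0 => j _; exact: diag_ge0 M_psd j. Qed.

Lemma grad_cvg_Lp : cvg_Lp S 2 (0 : R)^'+ (fun e s => grad l (x_ e s)) (fun s => grad l (xb s)).
Proof.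
split.
- apply: filterS3 fl xE b_gt0 => e fle xe be.
  apply: (@in_Lp_bounded _ _ _ _ _ ((\sum_j M j j) * speed2 M p (b_ e) (w_ e 0))) => //.
    move=> i; apply: (@eq_ae_measurable _ _ _ (fun s => (M *m expcol (b_ e) (w_ e s)) i 0 - q i 0)).
      by move=> s /IE s0; rewrite grad_coordE xe.
    apply: measurable_ae_measurable; apply: continuous_measurable_itv => s.
    apply: cvgB; last exact: cvg_cst.
    by move: i s; apply: col_continuous_mulmx; exact: col_continuous_expcol fle.
  apply: aeW => s /andP[s0 _]; apply: le_trans (grad_enorm_le _) _.
  by rewrite xe // ler_wpM2l //; exact: (speed2_nincr M_sym be fle (lexx 0) s0).
- apply: (@in_Lp_bounded _ _ _ _ _ ((\sum_j M j j) * sqf M p)) => //.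
    move=> i; apply: (@eq_ae_measurable _ _ _ ((fun a => a - q i 0) \o (fun s => (M *m xb s) i 0))).
      by move=> s _; rewrite /= grad_coordE.
    apply: ae_measurable_comp; first by apply: measurable_funB.
    exact: (right_grad_ae_measurable M_sym M_psd MPM b_cvg fl w0_cvg w0_le0 w0_anchor xb_mirror).
  apply: ae_imply xb_speed_le => s h hs; apply: le_trans (grad_enorm_le _) _.
  by rewrite ler_wpM2l // h.
apply: Lp_norm_cvg0 => // k k0.
have := right_grad_integral_small M_sym M_psd MPM b_cvg fl w0_cvg w0_le0 w0_anchor
  xb_mirror S_gt0 k0.
apply: filterS2 xE => e xe; apply: le_trans; rewrite le_eqVlt; apply/orP; left; apply/eqP.
apply: eq_integral => s; rewrite inE => /IE s0; congr (_ * s)%:E.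
rewrite enorm_powR2; apply: eq_bigr => i _.
by rewrite colB !grad_coordE xe //; congr (_ ^+ 2); ring.
Qed.

Lemma loss_cvg_Lp : cvg_Lp_scalar S 1 (0 : R)^'+ (fun e s => l (x_ e s)) (fun s => l (xb s)).
Proof.
have sqf0 x := sqf_ge0 M_psd x.
have le x B : sqf M (x - p) <= B -> enorm ((l x)%:M : 'cV[R]_1) `^ 1 <= 2^-1 * B + `|K|.
  move=> h; rewrite enorm_scalar powRr1 // quadraticE (le_trans (ler_normD _ _)) //.
  by rewrite lerD2r ger0_norm ?mulr_ge0 // ler_wpM2l.
have ent (a : R) (i : 'I_1) : (a%:M : 'cV[R]_1) i 0 = a by rewrite (ord1 i) !mxE eqxx.
split.
- apply: filterS3 fl xE b_gt0 => e fle xe be.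
  apply: (@in_Lp_bounded _ _ _ _ _ (2^-1 * speed2 M p (b_ e) (w_ e 0) + `|K|)) => //.
    move=> i; apply: (@eq_ae_measurable _ _ _ (fun s => 2^-1 * speed2 M p (b_ e) (w_ e s) + K)).
      by move=> s /IE s0; rewrite ent xe // quadraticE.
    apply: measurable_ae_measurable; apply: continuous_measurable_itv => s.
    apply: cvgD; last exact: cvg_cst.
    apply: cvgM; first exact: cvg_cst.
    exact: (continuous_speed2 fle).
  apply: aeW => s /andP[s0 _]; apply: le.
  by rewrite xe //; exact: (speed2_nincr M_sym be fle (lexx 0) s0).
- apply: (@in_Lp_bounded _ _ _ _ _ (2^-1 * sqf M p + `|K|)) => //.
    move=> i; apply: (@eq_ae_measurable _ _ _ ((fun a => 2^-1 * a + K) \o (fun s => sqf M (xb s - p)))).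
      by move=> s _; rewrite ent quadraticE.
    apply: ae_measurable_comp; first by apply: measurable_funD => //; exact: measurable_funM.
    exact: (right_speed_ae_measurable M_sym M_psd MPM b_cvg fl w0_cvg w0_le0 w0_anchor xb_mirror).
  by apply: ae_imply xb_speed_le => s h hs; apply: le; exact: h.
apply: Lp_norm_cvg0 => // k k0.
have := right_speed_integral_small M_sym M_psd MPM b_cvg fl w0_cvg w0_le0 w0_anchor
  xb_mirror S_gt0 k0.
apply: filterS2 xE => e xe; apply: le_trans; apply: integral_le_ge0.
- by move=> s /IE s0; rewrite lee_fin mulr_ge0 ?powR_ge0.
move=> s /IE s0; rewrite lee_fin ler_wpM2r //.
have -> : (l (x_ e s))%:M - (l (xb s))%:M = (l (x_ e s) - l (xb s))%:M :> 'cV[R]_1.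
  by rewrite raddfB.
rewrite enorm_scalar powRr1 // !quadraticE xe // /speed2 opprD addrACA subrr addr0 -mulrBr.
by rewrite normrM ger0_norm // ler_piMl // invf_le1 // ler1n.
Qed.

Lemma primal_argmin_ae :
  {ae mu, forall s, 0 <= s -> argmin (feasible (wb s)) l (xb s)}.
Proof.
have wb_le0 t i : 0 <= t -> wb t i 0 <= 0.
  by move=> t0; exact: (limit_flow_le0 M_sym M_psd MPM b_cvg fl w0_cvg w0_le0 w0_anchor i t0).
apply: ae_imply good_ae => s h s0; have [s1 sm] := h s0.
exact: (mirror_at_argmin c M_sym M_psd qE s1 wb_le0 sm).
Qed.

(** A cluster point need not equal [xb s], but it is feasible, and the speed along the sequence
    tends both to its squared distance from [p] and to that of [xb s]. The two losses are thus
    equal. *)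
Lemma cluster_argmin_ae (v : nat -> R) (yb : R -> 'cV[R]_d) : (forall n, 0 < v n) ->
  v n @[n --> \oo] --> 0 ->
  {ae mu, forall s, s \in `[0, S] -> x_ (v n) s @[n --> \oo] --> yb s} ->
  {ae mu, forall s, s \in `[0, S] -> argmin (feasible (wb s)) l (yb s)}.
Proof.
move=> v0 vc yb_cvg; have vr := cvg_at_right0 v0 vc.
have xv : \forall n \near \oo, forall s, 0 <= s -> x_ (v n) s = expcol (b_ (v n)) (w_ (v n) s).
  exact: vr _ xE.
apply: ae_imply2 yb_cvg (ae_imply2 (fun s a b => conj a b) good_ae primal_argmin_ae)
  => s ys [gs ms] sS.
have s0 : 0 <= s by move: sS; rewrite in_itv /= => /andP[].
have {}ys := ys sS.
have [s1 sm] := gs s0; have [xf xmin] := ms s0.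
have ysi i : expcol (b_ (v n)) (w_ (v n) s) i 0 @[n --> \oo] --> yb s i 0.
  have h : x_ (v n) s i 0 @[n --> \oo] --> yb s i 0.
    apply: (cvg_comp (fun n => x_ (v n) s) (fun m : 'cV[R]_d => m i 0) ys).
    exact: coord_continuous.
  apply: cvg_trans h; apply: near_eq_cvg.
  by near=> n; rewrite (near xv n _ s s0).
have yb0 i : 0 <= yb s i 0.
  have := ysi i => /(@le_of_cvg R nat \oo _ (fun=> 0) _ 0 _ (cvg_cst 0)); apply.
  by apply: nearW => n; rewrite mxE expR_ge0.
have wb_le0 t i : 0 <= t -> wb t i 0 <= 0.
  by move=> t0; exact: (limit_flow_le0 M_sym M_psd MPM b_cvg fl w0_cvg w0_le0 w0_anchor i t0).
have yf : feasible (wb s) (yb s).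
  split => //; apply: big1 => i _.
  have := wb_le0 s i s0; rewrite le_eqVlt => /orP[/eqP ->|wi]; first by rewrite mul0r.
  have h : expR (b_ e * w_ e s i 0) @[e --> 0^'+] --> 0.
    exact: (family_expcol_cvg0 M_sym M_psd MPM b_cvg fl w0_cvg w0_le0 w0_anchor s0 wi).
  have h' : expcol (b_ (v n)) (w_ (v n) s) i 0 @[n --> \oo] --> 0.
    have h'' : expR (b_ (v n) * w_ (v n) s i 0) @[n --> \oo] --> 0 by exact: cvg_comp vr h.
    by under eq_cvg do rewrite mxE.
  by rewrite (cvg_unique _ (ysi i) h') // mulr0.
split => // z zf; suff -> : l (yb s) = l (xb s) by exact: xmin.
have h1 : speed2 M p (b_ (v n)) (w_ (v n) s) @[n --> \oo] --> sqf M (yb s - p).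
  have h i : (expcol (b_ (v n)) (w_ (v n) s) - p) i 0 @[n --> \oo] --> (yb s - p) i 0.
    rewrite colB; under eq_cvg do rewrite colB.
    by apply: cvgB; [exact: ysi|exact: cvg_cst].
  apply: inner_cvg => // i; rewrite mxE; under eq_cvg do rewrite mxE.
  by apply: cvg_sum_ord => j; apply: cvgM; [exact: cvg_cst|exact: h].
have h2 : speed2 M p (b_ e) (w_ e s) @[e --> 0^'+] --> sqf M (xb s - p).
  exact: (family_speed_cvg M_sym M_psd MPM b_cvg fl w0_cvg w0_le0 w0_anchor s1 sm).
have h3 : speed2 M p (b_ (v n)) (w_ (v n) s) @[n --> \oo] --> sqf M (xb s - p).
  exact: cvg_comp vr h2.
by rewrite !quadraticE (cvg_unique _ h1 h3).
Unshelve. all: by end_near. Qed.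

End loss_convergence.

Theorem theorem4p1 (R : realType) (d : nat) (d_ge1 : (1 <= d)%N)
  (M : 'M[R]_d) (q : 'cV[R]_d) (c : R)
  (M_sym : M^T = M)
  (M_psd : forall x : 'cV[R]_d, 0 <= inner x (M *m x))
  (q_span : colspan M q)
  (u0 : R -> 'cV[R]_d) (u : R -> R -> 'cV[R]_d)
  (u_flow : forall eps : R, 0 < eps ->
     gradient_flow (fun v : 'cV[R]_d => quadratic M q c (hadamard v v))
       (u0 eps) (u eps))
  (u0_neq0 : forall eps : R, 0 < eps -> forall i : 'I_d, u0 eps i 0 != 0)
  (mu_cvg : log_scale (u0 eps) @[eps --> 0^'+] --> +oo)
  (w0 : 'cV[R]_d)
  (w0_cvg :
     (2 * log_scale (u0 eps))^-1 *: log_abs (u0 eps) @[eps --> 0^'+] --> w0)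
  (w0_dom : (@vec_nonpos R d `&` minkowski_sum (@vec_neg R d) (colspan M)) w0) :
  let l := quadratic M q c in
  let g := indicator_fun (@vec_nonneg R d) in
  let xbar_ := fun eps s : R =>
    hadamard (u eps (log_scale (u0 eps) * s)) (u eps (log_scale (u0 eps) * s)) in
  exists wbar : R -> 'cV[R]_d,
    [/\ Lipschitz_mirror_flow g l w0 wbar,
        (forall w : R -> 'cV[R]_d, Lipschitz_mirror_flow g l w0 w ->
           forall s : R, 0 <= s -> w s = wbar s) &
        forall (xbar : R -> 'cV[R]_d) (S : R),
          associated_primal g l wbar xbar -> 0 < S ->
          [/\ cvg_Lp S 2 (0^'+) (fun eps s => grad l (xbar_ eps s))
                (fun s => grad l (xbar s)),
              cvg_Lp_scalar S 1 (0^'+) (fun eps s => l (xbar_ eps s))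
                (fun s => l (xbar s)),
              {ae @lebesgue_measure R, forall s : R, s \in `[0, S] ->
                 is_min_value (feasible (wbar s)) l (l (xbar s))} &
              forall ybar : R -> 'cV[R]_d,
                (exists eps_ : nat -> R,
                   [/\ forall k, 0 < eps_ k,
                       eps_ k @[k --> \oo] --> 0 &
                       {ae @lebesgue_measure R, forall s : R, s \in `[0, S] ->
                          xbar_ (eps_ k) s @[k --> \oo] --> ybar s}]) ->
                {ae @lebesgue_measure R, forall s : R, s \in `[0, S] ->
                   argmin (feasible (wbar s)) l (ybar s)}]].
Proof.
move=> l g xbar_.
have [p _ /esym qE] := q_span.
have MPM : M *m pinvmx M *m M = M by exact: mulmxKpV (submx_refl M).
(* Writing [w0 = n + M zeta] with [n] negative, the anchor of the limit is [n] itself. *)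
have [w0_le0 [n n_lt0 [_ [zeta _ <-] w0E]]] := w0_dom.
have w0_anchor i : (w0 - M *m zeta) i 0 < 0 by rewrite -w0E addrK.
pose mu e := log_scale (u0 e); pose b_ e := 4 * mu e; pose w_ e := dual_path (u e) (mu e).
have mu_gt0 : \forall e \near (0 : R)^'+, 0 < e /\ 0 < mu e.
  apply: filterI; first exact: nbhs_right_gt.
  by have /cvgryPgt := mu_cvg; apply.
have b_cvg : b_ e @[e --> 0^'+] --> +oo.
  by apply/cvgryPge => A; have /cvgryPge/(_ (4^-1 * A)) := mu_cvg; apply: filterS => e;
    rewrite /b_ /mu; lra.
have fl : \forall e \near (0 : R)^'+, entropic_flow M p (b_ e) (w_ e).
  apply: filterS mu_gt0 => e [e0 m0].
  exact: (dual_path_flow M_sym qE (u_flow e e0) (u0_neq0 e e0) m0).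
have w_cvg i : w_ e 0 i 0 @[e --> 0^'+] --> w0 i 0.
  have h : ((2 * mu e)^-1 *: log_abs (u0 e)) i 0 @[e --> 0^'+] --> w0 i 0.
    apply: (cvg_comp (fun e => (2 * mu e)^-1 *: log_abs (u0 e)) (fun v : 'cV[R]_d => v i 0) w0_cvg).
    exact: coord_continuous.
  apply: cvg_trans h; apply: near_eq_cvg; apply: filterS mu_gt0 => e [e0 _].
  by rewrite /w_ (dual_path0 (u_flow e e0)).
have xE : \forall e \near (0 : R)^'+, forall s : R, 0 <= s -> xbar_ e s = expcol (b_ e) (w_ e s).
  apply: filterS mu_gt0 => e [e0 m0] s s0.
  by rewrite (expcol_dual_path M_sym qE (u_flow e e0) (u0_neq0 e e0) m0 s0).
pose wbar := limit_flow (0 : R)^'+ w_.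
have wbar_flow : Lipschitz_mirror_flow g l w0 wbar.
  split; first exact/lipschitzP/(limit_flow_lip M_sym M_psd MPM b_cvg fl w_cvg w0_le0 w0_anchor).
    have [x xm] := limit_flow_mirror M_sym M_psd MPM b_cvg fl w_cvg w0_le0 w0_anchor.
    by exists x; apply/(associated_primalP c M_sym qE).
  exact: (limit_flow0 M_sym M_psd MPM b_cvg fl w_cvg w0_le0 w0_anchor).
exists wbar; split => // [w w_flow s s0|xbar S /(associated_primalP c M_sym qE) xm S_gt0].
  exact: (mirror_flow_unique M_sym M_psd MPM qE w_flow wbar_flow s0).
split.
- exact: (grad_cvg_Lp c M_sym M_psd MPM qE b_cvg fl w_cvg w0_le0 w0_anchor xE xm S_gt0).
- exact: (loss_cvg_Lp c M_sym M_psd MPM qE b_cvg fl w_cvg w0_le0 w0_anchor xE xm S_gt0).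
- have := primal_argmin_ae c M_sym M_psd MPM qE b_cvg fl w_cvg w0_le0 w0_anchor xm.
  apply: ae_imply => s h; rewrite in_itv /= => /andP[/h [xf xmin] _].
  by split; [exists (xbar s)|move=> _ [y yf <-]; exact: xmin].
move=> ybar [v [v0 vc yc]].
exact: (cluster_argmin_ae c M_sym M_psd MPM qE b_cvg fl w_cvg w0_le0 w0_anchor xE xm v0 vc yc).
Qed.
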